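(* Let $(H,R)$ be a semisimple quasi-triangular Hopf algebra over a field $k$ of characteristic zero, and let $A$ be a strongly separable quantum commutative left $H$-module algebra with symmetric separability idempotent $x=x^1\otimes x^2$. Let $B=A\otimes H\otimes A^*$ be the algebra with multiplication $$(a\otimes h\otimes a^* )(b\otimes g\otimes b^* )=\langle b^*,a\rangle\, b\otimes hg\otimes a^*$$ and unit $1_B=x^1\otimes 1_H\otimes (x^2\rightharpoonup\alpha_A)$. Define, for $a\in A$, $h\in H$, $a^*\in A^*$, $$\Delta_B(a\otimes h\otimes a^* )=\big((R_1^2\cdot x^1)a\otimes R_2^1h_{(1)}R_1^1\otimes a^*_{(2)}\big)\otimes\big(x^2\otimes h_{(2)}\otimes a^*_{(1)}\vartriangleleft R_2^2\big),$$ $$\varepsilon_B(a\otimes h\otimes a^* )=\langle\alpha_A,a\rangle\,\varepsilon(h)\,\langle a^*,1_A\rangle,$$ $$S_B(a\otimes h\otimes a^* )=\langle a^*\vartriangleleft R_2^2,x^1\rangle\, x^2\otimes R_1^1S(R_2^1h)\otimes \alpha_A\leftharpoonup(R_1^2\cdot a),$$ and let $$R_B=\big((R_3^2\cdot x_2^1)x_1^1\otimes R_2^1R_3^1\otimes\alpha_{A(1)}\vartriangleleft R_1^2\big)\otimes\big(x_2^2\otimes R_1^1R_2^2\otimes (x_1^2\rightharpoonup\alpha_{A(2)})\big)\in B\otimes B.$$ Then, with coproduct $\Delta_B$, counit $\varepsilon_B$ and antipode $S_B$, $(B,R_B)$ is a quasi-triangular weak Hopf algebra.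
   Context: All algebras and coalgebras are over $k$; Sweedler notation is used and $S$ is the antipode of $H$. A quasi-triangular Hopf algebra is a pair $(H,R)$, $R=R^1\otimes R^2\in H\otimes H$ invertible, with $R^1h_{(1)}\otimes R^2h_{(2)}=h_{(2)}R^1\otimes h_{(1)}R^2$ for all $h\in H$, $(\Delta\otimes id)(R)=R_1^1\otimes R_2^1\otimes R_1^2R_2^2$, $(id\otimes\Delta)(R)=R_1^1R_2^1\otimes R_2^2\otimes R_1^2$. Here $R_i=R_i^1\otimes R_i^2$ are copies of $R$ and $x_i=x_i^1\otimes x_i^2$ are copies of $x$ (lower index: copy; upper index: tensor leg). A left $H$-module algebra $A$ is quantum commutative if $ab=(R^2\cdot b)(R^1\cdot a)$ for all $a,b\in A$. $A$ is strongly separable if it has a symmetric separability idempotent $x=x^1\otimes x^2\in A\otimes A$, i.e. $ax^1\otimes x^2=x^1\otimes x^2a$, $x^1x^2=1_A$, $x^1\otimes x^2=x^2\otimes x^1$ (so $A$ is finite dimensional). $\alpha_A\in A^*$ is determined by $\langle\alpha_A,x^1\rangle x^2=1_A$. For $a,b\in A$, $a^*\in A^*$, $h\in H$: $\langle a\rightharpoonup a^*,b\rangle=\langle a^*,ba\rangle$, $\langle a^*\leftharpoonup a,b\rangle=\langle a^*,ab\rangle$, $\langle a^*\vartriangleleft h,b\rangle=\langle a^*,h\cdot b\rangle$. $A^*$ is the dual coalgebra: $\langle a^*_{(1)},a\rangle\langle a^*_{(2)},b\rangle=\langle a^*,ab\rangle$. The algebra $B$ is identified with $\operatorname{End}A^*\otimes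 H$ via $a\otimes h\otimes a^*\mapsto(b^*\mapsto\langle b^*,a\rangle a^* )\otimes h$. A quasi-triangular weak Hopf algebra is a weak Hopf algebra $L$ with $\mathcal R\in\Delta^{cop}(1)(L\otimes L)\Delta(1)$ such that $\Delta^{cop}(l)\mathcal R=\mathcal R\Delta(l)$ for $l\in L$, $(id\otimes\Delta)\mathcal R=\mathcal R^{13}\mathcal R^{12}$, $(\Delta\otimes id)\mathcal R=\mathcal R^{13}\mathcal R^{23}$, and there is $\bar{\mathcal R}\in\Delta(1)(L\otimes L)\Delta^{cop}(1)$ with $\bar{\mathcal R}\mathcal R=\Delta(1)$, $\mathcal R\bar{\mathcal R}=\Delta^{cop}(1)$. *)

(* Defs.v *)
From HB Require Import structures.
From mathcomp Require Import all_boot all_order all_algebra.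
From mathcomp Require Import sesquilinear.
From mathcomp Require Import boolp classical_sets.

Set Implicit Arguments.
Unset Strict Implicit.
Unset Printing Implicit Defensive.

Import GRing.Theory.
Local Open Scope ring_scope.
Local Open Scope quotient_scope.

Reserved Notation "u ⊗ v" (at level 45, left associativity).
Reserved Notation "'\tsum_' ( u ⊗ v <- t ) F"
  (at level 46, u name, v name, t at level 45, F at level 46,
   format "'[' '\tsum_' ( u  ⊗  v  <-  t ) '/  '  F ']'").
Reserved Notation "'\tsum_' ( u ⊗ v ⊗ w <- t ) F"
  (at level 46, u name, v name, w name, t at level 45, F at level 46,
   format "'[' '\tsum_' ( u  ⊗  v  ⊗  w  <-  t ) '/  '  F ']'").

Section LinearLmodule.
Variables (R : comNzRingType) (U V : lmodType R).
Implicit Types f g h : {linear U -> V}.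

Lemma linear_ext f g : f =1 g -> f = g.
Proof.
case: f g => f [[f1] [f2]] [g [[g1] [g2]]] /= /funext fg.
case: _ / fg in g1 g2 *; congr (GRing.Linear.Pack _).
by rewrite (Prop_irrelevance f1 g1) (Prop_irrelevance f2 g2).
Qed.

HB.instance Definition _ := gen_eqMixin {linear U -> V}.
HB.instance Definition _ := gen_choiceMixin {linear U -> V}.

Definition lin_zero : {linear U -> V} := \0.
Definition lin_opp f : {linear U -> V} := \- f.
Definition lin_add f g : {linear U -> V} := f \+ g.
Definition lin_scale a f : {linear U -> V} := a \*: f.

Fact lin_addA : associative lin_add.
Proof. by move=> f g h; apply: linear_ext => x /=; rewrite addrA. Qed.
Fact lin_addC : commutative lin_add.
Proof. by move=> f g; apply: linear_ext => x /=; rewrite addrC. Qed.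
Fact lin_add0 : left_id lin_zero lin_add.
Proof. by move=> f; apply: linear_ext => x /=; rewrite add0r. Qed.
Fact lin_addN : left_inverse lin_zero lin_opp lin_add.
Proof. by move=> f; apply: linear_ext => x /=; rewrite addNr. Qed.

HB.instance Definition _ := GRing.isZmodule.Build {linear U -> V}
  lin_addA lin_addC lin_add0 lin_addN.

Fact lin_scaleA a b f : lin_scale a (lin_scale b f) = lin_scale (a * b) f.
Proof. by apply: linear_ext => x /=; rewrite scalerA. Qed.
Fact lin_scale1 : left_id 1 lin_scale.
Proof. by move=> f; apply: linear_ext => x /=; rewrite scale1r. Qed.
Fact lin_scaleDr : right_distributive lin_scale +%R.
Proof. by move=> a f g; apply: linear_ext => x /=; rewrite scalerDr. Qed.
Fact lin_scaleDl f : {morph lin_scale^~ f : a b / a + b}.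
Proof. by move=> a b; apply: linear_ext => x /=; rewrite scalerDl. Qed.

HB.instance Definition _ := GRing.Zmodule_isLmodule.Build R {linear U -> V}
  lin_scaleA lin_scale1 lin_scaleDr lin_scaleDl.

End LinearLmodule.

(* The tensor product U ⊗ V is the set of finite formal sums of pairs (u, v), *)
(* two sums being identified when every bilinear map out of U x V (with any   *)
(* target) takes the same value on them.                                      *)
Section Tensor.
Variables (k : fieldType) (U V : lmodType k).
Implicit Types s : seq (U * V).

Definition tens_eval (W : zmodType) (f : U -> V -> W) s : W :=
  \sum_(p <- s) f p.1 p.2.

Definition tens_equiv (s t : seq (U * V)) : bool :=
  `[< forall (W : lmodType k) (f : {bilinear U -> V -> W}),
        tens_eval f s = tens_eval f t >].

Fact tens_equiv_refl : reflexive tens_equiv.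
Proof. by move=> s; apply/asboolP. Qed.
Fact tens_equiv_sym : symmetric tens_equiv.
Proof. by move=> s t; apply/asboolP/asboolP => H W f; rewrite H. Qed.
Fact tens_equiv_trans : transitive tens_equiv.
Proof.
by move=> s t r /asboolP H1 /asboolP H2; apply/asboolP=> W f; rewrite H1 H2.
Qed.

Canonical tens_equiv_rel :=
  EquivRel tens_equiv tens_equiv_refl tens_equiv_sym tens_equiv_trans.

Definition tensor := {eq_quot tens_equiv}.
HB.instance Definition _ := Choice.on tensor.
HB.instance Definition _ := EqQuotient.on tensor.

Definition tens (u : U) (v : V) : tensor := \pi_tensor [:: (u, v)].

(* Extension of f to U ⊗ V; it is meaningful only when f is bilinear. *)
Definition tlift (W : zmodType) (t : tensor) (f : U -> V -> W) : W :=
  tens_eval f (repr t).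

Lemma tlift_pi (W : lmodType k) (f : {bilinear U -> V -> W}) s :
  tlift (\pi_tensor s) f = tens_eval f s.
Proof.
have /eqmodP/asboolP H : repr (\pi_tensor s) = s %[mod tensor] := reprK _.
exact: H.
Qed.

Lemma tensor_eqP (t t' : tensor) :
  (forall (W : lmodType k) (f : {bilinear U -> V -> W}),
     tlift t f = tlift t' f) -> t = t'.
Proof.
by move=> H; rewrite -(reprK t) -(reprK t'); apply/eqmodP/asboolP => W f; apply: H.
Qed.

Definition tensor_zero : tensor := \pi_tensor [::].
Definition tensor_add (t t' : tensor) : tensor := \pi_tensor (repr t ++ repr t').
Definition tensor_scale (c : k) (t : tensor) : tensor :=
  \pi_tensor [seq (c *: p.1, p.2) | p <- repr t].
Definition tensor_opp (t : tensor) : tensor := tensor_scale (-1) t.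

Section TliftOps.
Variables (W : lmodType k) (f : {bilinear U -> V -> W}).

Fact tlift0_subproof : tlift tensor_zero f = 0.
Proof. by rewrite tlift_pi /tens_eval big_nil. Qed.
Fact tliftD_subproof (t t' : tensor) :
  tlift (tensor_add t t') f = tlift t f + tlift t' f.
Proof. by rewrite tlift_pi /tens_eval big_cat. Qed.
Fact tliftZ_subproof c (t : tensor) :
  tlift (tensor_scale c t) f = c *: tlift t f.
Proof.
rewrite tlift_pi /tens_eval big_map scaler_sumr.
by apply: eq_bigr => p _ /=; rewrite linearZl_LR.
Qed.

End TliftOps.

Let tliftE := (tlift0_subproof, tliftD_subproof, tliftZ_subproof).

Fact tensor_addA : associative tensor_add.
Proof. by move=> r s t; apply: tensor_eqP => W f; rewrite !tliftE addrA. Qed.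
Fact tensor_addC : commutative tensor_add.
Proof. by move=> s t; apply: tensor_eqP => W f; rewrite !tliftE addrC. Qed.
Fact tensor_add0 : left_id tensor_zero tensor_add.
Proof. by move=> t; apply: tensor_eqP => W f; rewrite !tliftE add0r. Qed.
Fact tensor_addN : left_inverse tensor_zero tensor_opp tensor_add.
Proof.
by move=> t; apply: tensor_eqP => W f; rewrite !tliftE scaleN1r addNr.
Qed.

HB.instance Definition _ := GRing.isZmodule.Build tensor
  tensor_addA tensor_addC tensor_add0 tensor_addN.

Fact tensor_scaleA a b (t : tensor) :
  tensor_scale a (tensor_scale b t) = tensor_scale (a * b) t.
Proof. by apply: tensor_eqP => W f; rewrite !tliftE scalerA. Qed.
Fact tensor_scale1 : left_id 1 tensor_scale.
Proof. by move=> t; apply: tensor_eqP => W f; rewrite !tliftE scale1r. Qed.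
Fact tensor_scaleDr : right_distributive tensor_scale +%R.
Proof. by move=> a s t; apply: tensor_eqP => W f; rewrite !tliftE scalerDr. Qed.
Fact tensor_scaleDl (t : tensor) : {morph tensor_scale^~ t : a b / a + b}.
Proof. by move=> a b; apply: tensor_eqP => W f; rewrite !tliftE scalerDl. Qed.

HB.instance Definition _ := GRing.Zmodule_isLmodule.Build k tensor
  tensor_scaleA tensor_scale1 tensor_scaleDr tensor_scaleDl.

Lemma tlift_tens (W : lmodType k) (f : {bilinear U -> V -> W}) u v :
  tlift (tens u v) f = f u v.
Proof. by rewrite tlift_pi /tens_eval big_seq1. Qed.

Lemma tliftK (W : lmodType k) (f : U -> V -> W) u v :
  bilinear_for *:%R *:%R f -> tlift (tens u v) f = f u v.
Proof.
move=> bf; pose F : {bilinear U -> V -> W} := HB.pack f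
  (bilinear_isBilinear.Build k U V W *:%R *:%R f bf).
exact: (tlift_tens F).
Qed.

Lemma tlift_linear (W : lmodType k) (f : {bilinear U -> V -> W}) :
  linear (fun t : tensor => tlift t f).
Proof. by move=> c s t; rewrite tliftD_subproof tliftZ_subproof. Qed.

Lemma tens_is_bilinear : bilinear_for *:%R *:%R tens.
Proof.
split=> [v c u u' | u c v v']; apply: tensor_eqP => W f.
  by rewrite tlift_linear !tlift_tens linearPl.
by rewrite tlift_linear !tlift_tens linearPr.
Qed.
HB.instance Definition _ :=
  bilinear_isBilinear.Build k U V tensor *:%R *:%R tens tens_is_bilinear.

Lemma tensorE (t : tensor) : t = \sum_(p <- repr t) tens p.1 p.2.
Proof.
apply: tensor_eqP => W f; rewrite {1}/tlift /tens_eval.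
elim: (repr t) => [|p s IHs]; first by rewrite !big_nil tlift0_subproof.
by rewrite !big_cons tliftD_subproof tlift_tens IHs.
Qed.

End Tensor.

Arguments tens {k U V} u v.

Notation "U ⊗ V" := (tensor U V) : type_scope.
Notation "u ⊗ v" := (tens u v) : ring_scope.

(* Sweedler notation: \tsum_(u ⊗ v <- t) F is F(t^1, t^2), F being bilinear   *)
(* in u and v. Iterated tensor products are bracketed to the left.            *)
Notation "'\tsum_' ( u ⊗ v <- t ) F" :=
  (tlift t (fun u v => F%R)) : ring_scope.
Notation "'\tsum_' ( u ⊗ v ⊗ w <- t ) F" :=
  (tlift t (fun uv w => tlift uv (fun u v => F%R))) : ring_scope.

Section TensorOps.
Variables (k : fieldType) (U V : lmodType k).

Definition tswap (t : U ⊗ V) : V ⊗ U := \tsum_(u ⊗ v <- t) v ⊗ u.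

Definition tmul (mU : U -> U -> U) (mV : V -> V -> V) (s t : U ⊗ V) : U ⊗ V :=
  \tsum_(u ⊗ v <- s) \tsum_(u' ⊗ v' <- t) mU u u' ⊗ mV v v'.

End TensorOps.

Section Coalgebra.
Variables (k : fieldType) (C : lmodType k).
Variables (Delta : C -> C ⊗ C) (eps : C -> k).

Record is_coalgebra : Prop := IsCoalgebra {
  comul_linear : linear Delta;
  counit_scalar : scalar eps;
  comul_coassoc c :
    \tsum_(c1 ⊗ c2 <- Delta c) \tsum_(c11 ⊗ c12 <- Delta c1) c11 ⊗ c12 ⊗ c2 =
    \tsum_(c1 ⊗ c2 <- Delta c) \tsum_(c21 ⊗ c22 <- Delta c2) c1 ⊗ c21 ⊗ c22;
  comul_counitl c : \tsum_(c1 ⊗ c2 <- Delta c) eps c1 *: c2 = c;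
  comul_counitr c : \tsum_(c1 ⊗ c2 <- Delta c) eps c2 *: c1 = c
}.

End Coalgebra.

Section HopfAlgebra.
Variables (k : fieldType) (H : algType k).
Variables (Delta : H -> H ⊗ H) (eps : H -> k) (S : H -> H) (R : H ⊗ H).

Record is_hopf_algebra : Prop := IsHopfAlgebra {
  hopf_coalgebra : is_coalgebra Delta eps;
  hopf_comul1 : Delta 1 = 1 ⊗ 1;
  hopf_comulM g h : Delta (g * h) = tmul *%R *%R (Delta g) (Delta h);
  hopf_counit1 : eps 1 = 1;
  hopf_counitM g h : eps (g * h) = eps g * eps h;
  hopf_antipode_linear : linear S;
  hopf_antipodel h : \tsum_(h1 ⊗ h2 <- Delta h) S h1 * h2 = eps h *: 1;
  hopf_antipoder h : \tsum_(h1 ⊗ h2 <- Delta h) h1 * S h2 = eps h *: 1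
}.

Record is_quasitriangular : Prop := IsQuasitriangular {
  qt_invertible : exists R' : H ⊗ H,
    tmul *%R *%R R R' = 1 ⊗ 1 /\ tmul *%R *%R R' R = 1 ⊗ 1;
  qt_comm h :
    \tsum_(r1 ⊗ r2 <- R) \tsum_(h1 ⊗ h2 <- Delta h) r1 * h1 ⊗ r2 * h2 =
    \tsum_(r1 ⊗ r2 <- R) \tsum_(h1 ⊗ h2 <- Delta h) h2 * r1 ⊗ h1 * r2;
  qt_comull :
    \tsum_(r1 ⊗ r2 <- R) \tsum_(r11 ⊗ r12 <- Delta r1) r11 ⊗ r12 ⊗ r2 =
    \tsum_(r1 ⊗ r2 <- R) \tsum_(s1 ⊗ s2 <- R) r1 ⊗ s1 ⊗ r2 * s2;
  qt_comulr :
    \tsum_(r1 ⊗ r2 <- R) \tsum_(r21 ⊗ r22 <- Delta r2) r1 ⊗ r21 ⊗ r22 =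
    \tsum_(r1 ⊗ r2 <- R) \tsum_(s1 ⊗ s2 <- R) r1 * s1 ⊗ s2 ⊗ r2
}.

End HopfAlgebra.

Section Semisimple.
Variable H : nzRingType.
Local Open Scope classical_set_scope.

Record left_ideal (I : set H) : Prop := LeftIdeal {
  left_ideal0 : I 0;
  left_idealD x y : I x -> I y -> I (x + y);
  left_idealM h x : I x -> I (h * x)
}.

Definition semisimple_ring : Prop :=
  forall I : set H, left_ideal I ->
  exists J : set H, [/\ left_ideal J, I `&` J = [set 0] &
    forall h : H, exists x y, [/\ I x, J y & h = x + y]].

End Semisimple.

Section ModuleAlgebra.
Variables (k : fieldType) (H : algType k).
Variables (Delta : H -> H ⊗ H) (eps : H -> k) (R : H ⊗ H).
Variables (A : algType k) (act : {bilinear H -> A -> A}).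

Record is_module_algebra : Prop := IsModuleAlgebra {
  act1 a : act 1 a = a;
  actM g h a : act (g * h) a = act g (act h a);
  act_mul h a b :
    act h (a * b) = \tsum_(h1 ⊗ h2 <- Delta h) act h1 a * act h2 b;
  act_unit h : act h 1 = eps h *: 1
}.

Definition quantum_commutative : Prop :=
  forall a b, a * b = \tsum_(r1 ⊗ r2 <- R) act r2 b * act r1 a.

End ModuleAlgebra.

Section DualAlgebra.
Variables (k : fieldType) (A : algType k).
Implicit Types (a b : A) (f g : {linear A -> k^o}) (x : A ⊗ A).

Definition dual_harpoonr a f : {linear A -> k^o} := f \o (a \o* idfun).
Definition dual_harpoonl f a : {linear A -> k^o} := f \o (a \*o idfun).

Lemma dual_harpoonrE a f b : dual_harpoonr a f b = f (b * a). Proof. by []. Qed.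
Lemma dual_harpoonlE f a b : dual_harpoonl f a b = f (a * b). Proof. by []. Qed.

Record is_symmetric_separability_idempotent x : Prop :=
  IsSymmetricSeparabilityIdempotent {
  sepidem_central a :
    \tsum_(x1 ⊗ x2 <- x) a * x1 ⊗ x2 = \tsum_(x1 ⊗ x2 <- x) x1 ⊗ x2 * a;
  sepidem_mul : \tsum_(x1 ⊗ x2 <- x) x1 * x2 = 1;
  sepidem_sym : tswap x = x
}.

(* The functional alpha_A with <alpha_A, x^1> x^2 = 1, which exists and is    *)
(* unique when x is a symmetric separability idempotent.                      *)
Definition sep_form x : {linear A -> k^o} :=
  xget 0 [set f : {linear A -> k^o} | \tsum_(x1 ⊗ x2 <- x) (f x1 : k) *: x2 = 1]%classic.

(* Dual comultiplication; for A finite dimensional, there is exactly one such *)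
(* tensor t in A^* ⊗ A^*.                                                     *)
Definition dual_comul f : {linear A -> k^o} ⊗ {linear A -> k^o} :=
  xget 0 [set t : {linear A -> k^o} ⊗ {linear A -> k^o} |
    forall a b, \tsum_(f1 ⊗ f2 <- t) f1 a * f2 b = f (a * b)]%classic.

Variables (H : algType k) (act : {bilinear H -> A -> A}).

Definition dual_act f (h : H) : {linear A -> k^o} := f \o act h.

Lemma dual_actE f h b : dual_act f h b = f (act h b). Proof. by []. Qed.

End DualAlgebra.

(* Weak Hopf algebras in the sense of Böhm, Nill and Szlachányi, on a vector  *)
(* space L with product m and unit u (Delta need not preserve the unit).      *)
Section WeakHopf.
Variables (k : fieldType) (L : lmodType k) (m : L -> L -> L) (u : L).
Variables (Delta : L -> L ⊗ L) (eps : L -> k) (S : L -> L) (Rm : L ⊗ L).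

Let m2 := tmul m m.
Let m3 := tmul (tmul m m) m.
Let Delta_cop l := tswap (Delta l).

Record is_algebra : Prop := IsAlgebra {
  alg_mul_linearl b : linear (m^~ b);
  alg_mul_linearr a : linear (m a);
  alg_mulA : associative m;
  alg_mul1 : left_id u m;
  alg_mulr1 : right_id u m
}.

Record is_weak_bialgebra : Prop := IsWeakBialgebra {
  wbialg_algebra : is_algebra;
  wbialg_coalgebra : is_coalgebra Delta eps;
  wbialg_comulM a b : Delta (m a b) = m2 (Delta a) (Delta b);
  wbialg_unitl :
    \tsum_(u1 ⊗ u2 <- Delta u) \tsum_(u11 ⊗ u12 <- Delta u1) u11 ⊗ u12 ⊗ u2 =
    m3 (Delta u ⊗ u) (\tsum_(u1 ⊗ u2 <- Delta u) u ⊗ u1 ⊗ u2);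
  wbialg_unitr :
    \tsum_(u1 ⊗ u2 <- Delta u) \tsum_(u11 ⊗ u12 <- Delta u1) u11 ⊗ u12 ⊗ u2 =
    m3 (\tsum_(u1 ⊗ u2 <- Delta u) u ⊗ u1 ⊗ u2) (Delta u ⊗ u);
  wbialg_counitl a b c :
    eps (m (m a b) c) =
    \tsum_(b1 ⊗ b2 <- Delta b) eps (m a b1) * eps (m b2 c);
  wbialg_counitr a b c :
    eps (m (m a b) c) =
    \tsum_(b1 ⊗ b2 <- Delta b) eps (m a b2) * eps (m b1 c)
}.

Record is_weak_hopf_algebra : Prop := IsWeakHopfAlgebra {
  whopf_bialgebra : is_weak_bialgebra;
  whopf_antipode_linear : linear S;
  whopf_antipoder l :
    \tsum_(l1 ⊗ l2 <- Delta l) m l1 (S l2) =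
    \tsum_(u1 ⊗ u2 <- Delta u) eps (m u1 l) *: u2;
  whopf_antipodel l :
    \tsum_(l1 ⊗ l2 <- Delta l) m (S l1) l2 =
    \tsum_(u1 ⊗ u2 <- Delta u) eps (m l u2) *: u1;
  whopf_antipode l :
    \tsum_(l1 ⊗ l2 <- Delta l) \tsum_(l11 ⊗ l12 <- Delta l1)
       m (m (S l11) l12) (S l2) = S l
}.

Record is_quasitriangular_weak_hopf_algebra : Prop :=
  IsQuasitriangularWeakHopfAlgebra {
  wqt_hopf : is_weak_hopf_algebra;
  wqt_mem : exists t : L ⊗ L, Rm = m2 (m2 (Delta_cop u) t) (Delta u);
  wqt_comm l : m2 (Delta_cop l) Rm = m2 Rm (Delta l);
  wqt_comulr :
    \tsum_(r1 ⊗ r2 <- Rm) \tsum_(r21 ⊗ r22 <- Delta r2) r1 ⊗ r21 ⊗ r22 =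
    m3 (\tsum_(r1 ⊗ r2 <- Rm) r1 ⊗ u ⊗ r2) (Rm ⊗ u);
  wqt_comull :
    \tsum_(r1 ⊗ r2 <- Rm) \tsum_(r11 ⊗ r12 <- Delta r1) r11 ⊗ r12 ⊗ r2 =
    m3 (\tsum_(r1 ⊗ r2 <- Rm) r1 ⊗ u ⊗ r2)
       (\tsum_(r1 ⊗ r2 <- Rm) u ⊗ r1 ⊗ r2);
  wqt_inverse : exists Rbar : L ⊗ L,
    [/\ exists t : L ⊗ L, Rbar = m2 (m2 (Delta u) t) (Delta_cop u),
        m2 Rbar Rm = Delta u & m2 Rm Rbar = Delta_cop u]
}.

End WeakHopf.

Section TheAlgebraB.
Variables (k : fieldType) (H : algType k).
Variables (Delta : H -> H ⊗ H) (eps : H -> k) (S : H -> H) (R : H ⊗ H).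
Variables (A : algType k) (act : {bilinear H -> A -> A}) (x : A ⊗ A).

Local Notation B := (A ⊗ H ⊗ {linear A -> k^o})%type.
Local Notation alpha := (sep_form x).
Local Notation "h ▷ a" := (act h a) (at level 30, right associativity).
Local Notation "f ◁ h" := (dual_act act f h) (at level 31, left associativity).
Local Notation "a ⇀ f" := (dual_harpoonr a f) (at level 30, right associativity).
Local Notation "f ↼ a" := (dual_harpoonl f a) (at level 31, left associativity).

Definition mulB (s t : B) : B :=
  \tsum_(a ⊗ h ⊗ f <- s) \tsum_(b ⊗ g ⊗ f' <- t) (f' a : k) *: (b ⊗ h * g ⊗ f).

Definition oneB : B := \tsum_(x1 ⊗ x2 <- x) x1 ⊗ 1 ⊗ (x2 ⇀ alpha).

Definition DeltaB (s : B) : B ⊗ B :=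
  \tsum_(a ⊗ h ⊗ f <- s)
  \tsum_(r11 ⊗ r12 <- R) \tsum_(r21 ⊗ r22 <- R) \tsum_(x1 ⊗ x2 <- x)
  \tsum_(h1 ⊗ h2 <- Delta h) \tsum_(f1 ⊗ f2 <- dual_comul f)
    ((r12 ▷ x1) * a ⊗ r21 * h1 * r11 ⊗ f2) ⊗ (x2 ⊗ h2 ⊗ (f1 ◁ r22)).

Definition epsB (s : B) : k :=
  \tsum_(a ⊗ h ⊗ f <- s) (alpha a * eps h * f 1 : k^o).

Definition SB (s : B) : B :=
  \tsum_(a ⊗ h ⊗ f <- s)
  \tsum_(r11 ⊗ r12 <- R) \tsum_(r21 ⊗ r22 <- R) \tsum_(x1 ⊗ x2 <- x)
    ((f ◁ r22) x1 : k) *: (x2 ⊗ r11 * S (r21 * h) ⊗ (alpha ↼ (r12 ▷ a))).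

Definition RB : B ⊗ B :=
  \tsum_(r11 ⊗ r12 <- R) \tsum_(r21 ⊗ r22 <- R) \tsum_(r31 ⊗ r32 <- R)
  \tsum_(x11 ⊗ x12 <- x) \tsum_(x21 ⊗ x22 <- x)
  \tsum_(alpha1 ⊗ alpha2 <- dual_comul alpha)
    ((r32 ▷ x21) * x11 ⊗ r21 * r31 ⊗ (alpha1 ◁ r12)) ⊗
    (x22 ⊗ r11 * r22 ⊗ (x12 ⇀ alpha2)).

End TheAlgebraB.

(* Main.v *)
Require Import Defs.
From HB Require Import structures.
From mathcomp Require Import all_boot all_order all_algebra.
From mathcomp Require Import sesquilinear.
From mathcomp Require Import boolp ring zify mxtens.
From mathcomp Require classical_sets.

Set Implicit Arguments.
Unset Strict Implicit.
Unset Printing Implicit Defensive.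

Import GRing.Theory.
Local Open Scope ring_scope.

(** Two facts carry the proof: the antipode of H is involutive, and once it is,
B has coordinates in which its axioms are moves of one tensor.

Involutivity is the theorem of Larson and Radford ([antipode_involutive]).
Semisimplicity gives a normalized integral t, so H is separable and finite
dimensional. The traces of [h * S^2(-)] and [S^2(-) * h] are integrals on H
([phi_left], [psi_right]); comparing them shows that S^4 is conjugation by a
grouplike element ([antipode4]), whence S^2 has finite order. The delicate
point is that S^2 has nonzero trace ([theta_neq0]). For representations V, W
of the cyclic group generated by sigma = S^2, the space of homomorphisms from
H ⊗ V to H ⊗ W over the smash product of H with that group has dimension
  1/M sum_j tr(sigma^j) v(j) w(-j),
v and w being the characters. Dimensions are natural numbers, and this
pairing is anisotropic on differences of characters ([twisted_trace_sep]);
since the trace of sigma^j is itself such a character, these two properties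
exclude that the trace of sigma is zero. Then the two integrals agree,
S^4 = id, and convolution with the regular character cuts out a subspace on
which S^2 has trace tr(S^2) / dim H. So tr(S^2) is a nonzero multiple of
dim H, and S^2, an involution that fixes 1, is the identity.

Now alpha is the trace of left multiplication on A, so it is symmetric and, S
being involutive, H-invariant ([alpha_inv]); x is its pair of dual bases.
Thus c |-> alpha ↼ c identifies A with its dual, and B is spanned by
elements beta(a, h, c) with a, c in A and h in H. Let q0 ⊗ q1 = R^2 q ⊗ R^1
be the coaction of A, and J1 ⊗ J2 ⊗ J3 the tensor obtained by coacting on the
first leg of x; let K be a second copy of J. Then
  beta(a, h, c) beta(b, g, d) = alpha(d a) beta(b, h g, c)
  Delta beta(a, h, c) = beta(J1 a, K2 h1 J2, c K1) ⊗ beta(J3, h2, K3)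
  S beta(a, h, c) = beta(c0, a1 S(h) c1, a0)
  R_B = beta(J1 y1, R1 J2, K3) ⊗ beta(J3, K2 R2, y2 K1), y a copy of x
([mulB_beta], [DeltaB_beta], [SB_beta], [RB_beta]). All the axioms reduce to
a few rules for J: a coaction is absorbed on either side of it ([jsum_left],
[jsum_right]), the coproduct of its middle leg is a second coaction
([jsum_coassoc]), and alpha, applied to the product of the third legs of two
copies, makes both copies disappear ([jsum_contract]). Coassociativity merges
two nested copies of J ([jsum_in], [jsum_out]), multiplicativity of the
coproduct is [jsum_contract], and the axioms for R_B follow from those for R
after moving copies of J from one factor to another.
*)

(** * Linear maps and traces *)

(** Linearity is kept as a property of plain functions: Sweedler sums are
taken of functions written out on the spot. *)
Definition lin (k : fieldType) (U V : lmodType k) (f : U -> V) : Prop :=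
  forall (c : k) u v, f (c *: u + v) = c *: f u + f v.

Section Lin.
Variables (k : fieldType) (U V : lmodType k) (f : U -> V).
Hypothesis lf : lin f.

Lemma lin0 : f 0 = 0.
Proof. by have := lf (-1) 0 0; rewrite scaler0 addr0 scaleN1r addNr. Qed.
Lemma linZ c u : f (c *: u) = c *: f u.
Proof. by have := lf c u 0; rewrite !addr0 lin0 addr0. Qed.
Lemma linD u v : f (u + v) = f u + f v.
Proof. by have := lf 1 u v; rewrite !scale1r. Qed.
Lemma linB u v : f (u - v) = f u - f v.
Proof. by rewrite linD -scaleN1r linZ scaleN1r. Qed.
Lemma lin_sum I (r : seq I) (P : pred I) (F : I -> U) :
  f (\sum_(i <- r | P i) F i) = \sum_(i <- r | P i) f (F i).
Proof. exact: (big_morph f linD lin0). Qed.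
End Lin.

(** A generating family with linear coordinates, not necessarily independent:
this is what a separability idempotent produces, and it suffices to define
traces. *)
Section Frame.
Variables (k : fieldType) (V : lmodType k) (I : finType).

Record frame (e : I -> V) (c : I -> V -> k^o) : Prop := Frame {
  frame_lin i : lin (c i);
  frameE v : v = \sum_i (c i v : k) *: e i
}.

Definition ftr (e : I -> V) (c : I -> V -> k^o) (f : V -> V) : k :=
  \sum_i c i (f (e i)).

End Frame.

(** Both sides are the double sum of c'_j(f e_i) c_i(g e'_j). With V = W and f
the identity, this is also the independence of the trace from the frame. *)
Lemma ftr_comp (k : fieldType) (V W : lmodType k) (I J : finType)
    (e : I -> V) (c : I -> V -> k^o) (e' : J -> W) (c' : J -> W -> k^o)
    (f : V -> W) (g : W -> V) :
  frame e c -> frame e' c' -> lin f -> lin g ->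
  ftr e c (fun v => g (f v)) = ftr e' c' (fun w => f (g w)).
Proof.
move=> fr fr' lf lg.
have -> : ftr e c (fun v => g (f v)) =
    \sum_i \sum_j (c' j (f (e i)) : k) * c i (g (e' j)).
  apply: eq_bigr => i _; rewrite {1}(frameE fr' (f (e i))) (lin_sum lg).
  rewrite (lin_sum (frame_lin fr i)); apply: eq_bigr => j _.
  by rewrite (linZ lg) (linZ (frame_lin fr i)).
rewrite exchange_big; apply: eq_bigr => j _ /=.
rewrite {2}(frameE fr (g (e' j))) (lin_sum lf).
rewrite (lin_sum (frame_lin fr' j)); apply: eq_bigr => i _.
by rewrite (linZ lf) (linZ (frame_lin fr' j)) mulrC.
Qed.

(** In a rank factorization A = C D, the factor C is injective and D
surjective, so that C (D C) D = C D cancels to D C = 1. *)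
Lemma idem_factor (k : fieldType) n (A : 'M[k]_n) : A *m A = A ->
  exists r (C : 'M[k]_(n, r)) (D : 'M[k]_(r, n)), C *m D = A /\ D *m C = 1%:M.
Proof.
move=> AA; exists (\rank A), (col_base A), (row_base A); rewrite mulmx_base; split=> //.
have := (mulmx_base A, row_base_free A, col_base_full A).
move: (col_base A) (row_base A) => C D [[CD Dfree] /row_fullP[B BC]].
apply: (row_free_inj Dfree); rewrite /= mul1mx.
have : C *m (D *m C *m D) = C *m D by rewrite mulmxA mulmxA -mulmxA !CD.
by move/(congr1 (mulmx B)); rewrite !(mulmxA B) BC !mul1mx.
Qed.

Lemma mxtrace_idem (k : fieldType) n (A : 'M[k]_n) :
  A *m A = A -> \tr A = (\rank A)%:R.
Proof.
move=> AA; have [r [C [D [CD DC]]]] := idem_factor AA.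
have -> : \rank A = r.
  apply/eqP; rewrite eqn_leq -{1}CD (leq_trans (mxrankM_maxl _ _)) ?rank_leq_col //=.
  rewrite -{1}(mxrank1 k r).
  have <- : D *m A *m C = 1%:M by rewrite -CD mulmxA DC mul1mx DC.
  by rewrite (leq_trans (mxrankM_maxl _ _)) ?mxrankM_maxr.
by rewrite -CD mxtrace_mulC DC mxtrace1.
Qed.

Section FrameMatrix.
Variables (k : fieldType) (V : lmodType k) (I : finType).
Variables (e : I -> V) (c : I -> V -> k^o).
Hypothesis fr : frame e c.

Lemma frame_coordE v w : (forall i, c i v = c i w) -> v = w.
Proof.
by move=> vw; rewrite (frameE fr v) (frameE fr w); apply: eq_bigr => i _; rewrite vw.
Qed.

Definition fmx (f : V -> V) : 'M[k]_#|I| :=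
  \matrix_(i, j) c (enum_val i) (f (e (enum_val j))).

Lemma mul_fmx f g : lin f -> fmx f *m fmx g = fmx (f \o g).
Proof.
move=> lf; apply/matrixP=> i j; rewrite !mxE /=.
rewrite [in RHS](frameE fr (g _)) (lin_sum lf) (lin_sum (frame_lin fr _)).
rewrite (big_enum_val (fun l => c (enum_val i) (f ((c l (g (e (enum_val j))) : k) *: e l)))).
apply: eq_bigr => l _; rewrite !mxE (linZ lf) (linZ (frame_lin fr _)).
by rewrite mulrC.
Qed.

Lemma mxtrace_fmx f : \tr (fmx f) = ftr e c f.
Proof.
rewrite /mxtrace /ftr (big_enum_val (fun l => c l (f (e l)))).
by apply: eq_bigr => i _; rewrite mxE.
Qed.

Lemma fmx_lin (W : lmodType k) (F : W -> V -> V) :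
  (forall v, lin (F^~ v)) -> lin (fun w => fmx (F w)).
Proof.
by move=> lF a u v; apply/matrixP=> i j; rewrite !mxE lF (frame_lin fr).
Qed.

Lemma fmx1 : (forall i j, c i (e j) = (i == j)%:R) -> fmx id = 1%:M.
Proof.
by move=> bas; apply/matrixP => i j; rewrite !mxE bas (inj_eq enum_val_inj).
Qed.

(** The trace of an idempotent is its rank. This is how dimensions enter as
natural numbers of the field. *)
Lemma ftr_idem p : lin p -> (forall v, p (p v) = p v) ->
  exists r : nat, ftr e c p = r%:R /\ (r = 0%N -> forall v, p v = 0).
Proof.
move=> lp pp; exists (\rank (fmx p)); rewrite -mxtrace_fmx mxtrace_idem; last first.
  by rewrite mul_fmx //; apply/matrixP=> i j; rewrite !mxE /= pp.
split=> // /eqP; rewrite mxrank_eq0 => /eqP p0 v.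
have pe i : p (e i) = 0.
  apply: frame_coordE => j; rewrite (lin0 (frame_lin fr j)).
  by move/matrixP/(_ (enum_rank j) (enum_rank i)): p0; rewrite !mxE !enum_rankK.
rewrite (frameE fr v) (lin_sum lp) big1 // => i _.
by rewrite (linZ lp) pe scaler0.
Qed.

End FrameMatrix.

(** The matrix of the identity map in a frame is idempotent; its rank
factorization extracts a basis together with the dual basis. *)
Lemma frame_basis (k : fieldType) (V : lmodType k) (I : finType)
    (e : I -> V) (c : I -> V -> k^o) : frame e c ->
  exists r (e' : 'I_r -> V) (c' : 'I_r -> V -> k^o),
    frame e' c' /\ forall i j, c' i (e' j) = (i == j)%:R.
Proof.
move=> fr; have lid : lin (@id V) by [].
have ii : fmx e c id *m fmx e c id = fmx e c id by rewrite mul_fmx.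
have [r [C [D [CD DC]]]] := idem_factor ii.
pose e' l := \sum_j C j l *: e (enum_val j).
pose c' l v : k^o := \sum_i (D l i * (c (enum_val i) v : k)).
exists r, e', c'.
have frv v : v = \sum_(j < #|I|) (c (enum_val j) v : k) *: e (enum_val j).
  apply: (etrans (frameE fr v)).
  by rewrite (big_enum_val (fun j => (c j v : k) *: e j)); apply: eq_bigr.
have cl v j : (c j v : k) = \sum_(i < #|I|) c j (e (enum_val i)) * (c (enum_val i) v : k).
  rewrite {1}(frv v) (lin_sum (frame_lin fr j)); apply: eq_bigr => i _.
  rewrite (linZ (frame_lin fr j)). exact: mulrC.
split; first split.
- move=> l a u v; rewrite /c' scaler_sumr -big_split; apply: eq_bigr => i _ /=.
  by rewrite (frame_lin fr) mulrDr /GRing.scale /= mulrCA.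
- move=> v; rewrite {1}(frv v).
  transitivity (\sum_j \sum_l (C j l * (c' l v : k)) *: e (enum_val j)).
    apply: eq_bigr => j _; rewrite -scaler_suml; congr (_ *: _).
    rewrite cl /c'.
    under [RHS]eq_bigr do rewrite mulr_sumr.
    rewrite [RHS]exchange_big; apply: eq_bigr => i _ /=.
    rewrite (_ : c (enum_val j) (e (enum_val i)) = (C *m D) j i); last by rewrite CD mxE.
    rewrite mxE mulr_suml; apply: eq_bigr => l _; exact/esym/mulrA.
  rewrite exchange_big; apply: eq_bigr => l _ /=.
  by rewrite scaler_sumr; apply: eq_bigr => j _; rewrite mulrC scalerA.
- move=> l m.
  have -> : (l == m)%:R = (D *m (C *m D) *m C) l m :> k.
    by rewrite mulmxA DC mul1mx DC mxE.
  rewrite CD /c' -mulmxA mxE; apply: eq_bigr => i _; congr (_ * _).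
  rewrite mxE (lin_sum (frame_lin fr _)); apply: eq_bigr => j _.
  by rewrite mxE (linZ (frame_lin fr _)); exact: mulrC.
Qed.

Section MatrixFrame.
Variables (k : fieldType) (n : nat).

Definition mxe (ij : 'I_n * 'I_n) : 'M[k]_n := delta_mx ij.1 ij.2.
Definition mxc (ij : 'I_n * 'I_n) (A : 'M[k]_n) : k^o := A ij.1 ij.2.

Lemma mxframe : frame mxe mxc.
Proof.
split=> [ij c A B|A]; first by rewrite /mxc !mxE.
by rewrite {1}(matrix_sum_delta A) pair_bigA.
Qed.

Lemma mxtrace_lmulr (A B : 'M[k]_n) :
  ftr mxe mxc (fun X => A *m X *m B) = \tr A * \tr B.
Proof.
rewrite /ftr -(pair_bigA _ (fun i j => mxc (i, j) (A *m mxe (i, j) *m B))) /=.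
rewrite /mxtrace big_distrl; apply: eq_bigr => i _.
rewrite big_distrr /=; apply: eq_bigr => j _.
rewrite /mxc /mxe /= !mxE (bigD1 j) //= big1 => [|l lj].
  rewrite addr0 mxE (bigD1 i) //= big1 => [|l li]; rewrite !mxE ?eqxx ?mulr1 ?addr0 //.
  by rewrite (negPf li) mulr0.
rewrite !mxE big1 ?mul0r // => l' _.
by rewrite !mxE (negPf lj) andbF mulr0.
Qed.

End MatrixFrame.

(** * Multilinear maps and Sweedler sums *)

Section MultiLin.
Variables (k : fieldType).
Implicit Types U V W X : lmodType k.

Definition bil U V W (f : U -> V -> W) :=
  (forall v, lin (f^~ v)) /\ (forall u, lin (f u)).
Definition tril U V X W (f : U -> V -> X -> W) :=
  [/\ forall v x, lin (fun u => f u v x), forall u x, lin (fun v => f u v x)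
    & forall u v, lin (fun x => f u v x)].
Definition quinl U1 U2 U3 U4 U5 W (f : U1 -> U2 -> U3 -> U4 -> U5 -> W) :=
  [/\ forall b c d e, lin (fun a => f a b c d e),
      forall a c d e, lin (fun b => f a b c d e),
      forall a b d e, lin (fun c => f a b c d e),
      forall a b c e, lin (fun d => f a b c d e)
    & forall a b c d, lin (fun e => f a b c d e)].

Lemma bil_for U V W (f : U -> V -> W) : bil f -> bilinear_for *:%R *:%R f.
Proof. by case=> fl fr; split=> [v c u u'|u c v v'] /=; rewrite ?fl ?fr. Qed.

Lemma lin_id U : lin (fun u : U => u). Proof. by []. Qed.
Lemma lin_comp U V W (g : V -> W) (f : U -> V) :
  lin g -> lin f -> lin (fun u => g (f u)).
Proof. by move=> lg lf c u v; rewrite lf lg. Qed.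
Lemma lin_tensl U V W (f : W -> U) (v : V) : lin f -> lin (fun z => f z ⊗ v).
Proof. by move=> lf c u u'; rewrite lf linearPl. Qed.
Lemma lin_tensr U V W (u : U) (f : W -> V) : lin f -> lin (fun z => u ⊗ f z).
Proof. by move=> lf c v v'; rewrite lf linearPr. Qed.
Lemma lin_mull W (A : algType k) (f : W -> A) (b : A) :
  lin f -> lin (fun z => f z * b).
Proof. by move=> lf c u v; rewrite lf mulrDl scalerAl. Qed.
Lemma lin_mulr W (A : algType k) (b : A) (f : W -> A) :
  lin f -> lin (fun z => b * f z).
Proof. by move=> lf c u v; rewrite lf mulrDr scalerAr. Qed.
Lemma lin_scalel W V (s : W -> k^o) (v : V) :
  lin s -> lin (fun z => (s z : k) *: v).
Proof. by move=> ls c u u'; rewrite ls scalerDl -scalerA. Qed.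
Lemma lin_scaler W V (a : k) (f : W -> V) : lin f -> lin (fun z => a *: f z).
Proof. by move=> lf c u v; rewrite lf scalerDr !scalerA mulrC. Qed.
Lemma lin_mulkl W (f : W -> k^o) (b : k) :
  lin f -> lin (fun z => (f z : k) * b : k^o).
Proof. by move=> lf a u v; rewrite lf mulrDl; congr (_ + _); exact/esym/mulrA. Qed.
Lemma lin_mulkr W (b : k) (f : W -> k^o) :
  lin f -> lin (fun z => b * (f z : k) : k^o).
Proof. by move=> lf a u v; rewrite lf mulrDr; congr (_ + _); exact: mulrCA. Qed.
Lemma lin_sub U V (f g : U -> V) : lin f -> lin g -> lin (fun z => f z - g z).
Proof. by move=> lf lg c u v; rewrite lf lg opprD addrACA scalerBr. Qed.
Lemma lin_linear U V (f : {linear U -> V}) : lin f.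
Proof. by move=> c u v; rewrite linearP. Qed.
Lemma lin_bilinl U V W (f : {bilinear U -> V -> W}) v : lin (f^~ v).
Proof. by move=> c u u' /=; rewrite linearPl. Qed.
Lemma lin_bilinr U V W (f : {bilinear U -> V -> W}) u : lin (f u).
Proof. by move=> c v v'; rewrite linearPr. Qed.
Section Tlift.
Variables U V : lmodType k.
Implicit Type t : U ⊗ V.

Lemma eq_tsum t (W : zmodType) (F F' : U -> V -> W) :
  (forall u v, F u v = F' u v) -> tlift t F = tlift t F'.
Proof. by move=> FF; apply: eq_bigr => p _; exact: FF. Qed.

Lemma tsum_tens W (F : U -> V -> W) u v : bil F -> tlift (u ⊗ v) F = F u v.
Proof. by move/bil_for/tliftK. Qed.

Lemma lin_tsum_arg W (F : U -> V -> W) : bil F -> lin (fun t => tlift t F).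
Proof.
move/bil_for => bF; pose F' : {bilinear U -> V -> W} := HB.pack F
  (bilinear_isBilinear.Build k U V W *:%R *:%R F bF).
exact: (tlift_linear F').
Qed.

Lemma lin_tsum_body t W W' (F : W' -> U -> V -> W) :
  (forall u v, lin (fun z => F z u v)) -> lin (fun z => tlift t (F z)).
Proof.
move=> lF c z z'; rewrite /tlift /tens_eval scaler_sumr -big_split.
by apply: eq_bigr => p _; rewrite lF.
Qed.

Lemma tsum_push W W' (L : W -> W') t (F : U -> V -> W) :
  lin L -> L (tlift t F) = tlift t (fun u v => L (F u v)).
Proof. by move=> lL; rewrite /tlift /tens_eval (lin_sum lL). Qed.

Lemma tsumZ (W : lmodType k) t (a : k) (F : U -> V -> W) :
  a *: tlift t F = tlift t (fun u v => a *: F u v).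
Proof. exact: scaler_sumr. Qed.

Lemma tsumC (U' V' : lmodType k) (W : zmodType) t (t' : U' ⊗ V')
    (F : U -> V -> U' -> V' -> W) :
  tlift t (fun u v => tlift t' (F u v)) =
  tlift t' (fun u' v' => tlift t (fun u v => F u v u' v')).
Proof. exact: exchange_big. Qed.

Lemma tsumB (W : zmodType) t (F G : U -> V -> W) :
  tlift t (fun u v => F u v - G u v) = tlift t F - tlift t G.
Proof. exact: sumrB. Qed.

Lemma tsum_bigC (I : Type) (r : seq I) (W : zmodType) t (F : I -> U -> V -> W) :
  \sum_(i <- r) tlift t (F i) = tlift t (fun u v => \sum_(i <- r) F i u v).
Proof. exact: exchange_big. Qed.

Lemma tsum_id t : tlift t (fun u v => u ⊗ v) = t.
Proof. by rewrite [RHS]tensorE. Qed.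
End Tlift.

Lemma tsum_flatten (U V U' V' : lmodType k) W (t : U ⊗ V) (T : U -> V -> U' ⊗ V')
    (G : U' -> V' -> W) : bil G ->
  tlift (tlift t T) G = tlift t (fun u v => tlift (T u v) G).
Proof. by move=> bG; rewrite (tsum_push (L := fun s => tlift s G)) //; exact: lin_tsum_arg. Qed.

Lemma tswap_tsum (U V W : lmodType k) (t : U ⊗ V) (G : V -> U -> W) : bil G ->
  \tsum_(v ⊗ u <- tswap t) G v u = \tsum_(u ⊗ v <- t) G v u.
Proof.
move=> bG; rewrite /tswap tsum_flatten //.
by apply: eq_tsum => u v; rewrite tsum_tens.
Qed.

End MultiLin.

Arguments tsum_push {k U V W W' L t F} _.

Ltac is_const f := lazymatch f with (fun _ => ?c) => idtac end.

Ltac lin2 f g ll lr :=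
  first [is_const f; apply lr | is_const g; apply ll].

(** The first pass avoids unfolding: trying irrelevant hypotheses up to conversion
is what makes the search slow. *)
Ltac lin_hyp := first [
  match goal with
  | H : context [lin _] |- _ => solve [simple apply H]
  end | match goal with
  | H : context [lin _] |- _ => solve [exact H | apply H]
  end].

(** A hook, redefined below for the sums over coactions. *)
Ltac lin_ext := fail.

(** Proves linearity goals by descending into the only argument of each operation
that contains the variable; hypotheses that state linearity close the leaves. *)
Ltac lin :=
  cbv beta;
  lazymatch goal with
  | |- bil _ => split; lin
  | |- tril _ => split; lin
  | |- quinl _ => split; lin
  | |- forall _, _ => intro; lin
  | |- lin (fun z => z) => exact (@lin_id _ _)
  | |- lin (fun z => tens (@?f z) (@?g z)) => lin2 f g lin_tensl lin_tensr; lin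
  | |- lin (fun z => GRing.scale (@?f z) (@?g z)) => lin2 f g lin_scalel lin_scaler; lin
  | |- lin (fun z => GRing.mul (@?f z) (@?g z)) =>
      first [lin2 f g lin_mull lin_mulr | lin2 f g lin_mulkl lin_mulkr]; lin
  | |- @lin ?k ?U ?W (fun z => tlift (@?t z) (@?F z)) =>
      first [ is_const t; apply: lin_tsum_body; lin
            | lazymatch F with (fun _ => ?F0) =>
                apply (@lin_comp k U _ W (fun y => tlift y F0) t);
                [apply lin_tsum_arg; lin | lin] end ]
  | |- lin (fun z => _) => first [lin_hyp | lin_ext; lin | lin_app]
  | |- lin ?f => first [lin_hyp | apply lin_linear | apply lin_bilinr
                       | refine (_ : lin (fun z => f z)); lin]
  end
with lin_app :=
  once (match goal with
  | |- @lin ?k ?U ?W (fun z => ?g (@?f z)) =>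
      apply (@lin_comp k U _ W g f); [first [lin_hyp | apply lin_linear | apply lin_bilinr] |]
  | |- @lin ?k ?U ?W (fun z => ?g (@?f z) ?a) =>
      apply (@lin_comp k U _ W (fun y => g y a) f); [first [lin_hyp | apply lin_bilinl] |]
  | |- @lin ?k ?U ?W (fun z => ?g (@?f z) ?a ?b) =>
      apply (@lin_comp k U _ W (fun y => g y a b) f); [lin_hyp |]
  | |- @lin ?k ?U ?W (fun z => ?g (@?f z) ?a ?b ?c) =>
      apply (@lin_comp k U _ W (fun y => g y a b c) f); [lin_hyp |]
  | |- @lin ?k ?U ?W (fun z => ?g (@?f z) ?a ?b ?c ?d) =>
      apply (@lin_comp k U _ W (fun y => g y a b c d) f); [lin_hyp |]
  | |- @lin ?k ?U ?W (fun z => ?g (@?f z) ?a ?b ?c ?d ?e) =>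
      apply (@lin_comp k U _ W (fun y => g y a b c d e) f); [lin_hyp |]
  end); lin.

(** Rewriting with a lemma on Sweedler sums; the multilinearity side conditions
are discharged at once. *)
Ltac rwl lem := rewrite lem; [|lin ..].

(** * Sweedler calculus in Hopf algebras *)

Section Hopf.
Variables (k : fieldType) (H : algType k).
Variables (Delta : H -> H ⊗ H) (eps : H -> k) (S : H -> H).
Hypothesis HH : is_hopf_algebra Delta eps S.

Lemma lin_Delta : lin Delta.
Proof. by case: HH => -[]. Qed.
Lemma lin_eps : lin (eps : H -> k^o).
Proof. by case: HH => -[_ + _ _ _ ] _ _ _ _ _ _ _ => e c u v; rewrite e. Qed.
Lemma lin_S : lin S.
Proof. by case: HH. Qed.
Let lD := lin_Delta.
Let le := lin_eps.
Let lS := lin_S.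

Section Sweedler.
Variable W : lmodType k.

(** The equations between tensors are used in evaluated form, as equations
between Sweedler sums of an arbitrary multilinear G. *)
Lemma Delta_coassoc h (G : H -> H -> H -> W) : tril G ->
  \tsum_(h1 ⊗ h2 <- Delta h) \tsum_(u ⊗ v <- Delta h1) G u v h2 =
  \tsum_(h1 ⊗ h2 <- Delta h) \tsum_(u ⊗ v <- Delta h2) G h1 u v.
Proof.
move=> [G1 G2 G3].
have := comul_coassoc (hopf_coalgebra HH) h.
move/(congr1 (fun t => \tsum_(uv ⊗ w <- t) \tsum_(u ⊗ v <- uv) G u v w)).
rewrite !tsum_flatten; try lin.
under eq_tsum => h1 h2.
  rwl tsum_flatten.
  under eq_tsum => u v do (do 2 rwl tsum_tens).
  over.
move=> ->.
under eq_tsum => h1 h2.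
  rwl tsum_flatten.
  under eq_tsum => u v do (do 2 rwl tsum_tens).
  over.
by [].
Qed.

Lemma Delta_counitl h (G : H -> W) : lin G ->
  \tsum_(u ⊗ v <- Delta h) eps u *: G v = G h.
Proof.
move=> G1; rewrite -[in RHS](comul_counitl (hopf_coalgebra HH) h).
by rewrite (tsum_push G1); apply: eq_tsum => u v; rewrite (linZ G1).
Qed.

Lemma Delta_counitr h (G : H -> W) : lin G ->
  \tsum_(u ⊗ v <- Delta h) eps v *: G u = G h.
Proof.
move=> G1; rewrite -[in RHS](comul_counitr (hopf_coalgebra HH) h).
by rewrite (tsum_push G1); apply: eq_tsum => u v; rewrite (linZ G1).
Qed.

Lemma DeltaM g h (G : H -> H -> W) : bil G ->
  \tsum_(u ⊗ v <- Delta (g * h)) G u v =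
  \tsum_(g1 ⊗ g2 <- Delta g) \tsum_(h1 ⊗ h2 <- Delta h) G (g1 * h1) (g2 * h2).
Proof.
move=> [G1 G2]; rewrite (hopf_comulM HH) /tmul; rwl tsum_flatten.
apply: eq_tsum => g1 g2; rwl tsum_flatten.
by apply: eq_tsum => h1 h2; rwl tsum_tens.
Qed.

Lemma Delta1 (G : H -> H -> W) : bil G -> \tsum_(u ⊗ v <- Delta 1) G u v = G 1 1.
Proof. by move=> [G1 G2]; rewrite (hopf_comul1 HH); rwl tsum_tens. Qed.

Lemma Delta_Sl h (G : H -> W) : lin G ->
  \tsum_(u ⊗ v <- Delta h) G (S u * v) = eps h *: G 1.
Proof.
move=> G1; rewrite -(linZ G1) -(hopf_antipodel HH) (tsum_push G1) //.
Qed.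

Lemma Delta_Sr h (G : H -> W) : lin G ->
  \tsum_(u ⊗ v <- Delta h) G (u * S v) = eps h *: G 1.
Proof.
move=> G1; rewrite -(linZ G1) -(hopf_antipoder HH) (tsum_push G1) //.
Qed.
End Sweedler.

Lemma epsM g h : eps (g * h) = eps g * eps h.
Proof. exact: (hopf_counitM HH). Qed.
Lemma eps1 : eps 1 = 1.
Proof. exact: (hopf_counit1 HH). Qed.

Lemma S1 : S 1 = 1.
Proof.
have := Delta_Sl 1 (@lin_id k H).
by rwl Delta1; rewrite mulr1 eps1 scale1r.
Qed.

Lemma eps_S h : eps (S h) = eps h.
Proof.
transitivity (\tsum_(u ⊗ v <- Delta h) (eps v *: (eps (S u) : k^o))).
  by rwl (Delta_counitr h (G := fun u => eps (S u) : k^o)).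
transitivity (\tsum_(u ⊗ v <- Delta h) (eps (S u * v) : k^o)).
  by apply: eq_tsum => u v; rewrite epsM mulrC.
by rwl (Delta_Sl h (G := eps : H -> k^o)); rewrite eps1; exact: mulr1.
Qed.

(** Both sides are convolution inverses of the multiplication of H: the sum of
S(g1 h1) g2 h2 S(h3) S(g3) collapses to either of them. *)
Lemma SM g h : S (g * h) = S h * S g.
Proof.
transitivity (\tsum_(g1 ⊗ g2 <- Delta g) \tsum_(h1 ⊗ h2 <- Delta h)
  \tsum_(g3 ⊗ g4 <- Delta g1) \tsum_(h3 ⊗ h4 <- Delta h1)
   S (g3 * h3) * (g4 * h4) * (S h2 * S g2)); last first.
  transitivity (\tsum_(g1 ⊗ g2 <- Delta g) eps g1 *:
     \tsum_(h1 ⊗ h2 <- Delta h) eps h1 *: (S h2 * S g2)); last first.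
    by rwl Delta_counitl; rwl Delta_counitl.
  apply: eq_tsum => g1 g2.
  rewrite tsumZ.
  apply: eq_tsum => h1 h2.
  rewrite -(DeltaM g1 h1 (G := fun u v => S u * v * (S h2 * S g2))); last by lin.
  rwl (Delta_Sl (g1 * h1) (G := fun z => z * (S h2 * S g2))).
  by rewrite epsM mul1r scalerA.
under eq_tsum => g1 g2 do rewrite tsumC.
rewrite (@Delta_coassoc H g (fun a b c => \tsum_(h1 ⊗ h2 <- Delta h)
   \tsum_(h3 ⊗ h4 <- Delta h1) S (a * h3) * (b * h4) * (S h2 * S c))); last by lin.
transitivity (\tsum_(g1 ⊗ g2 <- Delta g) eps g2 *: \tsum_(h1 ⊗ h2 <- Delta h)
   eps h2 *: S (g1 * h1)).
  by rwl Delta_counitr; rwl Delta_counitr.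
apply: eq_tsum => g1 g2.
transitivity (\tsum_(u ⊗ v <- Delta g2) \tsum_(h1 ⊗ h2 <- Delta h)
   eps h2 *: (S (g1 * h1) * (u * S v))).
  under [RHS]eq_tsum => u v do rwl Delta_counitr.
  by rewrite (Delta_Sr g2) ?mulr1; [rwl Delta_counitr|lin].
apply: eq_tsum => u v.
rwl (@Delta_coassoc H h (fun a b c => S (g1 * a) * (u * b) * (S c * S v))).
apply: eq_tsum => h1 h2.
under eq_tsum => b c do rewrite !mulrA -(mulrA (S (g1 * h1) * u)).
rwl (Delta_Sr h2 (G := fun z => S (g1 * h1) * u * z * S v)).
by rewrite mulr1 !mulrA.
Qed.

(** Dually, Delta(S(h1) h2) (S(h4) ⊗ S(h3)) collapses to either side. *)
Lemma Delta_S (W : lmodType k) h (G : H -> H -> W) : bil G ->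
  \tsum_(u ⊗ v <- Delta (S h)) G u v = \tsum_(h1 ⊗ h2 <- Delta h) G (S h2) (S h1).
Proof.
move=> [G1 G2].
transitivity (\tsum_(h1 ⊗ h2 <- Delta h) \tsum_(a ⊗ b <- Delta h1)
   \tsum_(u ⊗ v <- Delta (S a * b)) \tsum_(c ⊗ d <- Delta h2) G (u * S d) (v * S c)).
  rwl (@Delta_coassoc W h (fun a b h2 => \tsum_(u ⊗ v <- Delta (S a * b))
      \tsum_(c ⊗ d <- Delta h2) G (u * S d) (v * S c))).
  transitivity (\tsum_(h1 ⊗ h2 <- Delta h) eps h2 *: \tsum_(u ⊗ v <- Delta (S h1)) G u v).
    by rwl Delta_counitr.
  apply: eq_tsum => h1 h2.
  transitivity (\tsum_(b ⊗ z <- Delta h2) \tsum_(u ⊗ v <- Delta (S h1))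
      \tsum_(b1 ⊗ b2 <- Delta b) \tsum_(c ⊗ d <- Delta z)
         G (u * b1 * S d) (v * b2 * S c)); last first.
    by apply: eq_tsum => b z; rwl DeltaM.
  rewrite tsumC tsumZ.
  apply: eq_tsum => u v.
  rwl (@Delta_coassoc W h2 (fun a b z => \tsum_(c ⊗ d <- Delta z)
     G (u * a * S d) (v * b * S c))).
  under eq_tsum => b1 z.
    rewrite -(@Delta_coassoc W z (fun b c d => G (u * b1 * S d) (v * b * S c))); last by lin.
    under eq_tsum => y d.
      under eq_tsum => b2 c do rewrite -(mulrA v).
      rwl (Delta_Sr y (G := fun q => G (u * b1 * S d) (v * q))).
      over.
    rwl (Delta_counitl z (G := fun d => G (u * b1 * S d) (v * 1))).
    rewrite mulr1 -(mulrA u).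
    over.
  by rwl (Delta_Sr h2 (G := fun q => G (u * q) v)); rewrite mulr1.
transitivity (\tsum_(h1 ⊗ h2 <- Delta h) eps h1 *: \tsum_(c ⊗ d <- Delta h2) G (S d) (S c)).
  apply: eq_tsum => h1 h2.
  rwl (Delta_Sl h1 (G := fun q => \tsum_(u ⊗ v <- Delta q)
    \tsum_(c ⊗ d <- Delta h2) G (u * S d) (v * S c))).
  rwl Delta1.
  by under eq_tsum do rewrite !mul1r.
by rwl Delta_counitl.
Qed.

End Hopf.

(** * Spaces of homomorphisms counted by traces *)

Lemma pchar0_natr_inj (k : fieldType) (char0 : has_pchar0 k) (m m' : nat) :
  m%:R = m'%:R :> k -> m = m'.
Proof.
have := (proj1 (pcharf0P _)) char0 => n0.
have h a b : (a <= b)%N -> a%:R = b%:R :> k -> a = b.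
  move=> ab abE; apply/eqP; rewrite eqn_leq ab -subn_eq0 /=.
  by rewrite -n0 natrB // abE subrr.
by case/orP: (leq_total m m') => /h // mm /esym/mm.
Qed.

Section Positivity.
Variables (k : fieldType) (n : nat) (P : 'M[k]_n -> 'M[k]_n).
Hypothesis char0 : has_pchar0 k.
Hypothesis lP : lin P.
Hypothesis PP : forall X, P (P X) = P X.
Hypothesis Pl : forall a X, P a = a -> P (a *m X) = a *m P X.
Hypothesis Pr : forall a X, P a = a -> P (X *m a) = P X *m a.

(** Here P is an averaging projection onto the commutant of a set of matrices
and E, F are idempotents of the commutant, i.e. subrepresentations. The map X
|-> E P(X) F projects onto the homomorphisms between them, so its trace is the
dimension of that space. *)
Definition homdim (E F : 'M[k]_n) : k :=
  ftr (@mxe k n) (@mxc k n) (fun X => E *m P X *m F).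

Let natr_inj := pchar0_natr_inj char0.

Lemma homdimDl E E' F : homdim (E + E') F = homdim E F + homdim E' F.
Proof.
by rewrite /homdim /ftr -big_split; apply: eq_bigr => i _; rewrite /= /mxc !mulmxDl mxE.
Qed.
Lemma homdimDr E F F' : homdim E (F + F') = homdim E F + homdim E F'.
Proof.
by rewrite /homdim /ftr -big_split; apply: eq_bigr => i _; rewrite /= /mxc mulmxDr mxE.
Qed.

Let PM a b : P a = a -> P b = b -> P (a *m b) = a *m b.
Proof. by move=> Pa Pb; rewrite Pl ?Pb. Qed.
Let lmull (A : 'M[k]_n) : lin (fun X : 'M[k]_n => A *m X).
Proof. by move=> c u v /=; rewrite mulmxDr -scalemxAr. Qed.
Let lmulr (A : 'M[k]_n) : lin (fun X : 'M[k]_n => X *m A).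
Proof. by move=> c u v /=; rewrite mulmxDl -scalemxAl. Qed.

Lemma homdimCl a b F : P a = a -> P b = b -> P F = F ->
  homdim (a *m b) F = homdim (b *m a) F.
Proof.
move=> Pa Pb PF; rewrite /homdim.
transitivity (ftr (@mxe k n) (@mxc k n) (fun X => a *m (b *m P X *m F))).
  by congr ftr; apply/funext => X; rewrite !mulmxA.
rewrite (@ftr_comp _ _ _ _ _ _ _ _ _ (fun X => b *m P X *m F) (fun X => a *m X)
  (mxframe k n) (mxframe k n)) //.
  by congr ftr; apply/funext => X; rewrite Pl // !mulmxA.
by move=> c u v; rewrite lP lmull lmulr.
Qed.

Lemma homdimCr a b E : P a = a -> P b = b -> P E = E ->
  homdim E (a *m b) = homdim E (b *m a).
Proof.
move=> Pa Pb PE; rewrite /homdim.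
transitivity (ftr (@mxe k n) (@mxc k n) (fun X => (E *m P X *m a) *m b)).
  by congr ftr; apply/funext => X; rewrite !mulmxA.
rewrite (@ftr_comp _ _ _ _ _ _ _ _ _ (fun X => E *m P X *m a) (fun X => X *m b)
  (mxframe k n) (mxframe k n)) //.
  by congr ftr; apply/funext => X /=; rewrite Pr // !mulmxA.
by move=> c u v; rewrite lP lmull lmulr.
Qed.

Lemma homdim_nat E F : P E = E -> P F = F -> E *m E = E -> F *m F = F ->
  exists r : nat, homdim E F = r%:R /\ (r = 0%N -> forall X, E *m P X *m F = 0).
Proof.
move=> PE PF EE FF; apply: (ftr_idem (mxframe k n)).
  by move=> c u v; rewrite lP lmull lmulr.
move=> X; rewrite Pr // Pl // PP.
by rewrite !mulmxA EE -!mulmxA FF.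
Qed.

(** Averaging a pseudo-inverse of a produces one that lies in the commutant:
the commutant is von Neumann regular. *)
Lemma commutant_regular a : P a = a -> exists2 b, P b = b & a *m b *m a = a.
Proof.
move=> Pa; exists (P (pinvmx a)); first exact: PP.
by rewrite -Pl // -Pr // mulmxKpV // Pa.
Qed.

(** Without nonzero homomorphisms in one direction there are none in the
other, by regularity of the commutant. The dimensions of the endomorphism
algebras then add up to 0. *)
Lemma homdim_disjoint E F : P E = E -> P F = F -> E *m E = E -> F *m F = F ->
  homdim E E + homdim F F = homdim E F + homdim F E ->
  (forall X, E *m P X *m F = 0) -> E = 0 /\ F = 0.
Proof.
move=> PE PF EE FF H EF0.
have FE0 X : F *m P X *m E = 0.
  have Pa : P (F *m P X *m E) = F *m P X *m E by rewrite PM ?PM.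
  have [b Pb <-] := commutant_regular Pa.
  by rewrite -Pb !mulmxA -(mulmxA _ E) -(mulmxA _ (E *m _) F) EF0 mulmx0 !mul0mx.
have hEF : homdim E F = 0.
  by rewrite /homdim /ftr big1 // => i _; rewrite EF0 /mxc mxE.
have hFE : homdim F E = 0.
  by rewrite /homdim /ftr big1 // => i _; rewrite FE0 /mxc mxE.
have [r [hE r0]] := homdim_nat PE PE EE EE.
have [s [hF s0]] := homdim_nat PF PF FF FF.
move: H; rewrite hE hF hEF hFE addr0 -natrD => /(@natr_inj _ 0%N)/eqP.
rewrite addn_eq0 => /andP[/eqP/r0/(_ E) E0 /eqP/s0/(_ F) F0].
by move: E0 F0; rewrite PE PF EE EE FF FF.
Qed.

(** Anisotropy: if the virtual representation E - F has zero pairing with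
itself, then E and F are isomorphic. By induction on the rank of E: a nonzero
homomorphism a with pseudo-inverse b identifies the summands a b of E and b a
of F, which are split off. *)
Lemma homdim_equiv E F : P E = E -> P F = F -> E *m E = E -> F *m F = F ->
  homdim E E + homdim F F = homdim E F + homdim F E ->
  exists a b, [/\ P a = a, P b = b, a *m b = E & b *m a = F].
Proof.
move: {2}(\rank E) (leqnn (\rank E)) => m.
elim: m E F => [|m IH] E F rE PE PF EE FF H.
all: have P0 : P 0 = 0 by exact: lin0 lP.
all: have [EF0|/existsNP[X /eqP X0]] := pselect (forall X, E *m P X *m F = 0);
  first by (have [-> ->] := homdim_disjoint PE PF EE FF H EF0;
            exists 0, 0; rewrite P0 mulmx0).
  by move: rE; rewrite leqn0 mxrank_eq0 => /eqP E0; rewrite E0 !mul0mx eqxx in X0.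
have [a [Pa Ea aF a0]] : exists a, [/\ P a = a, E *m a = a, a *m F = a & a != 0].
  exists (E *m P X *m F); split=> //; first by rewrite !PM ?PM.
    by rewrite !mulmxA EE.
  by rewrite -mulmxA FF.
have [b0 Pb0 ab0] := commutant_regular Pa.
have [b1 [Pb1 Fb1 b1E ab1]] :
    exists b, [/\ P b = b, F *m b = b, b *m E = b & a *m b *m a = a].
  exists (F *m b0 *m E); split; first by rewrite !PM ?PM.
  - by rewrite !mulmxA FF.
  - by rewrite -mulmxA EE.
  - by rewrite !mulmxA aF -(mulmxA _ E) Ea ab0.
(* Passing from b1 to b1 a b1 makes the relation between a and b symmetric. *)
have [b [Pb Fb bE aba bab]] : exists b,
    [/\ P b = b, F *m b = b, b *m E = b, a *m b *m a = a & b *m a *m b = b].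
  exists (b1 *m a *m b1); split; first by rewrite !PM ?PM.
  - by rewrite !mulmxA Fb1.
  - by rewrite -mulmxA b1E.
  - by rewrite !mulmxA ab1 ab1.
  - by rewrite -!mulmxA (mulmxA a) (mulmxA (a *m _)) ab1 (mulmxA a) (mulmxA (a *m _)) ab1.
pose E' := a *m b; pose F' := b *m a.
have PE' : P E' = E' by rewrite PM.
have PF' : P F' = F' by rewrite PM.
have E'E' : E' *m E' = E' by rewrite /E' mulmxA aba.
have F'F' : F' *m F' = F' by rewrite /F' mulmxA bab.
have EE' : E *m E' = E' by rewrite /E' mulmxA Ea.
have E'E : E' *m E = E' by rewrite /E' -mulmxA bE.
have FF' : F *m F' = F' by rewrite /F' mulmxA Fb.
have F'F : F' *m F = F' by rewrite /F' -mulmxA aF.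
pose E2 := E - E'; pose F2 := F - F'.
have PE2 : P E2 = E2 by rewrite (linB lP) PE PE'.
have PF2 : P F2 = F2 by rewrite (linB lP) PF PF'.
have E2E2 : E2 *m E2 = E2.
  by rewrite /E2 mulmxBl !mulmxBr EE EE' E'E E'E' subrr subr0.
have F2F2 : F2 *m F2 = F2.
  by rewrite /F2 mulmxBl !mulmxBr FF FF' F'F F'F' subrr subr0.
have rE2 : (\rank E2 <= m)%N.
  have : (\rank E2 + \rank E')%N = \rank E.
    apply: natr_inj; rewrite natrD -!mxtrace_idem // /E2.
    by rewrite linearB /= subrK.
  have : \rank E' != 0%N.
    rewrite mxrank_eq0; apply: contra a0 => /eqP E'0.
    by rewrite -aba -/E' E'0 mul0mx.
  by move: rE; lia.
have Es : E = E2 + E' by rewrite subrK.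
have Fs : F = F2 + F' by rewrite subrK.
have E2E' : E2 *m E' = 0 by rewrite mulmxBl EE' E'E' subrr.
have E'E2 : E' *m E2 = 0 by rewrite mulmxBr E'E E'E' subrr.
have F2F' : F2 *m F' = 0 by rewrite mulmxBl FF' F'F' subrr.
have F'F2 : F' *m F2 = 0 by rewrite mulmxBr F'F F'F' subrr.
clearbody E2 F2.
have hl Y : P Y = Y -> homdim E' Y = homdim F' Y by move=> ?; exact: homdimCl.
have hr Y : P Y = Y -> homdim Y E' = homdim Y F' by move=> ?; exact: homdimCr.
have aF' : a *m F' = a by rewrite mulmxA.
have E'a : E' *m a = a by [].
have bE' : b *m E' = b by rewrite mulmxA.
have F'b : F' *m b = b by [].
have abE : a *m b = E' by [].
have baF : b *m a = F' by [].
clearbody E' F'.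
have [|a2 [b2 [Pa2 Pb2 ab2 ba2]]] := IH E2 F2 rE2 PE2 PF2 E2E2 F2F2.
  move: H; rewrite Es Fs !homdimDl !homdimDr !hl // !hr // => H.
  apply/eqP; rewrite -subr_eq0; apply/eqP.
  move/eqP: H; rewrite -subr_eq0 => /eqP <-; ring.
have E2a2 : E2 *m a2 = a2 *m F2 by rewrite -ab2 -mulmxA ba2.
have b2E2 : b2 *m E2 = F2 *m b2 by rewrite -ab2 mulmxA ba2.
exists (a + E2 *m a2), (b + b2 *m E2); split.
- by rewrite (linD lP) PM ?PM // Pa.
- by rewrite (linD lP) PM ?PM // Pb.
- rewrite mulmxDl !mulmxDr abE b2E2 mulmxA -aF' -(mulmxA a) F'F2 mulmx0 mul0mx addr0.
  rewrite E2a2 -F'b !mulmxA -(mulmxA a2) F2F' mulmx0 mul0mx add0r -E2a2.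
  by rewrite -(mulmxA _ F2) -b2E2 !mulmxA -(mulmxA E2 a2) ab2 E2E2 E2E2 Es addrC.
- rewrite mulmxDl !mulmxDr baF mulmxA -bE' -(mulmxA b) E'E2 mulmx0 mul0mx addr0.
  rewrite -E'a !mulmxA -(mulmxA b2) E2E' mulmx0 mul0mx add0r.
  by rewrite -(mulmxA b2) E2E2 b2E2 -mulmxA ba2 F2F2 Fs addrC.
Qed.

End Positivity.

(** * Automorphisms of finite order have nonzero trace *)

Lemma tensmx11 (k : fieldType) m n :
  (1%:M : 'M[k]_m) *t (1%:M : 'M[k]_n) = 1%:M.
Proof.
apply/matrixP=> i j; case: (mxtens_indexP i) => a b; case: (mxtens_indexP j) => a' b'.
rewrite tensmxE !mxE (inj_eq (can_inj (@mxtens_indexK _ _))) xpair_eqE.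
by rewrite -natrM mulnb.
Qed.

Lemma mxtrace_tens (k : fieldType) m n (A : 'M[k]_m) (B : 'M[k]_n) :
  \tr (A *t B) = \tr A * \tr B.
Proof.
rewrite /mxtrace mulr_sum; apply: eq_bigr => i _.
by rewrite mxE; case: (mxtens_unindex i).
Qed.

Lemma tensmx_linl (k : fieldType) m n (B : 'M[k]_n) : lin (fun A : 'M[k]_m => A *t B).
Proof. by move=> a u v; apply/matrixP=> i j; rewrite !mxE mulrDl mulrA. Qed.

(** H is an algebra with separability idempotent x and a normalized right
integral t relative to epsi; sigma is an automorphism that fixes t and whose
order divides M. A matrix S with S^M = 1 is a representation V of the cyclic
group Z/M, and H ⊗ V is a module over the smash product of H and Z/M, where H
acts by left multiplication and the generator acts by sigma ⊗ S. *)
Section Twisted.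
Variables (k : fieldType) (H : algType k) (x : seq (H * H)).
Variables (sigma : H -> H) (M : nat) (epsi : H -> k) (t : H).
Variables (I : finType) (e : I -> H) (c : I -> H -> k^o).
Hypothesis char0 : has_pchar0 k.
Hypothesis x_central : forall (W : lmodType k) (f : H -> H -> W) h,
  (forall v, lin (f^~ v)) -> (forall u, lin (f u)) ->
  \sum_(p <- x) f (h * p.1) p.2 = \sum_(p <- x) f p.1 (p.2 * h).
Hypothesis x_mul : \sum_(p <- x) p.1 * p.2 = 1.
Hypothesis sigma_lin : lin sigma.
Hypothesis sigmaM : forall g h, sigma (g * h) = sigma g * sigma h.
Hypothesis sigma_order : forall h, iter M sigma h = h.
Hypothesis M_gt0 : (0 < M)%N.
Hypothesis t_right : forall h, t * h = epsi h *: t.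
Hypothesis epsi_lin : lin (epsi : H -> k^o).
Hypothesis epsi_t : epsi t = 1.
Hypothesis sigma_t : sigma t = t.
Hypotheses (fr : frame e c) (bas : forall i j, c i (e j) = (i == j)%:R).

Definition theta j : k := ftr e c (iter j sigma).

Local Notation mx := (fmx e c).
Let L h : 'M[k]_#|I| := mx (fun g => h * g).

Let lmull (h : H) : lin (fun g : H => h * g).
Proof. by move=> a u v /=; rewrite mulrDr -scalerAr. Qed.
Let lmulr (h : H) : lin (fun g : H => g * h).
Proof. by move=> a u v /=; rewrite mulrDl -scalerAl. Qed.
Let liter j : lin (iter j sigma).
Proof. by elim: j => [|j IH] a u v //=; rewrite IH sigma_lin. Qed.
Let iterM j g h : iter j sigma (g * h) = iter j sigma g * iter j sigma h.
Proof. by elim: j => //= j ->; rewrite sigmaM. Qed.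
Section Rep.
Variables (m : nat) (S : 'M[k]_m).
Hypothesis SM : S ^+ M = 1%:M.

Definition sgmx j : 'M[k]_(#|I| * m) := mx (iter j sigma) *t (S ^+ j).
Definition rhomx h : 'M[k]_(#|I| * m) := L h *t 1%:M.

Lemma sgmxD i j : sgmx i *m sgmx j = sgmx (i + j).
Proof.
rewrite tensmx_mul (mul_fmx fr) //; congr (mx _ *t _).
  by apply/funext => h /=; rewrite iterD.
by rewrite exprD.
Qed.
Lemma sgmxM : sgmx M = 1%:M.
Proof.
rewrite /sgmx SM (_ : iter M sigma = id) ?(fmx1 bas) ?tensmx11 //.
exact/funext/sigma_order.
Qed.
Lemma sgmx0 : sgmx 0 = 1%:M.
Proof. by rewrite /sgmx (fmx1 bas) tensmx11. Qed.
Lemma rhomx_lin : lin rhomx.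
Proof.
move=> a u v; rewrite /rhomx -tensmx_linl; congr (_ *t _).
by apply: (fmx_lin fr (F := fun h g : H => h * g)) => g; exact: lmulr.
Qed.
Lemma rhomxM g h : rhomx g *m rhomx h = rhomx (g * h).
Proof.
rewrite tensmx_mul mulmx1 (mul_fmx fr) //; congr (mx _ *t _).
by apply/funext => l /=; rewrite mulrA.
Qed.
Lemma rhomx1 : rhomx 1 = 1%:M.
Proof.
rewrite /rhomx /L (_ : (fun _ => _) = id) ?(fmx1 bas) ?tensmx11 //.
by apply/funext => h; rewrite mul1r.
Qed.
Lemma sgmx_rho j h : sgmx j *m rhomx h = rhomx (iter j sigma h) *m sgmx j.
Proof.
rewrite !tensmx_mul mulmx1 mul1mx !(mul_fmx fr) //; congr (mx _ *t _).
by apply/funext => g /=; rewrite iterM.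
Qed.

(** The average over the smash product: its separability idempotent is made of
x and of the averaging idempotent of the cyclic group. *)
Definition avgmx (X : 'M[k]_(#|I| * m)) : 'M[k]_(#|I| * m) :=
  M%:R^-1 *: \sum_(j < M) \sum_(p <- x)
     sgmx j *m rhomx p.1 *m X *m rhomx p.2 *m sgmx (M - j).

Definition inter (X : 'M[k]_(#|I| * m)) :=
  (forall h, rhomx h *m X = X *m rhomx h) /\ sgmx 1 *m X = X *m sgmx 1.

Lemma avgmx_lin : lin avgmx.
Proof.
move=> a u v; rewrite /avgmx scalerA mulrC -scalerA -scalerDr; congr (_ *: _).
rewrite scaler_sumr -big_split; apply: eq_bigr => j _ /=.
rewrite scaler_sumr -big_split; apply: eq_bigr => p _ /=.
by rewrite mulmxDr !mulmxDl -scalemxAr -!scalemxAl.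
Qed.

Lemma avgmx_inter X : inter (avgmx X).
Proof.
split=> [h|]; rewrite -scalemxAr -scalemxAl; congr (_ *: _);
  rewrite mulmx_sumr mulmx_suml.
- apply: eq_bigr => j _; rewrite mulmx_sumr mulmx_suml.
  pose f u v := sgmx j *m rhomx u *m X *m rhomx v *m sgmx (M - j).
  have f1 v : lin (f^~ v).
    move=> a u u'; rewrite /f rhomx_lin mulmxDr !mulmxDl.
    by rewrite -scalemxAr -!scalemxAl.
  have f2 u : lin (f u).
    move=> a v v'; rewrite /f rhomx_lin mulmxDr !mulmxDl.
    by rewrite -scalemxAr -!scalemxAl.
  transitivity (\sum_(p <- x) f (iter (M - j) sigma h * p.1) p.2).
    apply: eq_bigr => p _; rewrite /f !mulmxA -rhomxM !mulmxA sgmx_rho -iterD.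
    by rewrite subnKC ?sigma_order // ltnW.
  rewrite x_central //; apply: eq_bigr => p _.
  by rewrite /f -rhomxM -!mulmxA sgmx_rho.
- pose f i j := \sum_(p <- x) sgmx i *m rhomx p.1 *m X *m rhomx p.2 *m sgmx j.
  transitivity (\sum_(j < M) f j.+1 (M - j)%N).
    apply: eq_bigr => j _; rewrite mulmx_sumr; apply: eq_bigr => p _.
    by rewrite !mulmxA sgmxD.
  transitivity (\sum_(j < M) f j (M - j).+1%N); last first.
    apply: eq_bigr => j _; rewrite mulmx_suml; apply: eq_bigr => p _.
    by rewrite -!mulmxA sgmxD addn1.
  case: M M_gt0 sgmxM => // M' _ sM.
  rewrite big_ord_recr big_ord_recl /= addrC; congr (_ + _).
    apply: eq_bigr => p _; rewrite subSnn subn0 sM sgmx0.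
    by rewrite -(addn1 M'.+1) -sgmxD sM !mul1mx.
  apply: eq_bigr => j _; rewrite /bump /= add1n; congr f.
  by rewrite subSS -subSn // ltnW.
Qed.

Lemma sgmx_comm X j : inter X -> sgmx j *m X = X *m sgmx j.
Proof.
case=> _ X1; elim: j => [|j IH]; first by rewrite sgmx0 mul1mx mulmx1.
by rewrite -addn1 -sgmxD -mulmxA X1 mulmxA IH -mulmxA.
Qed.

Lemma sum_rhomx : \sum_(p <- x) rhomx p.1 *m rhomx p.2 = 1%:M.
Proof.
under eq_bigr do rewrite rhomxM.
by rewrite -(lin_sum rhomx_lin) x_mul rhomx1.
Qed.

Lemma inter_avgl a X : inter a -> avgmx (a *m X) = a *m avgmx X.
Proof.
move=> ia; have [ra _] := ia; rewrite -scalemxAr; congr (_ *: _).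
rewrite mulmx_sumr; apply: eq_bigr => j _; rewrite mulmx_sumr; apply: eq_bigr => p _.
by rewrite !mulmxA -(sgmx_comm _ ia) -!mulmxA (mulmxA (rhomx p.1)) ra !mulmxA.
Qed.
Lemma inter_avgr a X : inter a -> avgmx (X *m a) = avgmx X *m a.
Proof.
move=> ia; have [ra _] := ia; rewrite -scalemxAl; congr (_ *: _).
rewrite mulmx_suml; apply: eq_bigr => j _; rewrite mulmx_suml; apply: eq_bigr => p _.
by rewrite -!mulmxA (sgmx_comm _ ia) (mulmxA (rhomx p.2) a) ra !mulmxA.
Qed.

Lemma avgmx1 : avgmx 1%:M = 1%:M.
Proof.
rewrite /avgmx (eq_bigr (fun=> 1%:M)) => [|j _].
  rewrite sumr_const card_ord -scaler_nat scalerA mulVf ?scale1r //.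
  by rewrite (proj1 (pcharf0P _) char0) -lt0n.
transitivity (sgmx j *m (\sum_(p <- x) rhomx p.1 *m rhomx p.2) *m sgmx (M - j)).
  rewrite mulmx_sumr mulmx_suml; apply: eq_bigr => p _.
  by rewrite mulmx1 -!mulmxA.
by rewrite sum_rhomx mulmx1 sgmxD subnKC ?sgmxM // ltnW.
Qed.

Lemma avgmx_id X : inter X -> avgmx X = X.
Proof. by move=> iX; rewrite -{1}(mulmx1 X) inter_avgl // avgmx1 mulmx1. Qed.

(** By centrality and cyclicity, the two traces merge into the trace of
sigma^j composed with multiplication by x1 x2 = 1. *)
Lemma theta_sum j : (j <= M)%N ->
  \sum_(p <- x) \tr (mx (iter j sigma) *m L p.1) * \tr (L p.2 *m mx (iter (M - j) sigma)) =
  theta j.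
Proof.
move=> jM; pose psi := iter j sigma; pose psi' := iter (M - j) sigma.
have psiK h : psi (psi' h) = h by rewrite /psi /psi' -iterD subnKC ?sigma_order.
transitivity (\sum_(p <- x) \sum_i \sum_l
   (c i (psi (p.1 * e i)) : k) * (c l (p.2 * psi' (e l)) : k)).
  apply: eq_bigr => p _; rewrite !(mul_fmx fr) // !mxtrace_fmx /ftr.
  by rewrite mulr_suml; apply: eq_bigr => i _; rewrite mulr_sumr.
rewrite exchange_big /=.
transitivity (\sum_i \sum_(p <- x) (c i (p.2 * psi (p.1 * e i)) : k)); last first.
  rewrite exchange_big /=.
  transitivity (\sum_(p <- x) ftr e c (fun h => psi (p.1 * (p.2 * h)))).
    apply: eq_bigr => p _.
    rewrite -(@ftr_comp _ _ _ _ _ _ _ _ _ (fun h => psi (p.1 * h)) (fun h => p.2 * h) fr fr) //.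
    by move=> a u v; rewrite /psi lmull liter.
  rewrite /theta /ftr exchange_big; apply: eq_bigr => i _ /=.
  rewrite -(lin_sum (frame_lin fr i)) -(lin_sum (liter j)).
  congr (c i (psi _)).
  under eq_bigr do rewrite mulrA.
  by rewrite -mulr_suml x_mul mul1r.
apply: eq_bigr => i _; rewrite exchange_big /=.
pose f l u v : k^o := (c i (psi (u * e i)) : k) * (c l v : k).
have f1 l v : lin (f l^~ v).
  apply: lin_mulkl => a u u'.
  by rewrite /psi mulrDl -scalerAl liter (frame_lin fr).
have f2 l u : lin (f l u) by exact/lin_mulkr/(frame_lin fr).
transitivity (\sum_l \sum_(p <- x) f l (psi' (e l) * p.1) p.2).
  by apply: eq_bigr => l _; rewrite x_central.
rewrite exchange_big; apply: eq_bigr => p _ /=.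
rewrite {2}(frameE fr p.2) mulr_suml (lin_sum (frame_lin fr i)).
apply: eq_bigr => l _; rewrite /f -scalerAl (linZ (frame_lin fr i)) -mulrA /psi iterM.
by rewrite -/psi psiK mulrC.
Qed.

(** Hence the dimension of the space of homomorphisms between two modules H ⊗
V and H ⊗ W is the pairing of the characters of V and W weighted by the traces
of the powers of sigma. *)
Lemma avg_trace (E0 F0 : 'M[k]_m) :
  homdim avgmx (1%:M *t E0) (1%:M *t F0) =
  M%:R^-1 * \sum_(j < M) theta j * \tr (E0 *m S ^+ j) * \tr (S ^+ (M - j) *m F0).
Proof.
pose Y j p X : 'M[k]_(#|I| * m) := (1%:M *t E0) *m (sgmx j *m rhomx p.1) *m X
   *m (rhomx p.2 *m sgmx (M - j) *m (1%:M *t F0)).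
transitivity (M%:R^-1 * \sum_(j < M) \sum_(p <- x) ftr (@mxe k _) (@mxc k _) (Y j p)).
  rewrite /ftr; under [in RHS]eq_bigr do rewrite exchange_big.
  rewrite exchange_big mulr_sumr; apply: eq_bigr => ij _ /=.
  rewrite /avgmx -scalemxAr -scalemxAl /mxc mxE; congr (_ * _).
  rewrite mulmx_sumr mulmx_suml summxE; apply: eq_bigr => j _.
  rewrite mulmx_sumr mulmx_suml summxE; apply: eq_bigr => p _.
  by rewrite /Y !mulmxA.
congr (_ * _); apply: eq_bigr => j _.
rewrite -(theta_sum (ltnW (ltn_ord j))) 2!mulr_suml.
apply: eq_bigr => p _; rewrite /Y mxtrace_lmulr.
rewrite /sgmx /rhomx !tensmx_mul !mul1mx !mulmx1 !mxtrace_tens.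
by rewrite mulrACA mulrA.
Qed.

(** The integral t maps H ⊗ V onto t ⊗ V, where sigma acts trivially on the
first factor: the module H ⊗ V determines the character of V. *)
Lemma tr_t (X : 'M[k]_m) j : \tr (sgmx j *m rhomx t *m (1%:M *t X)) = \tr (S ^+ j *m X).
Proof.
rewrite !tensmx_mul !mulmx1 mxtrace_tens (mul_fmx fr) // mxtrace_fmx.
rewrite (_ : ftr _ _ _ = 1) ?mul1r //.
have -> : (iter j sigma \o (fun g => t * g)) = (fun g => epsi g *: t).
  apply/funext => g /=; rewrite t_right (linZ (liter j)); congr (_ *: _).
  by elim: j => //= j ->.
rewrite /ftr -[RHS]epsi_t.
rewrite {2}(frameE fr t) (lin_sum epsi_lin); apply: eq_bigr => i _.
by rewrite (linZ (frame_lin fr i)) (linZ epsi_lin); exact: mulrC.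
Qed.

Lemma inter_tens (X : 'M[k]_m) : S *m X = X *m S -> inter (1%:M *t X).
Proof.
by move=> SX; split=> [h|]; rewrite !tensmx_mul !mul1mx !mulmx1 ?expr1 ?SX.
Qed.

End Rep.

Lemma block_diag_exp m m' (S : 'M[k]_m) (S' : 'M[k]_m') j :
  (block_mx S 0 0 S') ^+ j = block_mx (S ^+ j) 0 0 (S' ^+ j).
Proof.
elim: j => [|j IH]; first by rewrite !expr0 -scalar_mx_block.
rewrite !exprS IH -!mulmxE mulmx_block.
by rewrite !mulmx0 !mul0mx !addr0 add0r.
Qed.

(** To compare V and V', both are made subrepresentations of one
representation, so that the results on idempotents of a commutant apply. *)
Section Blocks.
Variables (m m' : nat) (S : 'M[k]_m) (S' : 'M[k]_m').
Hypotheses (SM : S ^+ M = 1%:M) (SM' : S' ^+ M = 1%:M).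
Let Sb := block_mx S 0 0 S'.
Let E0 : 'M[k]_(m + m') := block_mx 1%:M 0 0 0.
Let F0 : 'M[k]_(m + m') := block_mx 0 0 0 1%:M.
Let E : 'M[k]_(#|I| * (m + m')) := 1%:M *t E0.
Let F : 'M[k]_(#|I| * (m + m')) := 1%:M *t F0.
Let mb := (mulmx_block, mulmx0, mul0mx, mul1mx, mulmx1, addr0, add0r,
  mxtrace_block, mxtrace0).

Let SbM : Sb ^+ M = 1%:M.
Proof. by rewrite block_diag_exp SM SM' -scalar_mx_block. Qed.
Let iE : inter Sb E. Proof. by apply: inter_tens; rewrite /E0 /Sb !mb. Qed.
Let iF : inter Sb F. Proof. by apply: inter_tens; rewrite /F0 /Sb !mb. Qed.
Let toi a : avgmx Sb a = a -> inter Sb a.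
Proof. by move=> <-; exact: avgmx_inter. Qed.
Let EE : E *m E = E. Proof. by rewrite /E tensmx_mul /E0 !mb. Qed.
Let FF : F *m F = F. Proof. by rewrite /F tensmx_mul /F0 !mb. Qed.
Let avg_id X : avgmx Sb (avgmx Sb X) = avgmx Sb X.
Proof. exact: (avgmx_id SbM (avgmx_inter SbM X)). Qed.
Let avgl a X (Pa : avgmx Sb a = a) := inter_avgl X (toi Pa).
Let avgr a X (Pa : avgmx Sb a = a) := inter_avgr X (toi Pa).

Lemma trace_pairing_nat : exists r : nat,
  M%:R^-1 * \sum_(j < M) theta j * \tr (S ^+ j) * \tr (S' ^+ (M - j)) = r%:R.
Proof.
have [r [hr _]] := homdim_nat (avgmx_lin Sb) avg_id avgl avgr
   (avgmx_id SbM iE) (avgmx_id SbM iF) EE FF.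
exists r; rewrite -hr avg_trace //; congr (_ * _); apply: eq_bigr => j _.
by rewrite /Sb !block_diag_exp /E0 /F0 !mb.
Qed.

(** The hypothesis is the equality of dimensions that [homdim_equiv] asks for;
it makes H ⊗ V and H ⊗ V' isomorphic, and [tr_t] recovers the characters. *)
Lemma twisted_trace_sep :
  \sum_(j < M) theta j * (\tr (S ^+ j) - \tr (S' ^+ j)) *
     (\tr (S ^+ (M - j)) - \tr (S' ^+ (M - j))) = 0 ->
  forall j, \tr (S ^+ j) = \tr (S' ^+ j).
Proof.
move=> H0; have [|a [b [Pa Pb ab ba]]] := homdim_equiv char0 (avgmx_lin Sb)
   avg_id avgl avgr (avgmx_id SbM iE) (avgmx_id SbM iF) EE FF.
  rewrite !avg_trace // -!mulrDr -!big_split /=; congr (_ * _).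
  apply/eqP; rewrite -subr_eq0 -sumrB -[X in _ == X]H0; apply/eqP.
  apply: eq_bigr => j _; rewrite /Sb !block_diag_exp /E0 /F0 !mb.
  by rewrite /=; ring.
have [ra _] := toi Pa.
move=> j.
have -> : \tr (S ^+ j) = \tr (Sb ^+ j *m E0) by rewrite /Sb block_diag_exp /E0 !mb.
have -> : \tr (S' ^+ j) = \tr (Sb ^+ j *m F0) by rewrite /Sb block_diag_exp /F0 !mb.
rewrite -!tr_t -/E -/F -ab -ba.
have cY : sgmx Sb j *m rhomx _ t *m a = a *m (sgmx Sb j *m rhomx _ t).
  by rewrite -mulmxA ra !mulmxA (sgmx_comm _ (toi Pa)).
by rewrite (mulmxA _ a) cY [LHS]mxtrace_mulC (mulmxA b) [LHS]mxtrace_mulC.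
Qed.
End Blocks.

(** The characters of representations of the cyclic group of order M; j is the
exponent of the generator. *)
Definition is_character (v : nat -> k) :=
  exists m (S : 'M[k]_m), S ^+ M = 1%:M /\ forall j, v j = \tr (S ^+ j).

Lemma is_character_theta : is_character theta.
Proof.
have pw j : mx sigma ^+ j = mx (iter j sigma).
  elim: j => [|j IH]; first by rewrite expr0 (fmx1 bas).
  by rewrite exprS IH -mulmxE (mul_fmx fr).
exists #|I|, (mx sigma); split=> [|j]; rewrite pw ?mxtrace_fmx //.
by rewrite -(fmx1 bas); congr (mx _); exact/funext/sigma_order.
Qed.

Lemma is_character_nat r : is_character (fun=> r%:R).
Proof.
exists r, 1%:M; have e1 j : (1%:M : 'M[k]_r) ^+ j = 1%:M by exact: expr1n.
by split=> [|j]; rewrite e1 ?mxtrace1.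
Qed.

Lemma is_characterD v w :
  is_character v -> is_character w -> is_character (fun j => v j + w j).
Proof.
move=> [m [S [SM hv]]] [m' [S' [SM' hw]]].
exists (m + m')%N, (block_mx S 0 0 S'); split=> [|j]; rewrite block_diag_exp.
  by rewrite SM SM' -scalar_mx_block.
by rewrite mxtrace_block hv hw.
Qed.

Lemma is_characterM v w :
  is_character v -> is_character w -> is_character (fun j => v j * w j).
Proof.
move=> [m [S [SM hv]]] [m' [S' [SM' hw]]].
have te j : (S *t S') ^+ j = S ^+ j *t S' ^+ j.
  elim: j => [|j IH]; first by rewrite !expr0 tensmx11.
  by rewrite !exprS IH -!mulmxE tensmx_mul.
exists (m * m')%N, (S *t S'); split=> [|j]; rewrite te.
  by rewrite SM SM' tensmx11.
by rewrite mxtrace_tens hv hw.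
Qed.

Lemma character_pairing v w : is_character v -> is_character w ->
  exists r : nat, M%:R^-1 * \sum_(j < M) theta j * v j * w (M - j)%N = r%:R.
Proof.
move=> [m [S [SM hv]]] [m' [S' [SM' hw]]].
have [r hr] := trace_pairing_nat SM SM'.
by exists r; rewrite -hr; congr (_ * _); apply: eq_bigr => j _; rewrite hv hw.
Qed.

Lemma is_characterX v r : is_character v -> is_character (fun j => v j ^+ r).
Proof.
move=> cv; elim: r => [|r IH]; first exact: (is_character_nat 1).
by under eq_fun do rewrite exprS; exact: is_characterM.
Qed.

Local Notation "p ^:k" := (map_poly (intr : int -> k) p) (at level 2).

Lemma virtual_character (p : {poly int}) : exists v w,
  [/\ is_character v, is_character w & forall j, p^:k.[theta j] = v j - w j].
Proof.
elim/poly_ind: p => [|p a [v [w [cv cw pE]]]].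
  exists (fun=> 0), (fun=> 0); split; try exact: (is_character_nat 0).
  by move=> j; rewrite rmorph0 horner0 subr0.
have ct := is_character_theta.
have [b [b' aE]] : exists b b' : nat, a%:~R = b%:R - b'%:R :> k.
  by case: a => b; [exists b, 0%N; rewrite subr0|exists 0%N, b.+1; rewrite sub0r].
exists (fun j => v j * theta j + b%:R), (fun j => w j * theta j + b'%:R).
split; try by apply: is_characterD; [exact: is_characterM|exact: is_character_nat].
move=> j; rewrite rmorphD rmorphM /= map_polyX map_polyC /= hornerMXaddC pE aE; ring.
Qed.

Lemma virtual_character_sep (p : {poly int}) :
  \sum_(j < M) theta j * p^:k.[theta j] * p^:k.[theta (M - j)] = 0 ->
  forall j, p^:k.[theta j] = 0.
Proof.
have [v [w [[m [S [SM hv]]] [m' [S' [SM' hw]]] pE]]] := virtual_character p.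
move=> H0 j; rewrite pE hv hw (twisted_trace_sep SM SM') ?subrr //.
by rewrite -[RHS]H0; apply: eq_bigr => i _; rewrite !pE !hv !hw.
Qed.

(** The functions theta^0, theta^1, up to theta^M on Z/M span at most M
dimensions, so their Gram matrix for the pairing weighted by theta is
singular. Its entries are natural numbers by [character_pairing], so it
annihilates a nonzero integral vector; the corresponding polynomial in theta
is orthogonal to itself, hence zero. *)
Lemma integral_relation : exists2 p : {poly int}, p != 0 &
  forall j, p^:k.[theta j] = 0.
Proof.
have ct r : is_character (fun j => theta j ^+ r).
  exact/is_characterX/is_character_theta.
pose g r s := sval (cid (character_pairing (ct r) (ct s))).
have gE r s : M%:R^-1 * \sum_(j < M) theta j * theta j ^+ r * theta (M - j) ^+ s = (g r s)%:R.
  by rewrite /g; case: cid.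
pose G : 'M[int]_M.+1 := \matrix_(r, s) (g r s : int).
have [u u0 uG] : exists2 u : 'rV_M.+1, u != 0 & u *m G = 0.
  apply/det0P.
  have : \det (map_mx (intr : int -> k) G) = 0.
    pose Y : 'M[k]_(M.+1, M) := \matrix_(r, j) (M%:R^-1 * theta j * theta j ^+ r).
    pose Y' : 'M[k]_(M, M.+1) := \matrix_(j, s) theta (M - j) ^+ s.
    have -> : map_mx (intr : int -> k) G = Y *m Y'.
      apply/matrixP=> r s; rewrite !mxE -[LHS]gE mulr_sumr; apply: eq_bigr => j _.
      by rewrite !mxE !mulrA.
    apply/eqP; rewrite -[_ == 0]negbK -unitfE -unitmxE -row_free_unit.
    apply/negP => /eqP E.
    by have := leq_trans (mxrankM_maxl Y Y') (rank_leq_col Y); rewrite E ltnn.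
  rewrite det_map_mx.
  case: (\det G) => b /eqP; first by rewrite (proj1 (pcharf0P _) char0).
  by rewrite oppr_eq0 (proj1 (pcharf0P _) char0).
exists (rVpoly u); first by apply: contra u0 => /eqP H0; rewrite -[u]rVpolyK H0 linear0.
have pE j : (rVpoly u)^:k.[theta j] = \sum_r (u 0 r)%:~R * theta j ^+ r.
  rewrite (@horner_coef_wide _ M.+1); last first.
    exact: leq_trans (size_poly _ _) (size_poly _ _).
  by apply: eq_bigr => r _; rewrite coef_map /= coef_rVpoly_ord.
apply: virtual_character_sep.
have gM r s : \sum_(j < M) theta j * theta j ^+ r * theta (M - j) ^+ s = M%:R * (g r s)%:R.
  by rewrite -gE mulVKf // (proj1 (pcharf0P _) char0) -lt0n.
have uG0 (s : 'I_M.+1) : \sum_r (u 0 r)%:~R * (g r s)%:R = 0 :> k.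
  move/matrixP/(_ 0 s)/(congr1 (intr : int -> k)): uG.
  rewrite !mxE rmorph0 rmorph_sum => uG.
  by rewrite -[RHS]uG; apply: eq_bigr => r _; rewrite rmorphM /= mxE.
transitivity (\sum_s (M%:R * (u 0 s)%:~R) * (\sum_r (u 0 r)%:~R * (g r s)%:R) : k); last first.
  by apply: big1 => s _; rewrite uG0 mulr0.
transitivity (\sum_s \sum_r \sum_(j < M)
    (theta j * ((u 0 r)%:~R * theta j ^+ r)) * ((u 0 s)%:~R * theta (M - j) ^+ s)).
  under [RHS]eq_bigr do rewrite exchange_big; rewrite [RHS]exchange_big /=.
  apply: eq_bigr => j _; rewrite !pE -mulrA big_distrlr mulr_sumr [RHS]exchange_big /=.
  by apply: eq_bigr => r _; rewrite mulr_sumr; apply: eq_bigr => s _; rewrite mulrA.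
apply: eq_bigr => s _; rewrite mulr_sumr; apply: eq_bigr => r _.
transitivity ((u 0 s)%:~R * (u 0 r)%:~R * (M%:R * (g r s)%:R) : k); last by ring.
by rewrite -gM mulr_sumr; apply: eq_bigr => j _; ring.
Qed.

(** If theta_1 = 0, a relation p(theta) = 0 has p(0) = 0, so that p = q X and
theta q(theta) = 0. Therefore q(theta) pairs to zero with itself, and q is a
relation of smaller degree: an infinite descent. *)
Lemma theta_neq0 : theta 1 != 0.
Proof.
have [p p0 pt] := integral_relation.
move: {2}(size p) (leqnn (size p)) => b.
elim: b p p0 pt => [|b IH] p p0 pt; first by rewrite leqn0 size_poly_eq0 (negPf p0).
move=> sp; apply/eqP => t0.
have /factor_theorem[q qE] : root p 0.
  rewrite rootE horner_coef0; have := pt 1%N; rewrite t0 horner_coef0 coef_map /=.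
  case: (p`_0) => a /eqP; first by rewrite (proj1 (pcharf0P _) char0).
  by rewrite oppr_eq0 (proj1 (pcharf0P _) char0).
rewrite subr0 in qE.
have q0 : q != 0 by apply: contra p0 => /eqP q0; rewrite qE q0 mul0r.
have : theta 1 != 0; last by rewrite t0 eqxx.
apply: (IH q q0); last by move: sp; rewrite qE size_mulX.
apply: virtual_character_sep; apply: big1 => j _.
have := pt j; rewrite qE rmorphM /= map_polyX hornerMX mulrC => ->.
by rewrite mul0r.
Qed.

End Twisted.

(** * Separable algebras are finite dimensional *)

Section Functionals.
Variables (k : fieldType) (V : lmodType k).

Definition subspace (U : V -> Prop) :=
  U 0 /\ forall (a : k) u w, U u -> U w -> U (a *: u + w).

Lemma subspaceZ U a u : subspace U -> U u -> U (a *: u).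
Proof. by case=> U0 UD Uu; rewrite -[_ *: _]addr0; apply: UD. Qed.

Lemma subspaceD U u w : subspace U -> U u -> U w -> U (u + w).
Proof. by case=> U0 UD Uu Uw; rewrite -[u]scale1r; apply: UD. Qed.

(** Zorn's lemma provides a subspace maximal among those that contain U and
avoid v. It is a hyperplane complementary to the line of v. *)
Lemma subspace_functional (U : V -> Prop) v : subspace U -> ~ U v ->
  exists f : V -> k^o, [/\ lin f, f v = 1 & forall u, U u -> f u = 0].
Proof.
move=> sU Uv; have [U0 UD] := sU.
pose P (X : V -> Prop) := [/\ forall (a : k) u w, X u -> X w -> X (a *: u + w),
   forall u w, U u -> X w -> X (u + w) & ~ X v].
have [A [[AD AU Av] Amax]] : exists A, P A /\
      forall B : V -> Prop, (forall w, A w -> B w) /\ ~ (forall w, B w -> A w) -> ~ P B.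
  apply: classical_sets.Zorn_bigcup => F FP Ftot; split.
  - move=> a u w [X FX Xu] [Y FY Yw].
    have [XY|YX] := Ftot X Y FX FY.
      by exists Y => //; have [h _ _] := FP Y FY; apply: h => //; exact: XY.
    by exists X => //; have [h _ _] := FP X FX; apply: h => //; exact: YX.
  - by move=> u w Uu [X FX Xw]; exists X => //; have [_ h _] := FP X FX; apply: h.
  - by move=> [X FX Xv]; have [_ _] := FP X FX.
have [w0 Aw0] : exists w, A w.
  apply: contrapT => /forallNP A0; apply: (Amax U).
    by split=> [w /A0//|UA]; apply: (A0 0); exact: UA.
  by split=> // u w; exact: subspaceD.
have A0 : A 0 by have := AD (-1) _ _ Aw0 Aw0; rewrite scaleN1r addNr.
have sA : subspace A by [].
have AUs u : U u -> A u by move=> Uu; rewrite -[u]addr0; apply: AU.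
have dec w : exists c : k, A (w - c *: v).
  have [Aw|nAw] := pselect (A w); first by exists 0; rewrite scale0r subr0.
  apply: contrapT => /forallNP nc.
  apply: (Amax (fun y => exists a c, A a /\ y = a + c *: w)).
    split; first by move=> a Aa; exists a, 0; rewrite scale0r addr0.
    move=> h; apply/nAw/h; exists 0, 1; by rewrite add0r scale1r.
  split.
  - move=> b u u' [a [c [Aa ->]]] [a' [c' [Aa' ->]]].
    exists (b *: a + a'), (b * c + c'); split; first exact: AD.
    by rewrite scalerDr scalerDl addrACA scalerA.
  - move=> u u' Uu [a [c [Aa ->]]]; exists (u + a), c; split; last by rewrite addrA.
    exact: AU.
  - move=> [a [c [Aa vE]]].
    have [c0|c0] := eqVneq c 0; first by apply: Av; rewrite vE c0 scale0r addr0.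
    apply: (nc c^-1); rewrite vE scalerDr scalerA mulVf // scale1r opprD addrCA subrr addr0.
    by rewrite -scaleNr; exact: subspaceZ.
pose f w : k^o := sval (cid (dec w)).
have fP w : A (w - (f w : k) *: v) by rewrite /f; case: cid.
have uniq w (c : k) : A (w - c *: v) -> f w = c.
  move=> Ac; apply: contrapT => fc; apply: Av.
  have : A ((c - f w) *: v).
    have := AD (-1) _ _ Ac (fP w); rewrite scaleN1r opprB addrA subrK.
    by rewrite -scalerBl.
  move/(subspaceZ (c - f w)^-1 sA); rewrite scalerA mulVf ?scale1r //.
  by rewrite subr_eq0 eq_sym; apply/eqP.
exists f; split.
- move=> a u w; apply: uniq.
  have -> : a *: u + w - (a *: f u + f w : k^o) *: v =
      a *: (u - (f u : k) *: v) + (w - (f w : k) *: v).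
    by rewrite scalerBr addrACA -opprD [in RHS]scalerA -scalerDl.
  exact: AD.
- by apply: uniq; rewrite scale1r subrr.
- by move=> u Uu; apply: uniq; rewrite scale0r subr0; exact: AUs.
Qed.

(** Dual coordinates for a spanning list, defined on the whole space even if
it is not yet known to be finite dimensional. *)
Lemma finite_functionals (b : seq V) : exists g : nat -> V -> k^o,
  (forall j, lin (g j)) /\
  forall v, v \in b -> v = \sum_(j < size b) (g j v : k) *: b`_j.
Proof.
elim/last_ind: b => [|b v [g [gl gE]]]; first by exists (fun _ _ => 0); split=> // j a u v; rewrite scaler0 addr0.
pose U w := w = \sum_(j < size b) (g j w : k) *: b`_j.
have sU : subspace U.
  split=> [|a u w uE wE]; first by apply/esym/big1 => j _; rewrite (lin0 (gl j)); exact: scale0r.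
  rewrite /U [in LHS]uE [in LHS]wE scaler_sumr -big_split; apply: eq_bigr => j _ /=.
  by rewrite gl scalerDl scalerA.
have rc (g' : nat -> V -> k^o) w : \sum_(j < size (rcons b v)) (g' j w : k) *: (rcons b v)`_j
    = \sum_(j < size b) (g' j w : k) *: b`_j + (g' (size b) w : k) *: v.
  rewrite size_rcons big_ord_recr /= nth_rcons ltnn eqxx; congr (_ + _).
  by apply: eq_bigr => j _; rewrite nth_rcons ltn_ord.
have [Uv|nUv] := pselect (U v).
  pose g' j : V -> k^o := if (j < size b)%N then g j else fun _ => 0.
  exists g'; rewrite /g'; split.
    by move=> j; case: ifP => // _ a u w; rewrite scaler0 addr0.
  move=> w; rewrite mem_rcons inE => wb.
  rewrite (rc g') /g' ltnn scale0r addr0.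
  under eq_bigr do rewrite ltn_ord.
  by case/predU1P: wb => [->|/gE].
have [f [fl fv f0]] := subspace_functional sU nUv.
pose g' j : V -> k^o :=
  if (j < size b)%N then fun w => g j w - (g j v : k) *: f w else f.
exists g'; rewrite /g'; split.
  move=> j; case: ifP => // _ a u w; rewrite gl fl.
  have E (p q r s d e : k) : p * q + r - d * (p * s + e) = p * (q - d * s) + (r - d * e).
    by ring.
  exact: E.
move=> w; rewrite mem_rcons inE => wb.
rewrite (rc g') /g' ltnn; under eq_bigr do rewrite ltn_ord.
case/predU1P: wb => [->|wb].
  rewrite fv scale1r big1 ?add0r // => j _.
  have -> : g j v - (g j v : k) *: (1 : k^o) = 0 by rewrite [_ *: _]mulr1 subrr.
  exact: scale0r.
have -> : (f w : k) *: v = 0 by rewrite (f0 w (gE w wb)); exact: scale0r.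
rewrite addr0 {1}(gE w wb); apply: eq_bigr => j _.
rewrite (f0 w (gE w wb)).
congr (_ *: _); have -> : (g j v : k) *: (0 : k^o) = 0 by exact: mulr0.
by rewrite subr0.
Qed.
End Functionals.

Section Separable.
Variables (k : fieldType) (A : algType k) (x : A ⊗ A).
Hypothesis x_central : forall a,
  \tsum_(x1 ⊗ x2 <- x) a * x1 ⊗ x2 = \tsum_(x1 ⊗ x2 <- x) x1 ⊗ x2 * a.
Hypothesis x_mul : \tsum_(x1 ⊗ x2 <- x) x1 * x2 = 1.

Lemma tsum_central (W : lmodType k) a (G : A -> A -> W) : bil G ->
  \tsum_(x1 ⊗ x2 <- x) G (a * x1) x2 = \tsum_(x1 ⊗ x2 <- x) G x1 (x2 * a).
Proof.
move=> [G1 G2]; have := x_central a.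
move/(congr1 (fun t => \tsum_(u ⊗ v <- t) G u v)).
rwl tsum_flatten; rwl tsum_flatten.
under eq_tsum do rwl tsum_tens.
by move=> ->; under eq_tsum do rwl tsum_tens.
Qed.

(** Let x be the sum of the a_i ⊗ b_i, and let g_j be coordinates for the b_j.
Then h is the sum of the h a_i b_i, that is of the g_j(b_i) h a_i b_j, and
centrality moves h into the coordinate g_j(b_i h) of a_i b_j. *)
Lemma separable_frame : exists n (e : 'I_n -> A) (c : 'I_n -> A -> k^o),
  frame e c /\ forall i j, c i (e j) = (i == j)%:R.
Proof.
pose b := [seq p.2 | p <- repr x].
have [g [gl gE]] := finite_functionals b.
pose I := ('I_(size (repr x)) * 'I_(size b))%type.
pose xi (i : 'I_(size (repr x))) := tnth (in_tuple (repr x)) i.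
pose e (i : I) := (xi i.1).1 * b`_(i.2).
pose c (i : I) h : k^o := g i.2 ((xi i.1).2 * h).
have fr : frame e c.
  split=> [i|h].
    by apply: (lin_comp (g := g i.2)) => //; lin.
  transitivity (\tsum_(x1 ⊗ x2 <- x) (h * x1) * x2).
    under eq_tsum do rewrite -mulrA.
    by rewrite -(tsum_push (L := fun z => h * z)); [rewrite x_mul mulr1|lin].
  transitivity (\tsum_(x1 ⊗ x2 <- x) \sum_(j < size b) (g j x2 : k) *: ((h * x1) * b`_j)).
    apply: eq_big_seq => p px /=; rewrite {1}(gE p.2) ?map_f // mulr_sumr.
    by apply: eq_bigr => j _; rewrite -scalerAr.
  rewrite (tsum_central h (G := fun x1 x2 => \sum_(j < size b) (g j x2 : k) *: (x1 * b`_j))).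
    rewrite /tlift /tens_eval (big_tnth _ _ (repr x)) pair_bigA /=.
    by apply: eq_bigr => -[i j].
  split=> [v|u] a w w'; rewrite scaler_sumr -big_split; apply: eq_bigr => j _ /=.
    by rewrite mulrDl scalerDr -scalerAl !scalerA mulrC.
  by rewrite gl scalerDl scalerA.
exact: frame_basis fr.
Qed.
End Separable.

(** * Semisimple Hopf algebras in characteristic zero are involutory *)

Section LarsonRadford.
Variables (k : fieldType) (H : algType k).
Variables (Delta : H -> H ⊗ H) (eps : H -> k) (S : H -> H).
Hypothesis HH : is_hopf_algebra Delta eps S.

Let lD : lin Delta := lin_Delta HH.
Let le : lin (eps : H -> k^o) := lin_eps HH.
Let lS : lin S := lin_S HH.

(** Split 1 along the augmentation ideal and a complementary left ideal J. The
component t in J works, because h t - eps(h) t lies in both ideals. *)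
Lemma normalized_integral : semisimple_ring H ->
  exists t, (forall h, h * t = eps h *: t) /\ eps t = 1.
Proof.
move=> ss; have e0 := lin0 le.
have [|J [[J0 JD JM] IJ dec]] := ss (fun h => eps h = 0).
  split=> // [h g h0 g0|h g g0]; first by rewrite (linD le) h0 g0 addr0.
  by rewrite (epsM HH) g0 mulr0.
have [i [t [i0 Jt E]]] := dec 1.
have et : eps t = 1 by rewrite -(eps1 HH) E (linD le) i0 add0r.
exists t; split=> // h; apply/eqP; rewrite -subr_eq0; apply/eqP.
have I0 g : eps g = 0 -> g * t = 0.
  move=> g0; have : (fun x => eps x = 0 /\ J x) (g * t).
    by split; [rewrite (epsM HH) g0 mul0r|exact: JM].
  by move/(congr1 (fun X => X (g * t))): IJ => /= ->.
rewrite -[_ *: t]mul1r -scalerAr scalerAl -mulrBl; apply: I0.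
by rewrite (linB le) (linZ le) (eps1 HH) [_ *: _]mulr1 subrr.
Qed.

Section Integral.
Variable t : H.
Hypothesis t_left : forall h, h * t = eps h *: t.
Hypothesis eps_t : eps t = 1.

(** This is centrality of the separability idempotent t1 ⊗ S(t2) of H,
obtained by expanding Delta(h1 t) ⊗ h2 in two ways. *)
Lemma integral_central (W : lmodType k) h (G : H -> H -> W) : bil G ->
  \tsum_(t1 ⊗ t2 <- Delta t) G (h * t1) (S t2) =
  \tsum_(t1 ⊗ t2 <- Delta t) G t1 (S t2 * h).
Proof.
move=> [G1 G2].
transitivity (\tsum_(h1 ⊗ h2 <- Delta h) \tsum_(u ⊗ v <- Delta (h1 * t)) G u (S v * h2)).
  under [RHS]eq_tsum => h1 h2 do rwl (DeltaM HH).
  rwl (@Delta_coassoc _ _ _ _ _ HH _ h (fun a b h2 => \tsum_(t1 ⊗ t2 <- Delta t)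
     G (a * t1) (S (b * t2) * h2))).
  transitivity (\tsum_(h1 ⊗ h2 <- Delta h) eps h2 *:
      \tsum_(t1 ⊗ t2 <- Delta t) G (h1 * t1) (S t2)).
    by rwl (Delta_counitr HH).
  apply: eq_tsum => h1 h2; rewrite tsumC.
  rewrite tsumZ.
  apply: eq_tsum => t1 t2.
  under eq_tsum => b c do rewrite (SM HH) -mulrA.
  by rwl (Delta_Sl HH h2 (G := fun z => G (h1 * t1) (S t2 * z))); rewrite mulr1.
under eq_tsum => h1 h2.
  rewrite t_left (linZ lD) (linZ (lin_tsum_arg (F := fun u v => G u (S v * h2)) _)); last by lin.
  over.
by rwl (Delta_counitl HH).
Qed.

Definition integral_sep : H ⊗ H := \tsum_(t1 ⊗ t2 <- Delta t) t1 ⊗ S t2.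

Lemma hopf_frame : exists n (e : 'I_n -> H) (c : 'I_n -> H -> k^o),
  frame e c /\ forall i j, c i (e j) = (i == j)%:R.
Proof.
apply: (@separable_frame _ _ integral_sep) => [a|]; rewrite /integral_sep.
  rwl tsum_flatten; rwl tsum_flatten.
  under eq_tsum do rwl tsum_tens.
  under [RHS]eq_tsum do rwl tsum_tens.
  by rwl (integral_central a (G := fun u v => u ⊗ v)).
rwl tsum_flatten; under eq_tsum do rwl tsum_tens.
by rwl (Delta_Sr HH t (G := fun z => z)); rewrite eps_t scale1r.
Qed.

Section Frame.
Variables (n : nat) (e : 'I_n -> H) (c : 'I_n -> H -> k^o).
Hypotheses (fr : frame e c) (bas : forall i j, c i (e j) = (i == j)%:R).
Local Notation tr := (ftr e c).

Let lc i : lin (c i) := frame_lin fr i.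

(** A trace through two composable tensors: the frame may be inserted on
either side of their common leg. *)
Lemma frame_comul (W : lmodType k) (D N : H -> H ⊗ H) (G : H -> H -> W) :
  lin D -> lin N -> bil G ->
  \sum_i (\tsum_(u ⊗ v <- D (e i)) \tsum_(p ⊗ q <- N v) (c i q : k) *: G p u) =
  \sum_j (\tsum_(p ⊗ q <- N (e j)) \tsum_(u ⊗ v <- D q) (c j v : k) *: G p u).
Proof.
move=> lD' lN [G1 G2].
transitivity (\sum_i \sum_j (\tsum_(u ⊗ v <- D (e i)) \tsum_(p ⊗ q <- N (e j))
    (c j v : k) *: ((c i q : k) *: G p u))).
  apply: eq_bigr => i _; rewrite tsum_bigC; apply: eq_tsum => u v.
  rewrite {1}(frameE fr v).
  rewrite (lin_sum (f := fun v => tlift (N v) (fun p q => (c i q : k) *: G p u))); last by lin.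
  apply: eq_bigr => j _.
  rewrite (linZ (f := fun v => tlift (N v) (fun p q => (c i q : k) *: G p u))); last by lin.
  by rewrite tsumZ.
rewrite exchange_big; apply: eq_bigr => j _ /=.
under eq_bigr do rewrite tsumC.
rewrite tsum_bigC; apply: eq_tsum => p q.
rewrite [in RHS](frameE fr q).
rewrite (lin_sum (f := fun q => tlift (D q) (fun u v => (c j v : k) *: G p u))); last by lin.
apply: eq_bigr => i _.
rewrite (linZ (f := fun q => tlift (D q) (fun u v => (c j v : k) *: G p u))); last by lin.
rewrite tsumZ.
by apply: eq_tsum => u v; rewrite !scalerA mulrC.
Qed.

Lemma frame_comulr (W : lmodType k) (N : H -> H ⊗ H) (G : H -> H -> W) :
  lin N -> bil G ->
  \sum_i (\tsum_(u ⊗ v <- Delta (e i)) \tsum_(p ⊗ q <- N v) (c i q : k) *: G p u) =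
  \sum_j (\tsum_(p ⊗ q <- N (e j)) \tsum_(u ⊗ v <- Delta q) (c j v : k) *: G p u).
Proof. exact: frame_comul. Qed.

Lemma frame_comull (W : lmodType k) (N : H -> H ⊗ H) (G : H -> H -> W) :
  lin N -> bil G ->
  \sum_i (\tsum_(v ⊗ u <- Delta (e i)) \tsum_(p ⊗ q <- N v) (c i p : k) *: G q u) =
  \sum_j (\tsum_(p ⊗ q <- N (e j)) \tsum_(v ⊗ u <- Delta p) (c j v : k) *: G q u).
Proof.
move=> lN [G1 G2].
have lsw (N' : H -> H ⊗ H) : lin N' -> lin (fun z => tswap (N' z)).
  by move=> lN'; rewrite /tswap; lin.
have lsD := lsw _ lD; have lsN := lsw _ lN.
have := frame_comul lsD lsN (conj G1 G2).
under eq_bigr => i _.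
  rwl (tswap_tsum (Delta (e i)) (G := fun u v => \tsum_(p ⊗ q <- tswap (N v)) (c i q : k) *: G p u)).
  under eq_tsum => v u do rwl (tswap_tsum (N v) (G := fun p q => (c i q : k) *: G p u)).
  over.
move=> ->; apply: eq_bigr => j _.
rwl (tswap_tsum (N (e j)) (G := fun p q => \tsum_(u ⊗ v <- tswap (Delta q)) (c j v : k) *: G p u)).
by apply: eq_tsum => p q; rwl (tswap_tsum (Delta p) (G := fun u v => (c j v : k) *: G q u)).
Qed.

Definition phi (h : H) : k^o := tr (fun g => h * S (S g)).
Definition psi (h : H) : k^o := tr (fun g => S (S g) * h).

Lemma phi_lin : lin phi.
Proof.
move=> a u v; rewrite /phi /ftr scaler_sumr -big_split; apply: eq_bigr => i _ /=.
by rewrite mulrDl -scalerAl lc.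
Qed.
Lemma psi_lin : lin psi.
Proof.
move=> a u v; rewrite /psi /ftr scaler_sumr -big_split; apply: eq_bigr => i _ /=.
by rewrite mulrDr -scalerAr lc.
Qed.
Let lphi := phi_lin.
Let lpsi := psi_lin.

Lemma Delta_SS (W : lmodType k) h (G : H -> H -> W) : bil G ->
  \tsum_(u ⊗ v <- Delta (S (S h))) G u v = \tsum_(u ⊗ v <- Delta h) G (S (S u)) (S (S v)).
Proof.
by move=> [G1 G2]; rwl (Delta_S HH); rwl (Delta_S HH).
Qed.

Lemma eps_SS h : eps (S (S h)) = eps h. Proof. by rewrite !(eps_S HH). Qed.

(** The trace phi is a left integral on H. Since h1 ⊗ h2 S^2(e) equals g1
S(e1) ⊗ g2 with g = h S^2(e2), the coproduct of the frame vector e can be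
transferred to the coordinates by [frame_comulr]; there the antipode cancels.
*)
Lemma phi_left (W : lmodType k) h (G : H -> W) : lin G ->
  \tsum_(h1 ⊗ h2 <- Delta h) (phi h2 : k) *: G h1 = (phi h : k) *: G 1.
Proof.
move=> lG.
transitivity (\sum_i (\tsum_(u ⊗ v <- Delta (e i)) \tsum_(p ⊗ q <- Delta (h * S (S v)))
   (c i q : k) *: G (p * S u))).
  transitivity (\sum_i (\tsum_(h1 ⊗ h2 <- Delta h) (c i (h2 * S (S (e i))) : k) *: G h1)).
    rewrite tsum_bigC; apply: eq_tsum => h1 h2.
    by rewrite /phi /ftr scaler_suml.
  apply: eq_bigr => i _.
  transitivity (\tsum_(u ⊗ v <- Delta (e i)) \tsum_(h1 ⊗ h2 <- Delta h)
     \tsum_(a ⊗ b <- Delta v) (c i (h2 * S (S b)) : k) *: G (h1 * S (S a) * S u)); last first.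
    apply: eq_tsum => u v; rwl (DeltaM HH); apply: eq_tsum => h1 h2.
    by rwl Delta_SS.
  rewrite tsumC; apply: eq_tsum => h1 h2.
  rewrite -(@Delta_coassoc _ _ _ _ _ HH _ (e i) (fun u a b =>
    (c i (h2 * S (S b)) : k) *: G (h1 * S (S a) * S u))); last by lin.
  transitivity (\tsum_(z ⊗ b <- Delta (e i)) eps z *: ((c i (h2 * S (S b)) : k) *: G h1)).
    by rwl (Delta_counitl HH (e i) (G := fun b => (c i (h2 * S (S b)) : k) *: G h1)).
  apply: eq_tsum => z b.
  under eq_tsum => u a do rewrite -mulrA -(SM HH).
  rwl (Delta_Sr HH z (G := fun y => (c i (h2 * S (S b)) : k) *: G (h1 * S y))).
  by rewrite (S1 HH) mulr1.
rewrite (@frame_comulr _ (fun v => Delta (h * S (S v))) (fun p u => G (p * S u))); [|lin|lin].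
rewrite /phi /ftr scaler_suml; apply: eq_bigr => j _.
rewrite -(@Delta_coassoc _ _ _ _ _ HH _ (h * S (S (e j)))
   (fun p u v => (c j v : k) *: G (p * S u))); last by lin.
under eq_tsum => z v do rwl (Delta_Sr HH z (G := fun y => (c j v : k) *: G y)).
by rwl (Delta_counitl HH (h * S (S (e j))) (G := fun v => (c j v : k) *: G 1)).
Qed.

(** The mirror image of [phi_left]. *)
Lemma psi_right (W : lmodType k) h (G : H -> W) : lin G ->
  \tsum_(h1 ⊗ h2 <- Delta h) (psi h1 : k) *: G h2 = (psi h : k) *: G 1.
Proof.
move=> lG.
transitivity (\sum_i (\tsum_(v ⊗ u <- Delta (e i)) \tsum_(p ⊗ q <- Delta (S (S v) * h))
   (c i p : k) *: G (S u * q))).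
  transitivity (\sum_i (\tsum_(h1 ⊗ h2 <- Delta h) (c i (S (S (e i)) * h1) : k) *: G h2)).
    rewrite tsum_bigC; apply: eq_tsum => h1 h2.
    by rewrite /psi /ftr scaler_suml.
  apply: eq_bigr => i _.
  transitivity (\tsum_(v ⊗ u <- Delta (e i)) \tsum_(h1 ⊗ h2 <- Delta h)
     \tsum_(a ⊗ b <- Delta v) (c i (S (S a) * h1) : k) *: G (S u * (S (S b) * h2))); last first.
    apply: eq_tsum => v u; rwl (DeltaM HH); rwl Delta_SS; rewrite tsumC.
    by [].
  rewrite tsumC; apply: eq_tsum => h1 h2.
  rwl (@Delta_coassoc _ _ _ _ _ HH _ (e i) (fun a b u =>
    (c i (S (S a) * h1) : k) *: G (S u * (S (S b) * h2)))).
  transitivity (\tsum_(a ⊗ z <- Delta (e i)) eps z *: ((c i (S (S a) * h1) : k) *: G h2)).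
    by rwl (Delta_counitr HH (e i) (G := fun a => (c i (S (S a) * h1) : k) *: G h2)).
  apply: eq_tsum => a z.
  under eq_tsum => b u do rewrite mulrA -(SM HH).
  rwl (Delta_Sl HH z (G := fun y => (c i (S (S a) * h1) : k) *: G (S y * h2))).
  by rewrite (S1 HH) mul1r.
rewrite (@frame_comull _ (fun v => Delta (S (S v) * h)) (fun q u => G (S u * q))); [|lin|lin].
rewrite /psi /ftr scaler_suml; apply: eq_bigr => j _.
rwl (@Delta_coassoc _ _ _ _ _ HH _ (S (S (e j)) * h)
   (fun v u q => (c j v : k) *: G (S u * q))).
under eq_tsum => v z do rwl (Delta_Sl HH z (G := fun y => (c j v : k) *: G y)).
by rwl (Delta_counitr HH (S (S (e j)) * h) (G := fun v => (c j v : k) *: G 1)).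
Qed.

Lemma tr_comp (f g : H -> H) : lin f -> lin g ->
  tr (fun h => g (f h)) = tr (fun h => f (g h)).
Proof. exact: ftr_comp. Qed.

Lemma tr_rank1 (u : H) (f : H -> k^o) : lin f -> tr (fun h => (f h : k) *: u) = f u.
Proof.
move=> lf; rewrite [in RHS](frameE fr u) (lin_sum lf); apply: eq_bigr => i _.
by rewrite (linZ (lc i)) (linZ lf); exact: mulrC.
Qed.

Lemma psi_t : psi t = 1.
Proof.
rewrite -[RHS]eps_t -(tr_rank1 t le); apply: eq_bigr => i _.
by rewrite t_left eps_SS.
Qed.

(** The Frobenius property of psi: centrality of t1 ⊗ S(t2) reduces it to
psi(t1) t2 = psi(t) = 1. It makes S surjective. *)
Lemma psi_frame h : \tsum_(t1 ⊗ t2 <- Delta t) (psi (h * t1) : k) *: S t2 = h.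
Proof.
rwl (integral_central h (G := fun u v => (psi u : k) *: v)).
rewrite (@psi_right _ t (fun v => S v * h)); last by lin.
by rewrite psi_t scale1r (S1 HH) mul1r.
Qed.

Lemma antipode_surj h : exists g, S g = h.
Proof.
exists (\tsum_(t1 ⊗ t2 <- Delta t) (psi (h * t1) : k) *: t2).
rewrite (tsum_push lS) -[RHS]psi_frame.
by apply: eq_tsum => u v; rewrite (linZ lS).
Qed.

Lemma S_t_right g : S t * g = eps g *: S t.
Proof.
by have [h' <-] := antipode_surj g; rewrite -(SM HH) t_left (linZ lS) (eps_S HH).
Qed.

(** H is unimodular: S t is a right integral by surjectivity of S, so the
product S(t) t equals both t and S(t). *)
Lemma S_t : S t = t.
Proof. by have := S_t_right t; rewrite t_left (eps_S HH) eps_t !scale1r. Qed.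

Lemma t_right h : t * h = eps h *: t.
Proof. by rewrite -{1}S_t S_t_right S_t. Qed.

Lemma phi_S h : phi (S h) = psi h.
Proof.
rewrite /phi /psi.
transitivity (tr (fun g => S (S g * h))).
  by congr ftr; apply/funext => g; rewrite (SM HH).
by rewrite (tr_comp (f := fun g => S g * h) (g := S)) //; lin.
Qed.

Lemma phi_t : phi t = 1. Proof. by rewrite -S_t phi_S psi_t. Qed.

Lemma phi_comm g h : phi (g * h) = phi (h * S (S g)).
Proof.
rewrite /phi.
transitivity (tr (fun y => g * (h * S (S y)))).
  by congr ftr; apply/funext => y; rewrite mulrA.
rewrite (tr_comp (f := fun y => h * S (S y)) (g := fun y => g * y)); [|lin|lin].
by congr ftr; apply/funext => y; rewrite !(SM HH) !mulrA.
Qed.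

Lemma psi_comm g h : psi (g * h) = psi (S (S h) * g).
Proof.
rewrite /psi.
transitivity (tr (fun y => (S (S y) * g) * h)).
  by congr ftr; apply/funext => y; rewrite mulrA.
rewrite (tr_comp (f := fun y => S (S y) * g) (g := fun y => y * h)); [|lin|lin].
by congr ftr; apply/funext => y; rewrite !(SM HH) !mulrA.
Qed.

Lemma antipode_inj g h : S g = S h -> g = h.
Proof.
move=> E; apply/eqP; rewrite -subr_eq0; apply/eqP.
have : S (g - h) = 0 by rewrite (linB lS) E subrr.
move: (g - h) => y Sy; rewrite -[y]psi_frame.
transitivity (\tsum_(t1 ⊗ t2 <- Delta t) (0 : H)).
  apply: eq_tsum => u v; rewrite -phi_S (SM HH) Sy mulr0 (lin0 lphi).
  exact: scale0r.
by rewrite /tlift /tens_eval big1.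
Qed.

Lemma integral_right (W : lmodType k) h (G : H -> H -> W) : bil G ->
  \tsum_(t1 ⊗ t2 <- Delta t) G (t1 * h) t2 =
  \tsum_(t1 ⊗ t2 <- Delta t) G t1 (t2 * S h).
Proof.
move=> [G1 G2].
transitivity (\tsum_(h1 ⊗ h2 <- Delta h) \tsum_(u ⊗ v <- Delta (t * h1)) G u (v * S h2)).
  under [RHS]eq_tsum => h1 h2 do (rwl (DeltaM HH); rewrite tsumC).
  rwl (@Delta_coassoc _ _ _ _ _ HH _ h (fun a b h2 => \tsum_(t1 ⊗ t2 <- Delta t)
     G (t1 * a) (t2 * b * S h2))).
  transitivity (\tsum_(h1 ⊗ h2 <- Delta h) eps h2 *:
      \tsum_(t1 ⊗ t2 <- Delta t) G (t1 * h1) t2).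
    by rwl (Delta_counitr HH).
  apply: eq_tsum => h1 h2; rewrite tsumC.
  rewrite tsumZ.
  apply: eq_tsum => t1 t2.
  under eq_tsum => b b' do rewrite -mulrA.
  by rwl (Delta_Sr HH h2 (G := fun z => G (t1 * h1) (t2 * z))); rewrite mulr1.
under eq_tsum => h1 h2.
  rewrite t_right (linZ lD) (linZ (lin_tsum_arg (F := fun u v => G u (v * S h2)) _)); last by lin.
  over.
by rwl (Delta_counitl HH).
Qed.

Lemma phi_frame h : \tsum_(t1 ⊗ t2 <- Delta t) (phi (t2 * S h) : k) *: t1 = h.
Proof.
rewrite -(integral_right h (G := fun u v => (phi v : k) *: u)); last by lin.
rwl (phi_left t (G := fun u => u * h)).
by rewrite phi_t scale1r mul1r.
Qed.

Lemma phi_nondeg z : (forall g, phi (g * z) = 0) -> z = 0.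
Proof.
have [z' <-] := antipode_surj z => z0; rewrite -(lin0 lS); congr S.
rewrite -[LHS]phi_frame /tlift /tens_eval big1 // => p _.
by rewrite z0; exact: scale0r.
Qed.

Lemma psi_frame_inv h : \tsum_(t1 ⊗ t2 <- Delta t) (psi (S h * t1) : k) *: t2 = h.
Proof.
apply: antipode_inj; rewrite (tsum_push lS) -[RHS]psi_frame.
by apply: eq_tsum => u v; rewrite (linZ lS).
Qed.

(** The distinguished grouplike element of the integral phi. *)
Definition modular : H := \tsum_(t1 ⊗ t2 <- Delta t) (phi t1 : k) *: t2.

(** The defect d of the asserted formula satisfies f(y1) d(y2) = f(1) d(y) for
every functional f, and vanishes at t; expanding y by [psi_frame_inv] gives d
= 0. *)
Lemma phi_modular (W : lmodType k) h (G : H -> W) : lin G ->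
  \tsum_(h1 ⊗ h2 <- Delta h) (phi h1 : k) *: G h2 = (phi h : k) *: G modular.
Proof.
move=> lG; pose d y := \tsum_(h1 ⊗ h2 <- Delta y) (phi h1 : k) *: h2 - (phi y : k) *: modular.
have ld : lin d by apply: lin_sub; lin.
have dP (f : H -> k^o) y : lin f ->
    \tsum_(y1 ⊗ y2 <- Delta y) (f y1 : k) *: d y2 = (f 1 : k) *: d y.
  move=> lf; rewrite /d scalerBr scalerA.
  under eq_tsum => y1 y2 do rewrite scalerBr.
  rewrite tsumB.
  congr (_ - _).
    transitivity (\tsum_(y1 ⊗ y2 <- Delta y) \tsum_(a ⊗ b <- Delta y2)
        ((f y1 : k) * (phi a : k)) *: b).
      apply: eq_tsum => y1 y2; rewrite tsumZ.
      by apply: eq_tsum => a b; rewrite scalerA.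
    rewrite -(@Delta_coassoc _ _ _ _ _ HH _ y (fun y1 a b => ((f y1 : k) * (phi a : k)) *: b)); last by lin.
    rewrite tsumZ.
    apply: eq_tsum => z b; rewrite scalerA.
    transitivity ((\tsum_(y1 ⊗ a <- Delta z) ((phi a : k) *: f y1) : k) *: b).
      rewrite (tsum_push (L := fun s : k^o => (s : k) *: b)); last by lin.
      by apply: eq_tsum => y1 a; rewrite mulrC.
    by rewrite (phi_left z lf); congr (_ *: _); exact: mulrC.
  transitivity ((\tsum_(y1 ⊗ a <- Delta y) ((phi a : k) *: f y1) : k) *: modular).
    rewrite (tsum_push (L := fun s : k^o => (s : k) *: modular)); last by lin.
    by apply: eq_tsum => y1 a; rewrite scalerA mulrC.
  by rewrite (phi_left y lf); congr (_ *: _); exact: mulrC.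
have dt : d t = 0 by rewrite /d phi_t scale1r subrr.
have d0 y : d y = 0.
  rewrite -{1}(psi_frame_inv y) (tsum_push ld).
  under eq_tsum do rewrite (linZ ld).
  by rewrite (dP (fun z => psi (S y * z))) ?dt ?scaler0 //; lin.
move/eqP: (d0 h); rewrite subr_eq0 => /eqP E.
rewrite -(linZ lG) -E (tsum_push lG).
by apply: eq_tsum => u v; rewrite (linZ lG).
Qed.

Lemma Delta_modular (W : lmodType k) (G : H -> H -> W) : bil G ->
  \tsum_(u ⊗ v <- Delta modular) G u v = G modular modular.
Proof.
move=> [G1 G2].
transitivity (\tsum_(t1 ⊗ t2 <- Delta t) \tsum_(u ⊗ v <- Delta t1) (phi u : k) *: G v t2).
  rwl (@Delta_coassoc _ _ _ _ _ HH _ t (fun a u v => (phi a : k) *: G u v)).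
  rewrite /modular (tsum_push (L := fun z => tlift (Delta z) G)); last by lin.
  apply: eq_tsum => t1 t2; rewrite (linZ lD) (linZ (lin_tsum_arg _)); last by lin.
  by rewrite tsumZ.
under eq_tsum => t1 t2 do rwl (phi_modular t1 (G := fun v => G v t2)).
by rwl (phi_modular t (G := fun v => G modular v)); rewrite phi_t scale1r.
Qed.

Lemma eps_modular : eps modular = 1.
Proof.
rewrite /modular (tsum_push le).
transitivity (\tsum_(u ⊗ v <- Delta t) (eps v *: phi u)).
  by apply: eq_tsum => u v; rewrite (linZ le); exact: mulrC.
by rewrite (Delta_counitr HH t lphi) phi_t.
Qed.

Lemma modular_S : modular * S modular = 1.
Proof.
have := Delta_Sr HH modular (@lin_id k H).
by rwl Delta_modular; rewrite eps_modular scale1r.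
Qed.

Lemma S_modular : S modular * modular = 1.
Proof.
have := Delta_Sl HH modular (@lin_id k H).
by rwl Delta_modular; rewrite eps_modular scale1r.
Qed.

(** Uniqueness of integrals: psi and phi(- modular) are right integrals on H
and agree at t. *)
Lemma psi_phi h : psi h = phi (h * modular).
Proof.
pose d y : k^o := phi (y * modular) - psi y.
have ld : lin d by apply: lin_sub; lin.
have dP (f : H -> k^o) y : lin f ->
    \tsum_(y1 ⊗ y2 <- Delta y) (d y1 : k) *: f y2 = (d y : k) *: f 1.
  move=> lf; rewrite /d scalerBl -(psi_right y lf).
  under eq_tsum => y1 y2 do rewrite scalerBl.
  rewrite tsumB.
  congr (_ - _).
  have := phi_modular (y * modular) (G := fun z => f (z * S modular)).
  rewrite (DeltaM HH) ?modular_S; [|lin].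
  move=> <-; last by lin.
  apply: eq_tsum => u v.
  rwl Delta_modular.
  by rewrite -mulrA modular_S mulr1.
have dt : d t = 0.
  by rewrite /d t_right eps_modular scale1r phi_t psi_t subrr.
apply/esym/eqP; rewrite -subr_eq0 -/(d h); apply/eqP.
rewrite -{1}(phi_frame h) (tsum_push ld).
transitivity (\tsum_(u ⊗ v <- Delta t) ((d u : k) *: phi (v * S h))).
  by apply: eq_tsum => u v; rewrite (linZ ld); exact: mulrC.
by rewrite (dP (fun v => phi (v * S h))) ?dt; [exact: mul0r|lin].
Qed.

(** Radford's formula in the unimodular case. It results from the rules phi(g
h) = phi(h S^2(g)) and psi(g h) = psi(S^2(h) g), since phi is nondegenerate.
*)
Lemma antipode4 h : S (S (S (S h))) = S modular * h * modular.
Proof.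
suff E : h * modular = modular * S (S (S (S h))).
  by rewrite -mulrA E mulrA S_modular mul1r.
apply/eqP; rewrite -subr_eq0; apply/eqP; apply: phi_nondeg => g.
rewrite mulrBr (linB lphi); apply/eqP; rewrite subr_eq0; apply/eqP.
rewrite mulrA -psi_phi psi_comm psi_phi -mulrA phi_comm.
by rewrite mulrA.
Qed.

Section GroupLike.
Variable a : H.
Hypothesis Delta_a : forall (W : lmodType k) (G : H -> H -> W), bil G ->
  \tsum_(u ⊗ v <- Delta a) G u v = G a a.
Hypothesis eps_a : eps a = 1.

Lemma grouplike_exp j (W : lmodType k) (G : H -> H -> W) : bil G ->
  \tsum_(u ⊗ v <- Delta (a ^+ j)) G u v = G (a ^+ j) (a ^+ j).
Proof.
elim: j G => [|j IH] G [G1 G2]; first by rwl (Delta1 HH).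
rewrite exprS; rwl (DeltaM HH).
by rwl Delta_a; rwl IH.
Qed.

(** The operator that maps z to z1 c(z2) - c(a^m) z kills a^m and multiplies
a^i by c(a^i) - c(a^m), which is nonzero for some coordinate c. *)
Lemma grouplike_indep m :
  (forall i j, (i < j)%N -> (j < m)%N -> a ^+ i <> a ^+ j) ->
  forall cf : nat -> k, \sum_(i < m) cf i *: a ^+ i = 0 -> forall i, (i < m)%N -> cf i = 0.
Proof.
elim: m => // m IH dist cf rel.
have cf0 i : (i < m)%N -> cf i = 0.
  move=> im; have aim := dist i m im (ltnSn m).
  have [l cl] : exists l, c l (a ^+ i) <> c l (a ^+ m).
    apply: contrapT => /forallNP E; apply: aim.
    by apply: (frame_coordE fr) => l; apply: contrapT; exact: E.
  pose L z := \tsum_(u ⊗ v <- Delta z) (c l v : k) *: u - (c l (a ^+ m) : k) *: z.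
  have lL : lin L by apply: lin_sub; lin.
  have La j : L (a ^+ j) = ((c l (a ^+ j) : k) - c l (a ^+ m)) *: a ^+ j.
    by rewrite /L scalerBl; rwl (grouplike_exp j).
  have R : \sum_(j < m) (cf j * ((c l (a ^+ j) : k) - c l (a ^+ m))) *: a ^+ j = 0.
    have := congr1 L rel; rewrite (lin0 lL) (lin_sum lL) big_ord_recr /=.
    rewrite (linZ lL) La subrr scale0r scaler0 addr0 => E; rewrite -[RHS]E.
    by apply: eq_bigr => j _; rewrite (linZ lL) La scalerA.
  have := IH (fun i j ij jm => dist i j ij (ltnW jm))
     (fun i => cf i * ((c l (a ^+ i) : k) - c l (a ^+ m))) R i im.
  by move/eqP; rewrite mulf_eq0 subr_eq0 => /orP [/eqP//|/eqP].
move=> i; rewrite ltnS leq_eqVlt => /orP[/eqP ->|/cf0//].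
move: rel; rewrite big_ord_recr /= big1 => [|j _]; last by rewrite cf0 // scale0r.
rewrite add0r => /(congr1 eps); rewrite (linZ le) (lin0 le).
have -> : eps (a ^+ m) = 1.
  by elim: m {IH dist cf0} => [|m IH]; rewrite ?(eps1 HH) // exprS (epsM HH) IH eps_a mul1r.
by move=> E; rewrite -[LHS]mulr1; exact: E.
Qed.

Lemma grouplike_order b : b * a = 1 -> exists N, (0 < N)%N /\ a ^+ N = 1.
Proof.
move=> ba; apply: contrapT => /forallNP nN.
pose C : 'M[k]_(n.+1, n) := \matrix_(i, l) (c l (a ^+ i) : k).
have : kermx C != 0.
  by rewrite -mxrank_eq0 mxrank_ker subn_eq0 -ltnNge ltnS rank_leq_col.
move=> ker0; have := nz_row_sub (kermx C); rewrite sub_kermx => /eqP vC.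
have : nz_row (kermx C) != 0 by rewrite nz_row_eq0.
move: (nz_row _) vC => v vC /eqP; apply.
have ab j : b ^+ j * a ^+ j = 1.
  by elim: j => [|j IH]; rewrite ?mulr1 // exprSr exprS -mulrA (mulrA b) ba mul1r.
have dist i j : (i < j)%N -> (j < n.+1)%N -> a ^+ i <> a ^+ j.
  move=> ij _ E; apply: (nN (j - i)%N); split; first by rewrite subn_gt0.
  have : b ^+ i * a ^+ i = b ^+ i * a ^+ j by rewrite E.
  by rewrite ab -[X in a ^+ X](subnKC (ltnW ij)) exprD mulrA ab mul1r => <-.
pose cf (i : nat) : k := if insub i is Some i' then v 0 i' else 0.
have cfE (i : 'I_n.+1) : cf i = v 0 i.
  by rewrite /cf insubT // => lt; congr (v _ _); exact: val_inj.
apply/rowP => i; rewrite mxE -cfE; apply: (grouplike_indep dist) => //.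
apply: (frame_coordE fr) => l; rewrite (lin_sum (lc l)) (lin0 (lc l)).
move/rowP/(_ l): vC; rewrite !mxE; under eq_bigr do rewrite mxE.
under [X in _ -> X = _]eq_bigr => j _ do rewrite (linZ (lc l)) cfE.
by [].
Qed.
End GroupLike.

Lemma antipode_order : exists M, (0 < M)%N /\ forall h, iter M (fun h => S (S h)) h = h.
Proof.
have [N [N0 aN]] := grouplike_order Delta_modular eps_modular S_modular.
exists (2 * N)%N; split=> [|h]; first by rewrite muln_gt0.
have -> : iter (2 * N) (fun h => S (S h)) h = S modular ^+ N * h * modular ^+ N.
  elim: N {N0 aN} => [|N IH]; first by rewrite muln0 mul1r mulr1.
  by rewrite mulnS iterD /= IH antipode4 exprS exprSr !mulrA.
have -> : S modular ^+ N = 1.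
  rewrite -[LHS]mulr1 -{1}aN.
  elim: N {N0 aN} => [|N IH]; first by rewrite mulr1.
  by rewrite exprSr exprS -mulrA (mulrA (S modular)) S_modular mul1r.
by rewrite aN mul1r mulr1.
Qed.

Section CharZero.
Hypothesis char0 : has_pchar0 k.

Lemma tr_antipode2_neq0 : tr (fun h => S (S h)) != 0.
Proof.
have [M [M0 oM]] := antipode_order.
pose x := [seq (p.1, S p.2) | p <- repr (Delta t)].
have xc (W : lmodType k) (f : H -> H -> W) h :
    (forall v, lin (f^~ v)) -> (forall u, lin (f u)) ->
    \sum_(p <- x) f (h * p.1) p.2 = \sum_(p <- x) f p.1 (p.2 * h).
  move=> f1 f2; rewrite !big_map.
  exact: (integral_central h (conj f1 f2)).
have xm : \sum_(p <- x) p.1 * p.2 = 1.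
  rewrite big_map; have := Delta_Sr HH t (@lin_id k H).
  by rewrite eps_t scale1r.
rewrite -[tr _]/(theta (fun h => S (S h)) e c 1).
have sl : lin (fun h => S (S h)) by lin.
have sM : forall g h, S (S (g * h)) = S (S g) * S (S h) by move=> g h; rewrite !(SM HH).
have st : S (S t) = t by rewrite !S_t.
exact: (theta_neq0 char0 xc xm sl sM oM M0 t_right le eps_t st fr bas).
Qed.

Lemma phi1 : phi 1 = tr (fun h => S (S h)).
Proof. by congr ftr; apply/funext => h; rewrite mul1r. Qed.
Lemma psi1 : psi 1 = tr (fun h => S (S h)).
Proof. by congr ftr; apply/funext => h; rewrite mulr1. Qed.

(** The sum of psi(h1) phi(h2) is computed by the integral property of either
function; both take the nonzero value tr(S^2) at 1. *)
Lemma phi_psi h : phi h = psi h.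
Proof.
have A := phi_left h lpsi; have B := psi_right h lphi.
apply: (mulIf tr_antipode2_neq0); rewrite -{1}psi1 -phi1.
apply: (etrans (esym A)); apply: etrans B.
by apply: eq_tsum => u v; exact: mulrC.
Qed.

(** As phi and psi coincide, both commutation rules hold for phi, so phi takes
the same value at g h and g S^4(h), and it is nondegenerate. *)
Lemma antipode4_id h : S (S (S (S h))) = h.
Proof.
apply/esym/eqP; rewrite -subr_eq0; apply/eqP; apply: phi_nondeg => g.
rewrite mulrBr (linB lphi); apply/eqP; rewrite subr_eq0; apply/eqP.
by rewrite phi_psi psi_comm -phi_psi phi_comm.
Qed.

Definition regchar (h : H) : k^o := tr (fun g => h * g).

Lemma regchar_lin : lin regchar.
Proof.
move=> a u v; rewrite /regchar /ftr scaler_sumr -big_split; apply: eq_bigr => i _ /=.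
by rewrite mulrDl -scalerAl lc.
Qed.
Let lchi := regchar_lin.

Lemma regcharC g h : regchar (g * h) = regchar (h * g).
Proof.
rewrite /regchar.
transitivity (tr (fun y => g * (h * y))); first by congr ftr; apply/funext => y; rewrite mulrA.
rewrite (tr_comp (f := fun y => h * y) (g := fun y => g * y)); [|lin|lin].
by congr ftr; apply/funext => y; rewrite mulrA.
Qed.

(** Tensoring with the regular representation gives a multiple of it, here for
any trace function f in place of a character. *)
Lemma regchar_conv (f : H -> k^o) h : lin f -> (forall g h, f (g * h) = f (h * g)) ->
  \tsum_(h1 ⊗ h2 <- Delta h) (regchar h1 : k) *: f h2 = (regchar h : k) *: f 1.
Proof.
move=> lf fC.
transitivity (\sum_i (\tsum_(v ⊗ u <- Delta (e i)) \tsum_(p ⊗ q <- Delta (h * v))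
   (c i p : k) *: f (q * S u))).
  transitivity (\sum_i (\tsum_(h1 ⊗ h2 <- Delta h) (c i (h1 * e i) : k) *: f h2)).
    rewrite tsum_bigC; apply: eq_tsum => h1 h2.
    by rewrite /regchar /ftr scaler_suml.
  apply: eq_bigr => i _.
  under [RHS]eq_tsum => v u do (rwl (DeltaM HH); rewrite tsumC).
  rwl (@Delta_coassoc _ _ _ _ _ HH _ (e i) (fun a b u => \tsum_(h1 ⊗ h2 <- Delta h)
    (c i (h1 * a) : k) *: f (h2 * b * S u))).
  transitivity (\tsum_(a ⊗ z <- Delta (e i)) eps z *: \tsum_(h1 ⊗ h2 <- Delta h)
     (c i (h1 * a) : k) *: f h2).
    by rwl (Delta_counitr HH (e i) (G := fun a => \tsum_(h1 ⊗ h2 <- Delta h)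
     (c i (h1 * a) : k) *: f h2)).
  apply: eq_tsum => a z; rewrite tsumC.
  rewrite (tsum_push (L := fun y => eps z *: y)); last by lin.
  apply: eq_tsum => h1 h2.
  under eq_tsum => b u do rewrite -mulrA.
  rwl (Delta_Sr HH z (G := fun y => (c i (h1 * a) : k) *: f (h2 * y))).
  by rewrite mulr1.
rewrite (@frame_comull _ (fun v => Delta (h * v)) (fun q u => f (q * S u))); [|lin|lin].
rewrite /regchar /ftr scaler_suml; apply: eq_bigr => j _.
rwl (@Delta_coassoc _ _ _ _ _ HH _ (h * e j) (fun v u q => (c j v : k) *: f (q * S u))).
under eq_tsum => v z.
  under eq_tsum => u q do rewrite fC.
  rwl (Delta_Sl HH z (G := fun y => (c j v : k) *: f y)).
  over.
by rwl (Delta_counitr HH (h * e j) (G := fun v => (c j v : k) *: f 1)).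
Qed.

Lemma regchar_SS h : regchar (S (S h)) = regchar h.
Proof.
rewrite /regchar.
transitivity (tr (fun g => S (S (h * S (S g))))).
  by congr ftr; apply/funext => g; rewrite !(SM HH) antipode4_id.
rewrite (tr_comp (f := fun g => h * S (S g)) (g := fun g => S (S g))); [|lin|lin].
by congr ftr; apply/funext => g; rewrite antipode4_id.
Qed.

Lemma regchar_t : regchar t = 1.
Proof.
rewrite -[RHS]eps_t -(tr_rank1 t le); apply: eq_bigr => i _.
by rewrite t_right.
Qed.

(** Convolution with the regular character; divided by dim H it is an
idempotent. *)
Definition regproj h := \tsum_(h1 ⊗ h2 <- Delta h) (regchar h1 : k) *: h2.

Lemma regproj_lin : lin regproj. Proof. by rewrite /regproj; lin. Qed.

Lemma regprojK h : regproj (regproj h) = (regchar 1 : k) *: regproj h.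
Proof.
rewrite {2}/regproj (tsum_push regproj_lin).
transitivity (\tsum_(h1 ⊗ h2 <- Delta h) \tsum_(u ⊗ v <- Delta h2)
    ((regchar h1 : k) * (regchar u : k)) *: v).
  apply: eq_tsum => h1 h2; rewrite (linZ regproj_lin) /regproj.
  rewrite tsumZ.
  by apply: eq_tsum => u v; rewrite scalerA.
rewrite -(@Delta_coassoc _ _ _ _ _ HH _ h
  (fun h1 u v => ((regchar h1 : k) * (regchar u : k)) *: v)); last by lin.
rewrite /regproj tsumZ.
apply: eq_tsum => z v; rewrite scalerA.
transitivity ((\tsum_(u ⊗ u' <- Delta z) ((regchar u : k) *: regchar u') : k) *: v).
  by rewrite (tsum_push (L := fun s : k^o => (s : k) *: v)) //; lin.
by rewrite (regchar_conv z lchi regcharC); congr (_ *: _); exact: mulrC.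
Qed.

Lemma regproj_SS h : regproj (S (S h)) = S (S (regproj h)).
Proof.
rewrite {1}/regproj; rwl Delta_SS.
rewrite /regproj (tsum_push (L := fun z => S (S z))); last by lin.
by apply: eq_tsum => u v; rewrite regchar_SS !(linZ lS).
Qed.

(** The trace is taken in the frame made of psi and t, where it becomes
regchar(t) tr(S^2). *)
Lemma tr_regproj_SS : tr (fun h => S (S (regproj h))) = tr (fun h => S (S h)).
Proof.
pose J := 'I_(size (repr (Delta t))).
pose ti (j : J) := tnth (in_tuple (repr (Delta t))) j.
have fr' : frame (fun j => S (ti j).2) (fun j h => psi (h * (ti j).1)).
  split=> [j|h]; first by lin.
  by rewrite -{1}(psi_frame h) /tlift /tens_eval big_tnth.
rewrite -[LHS](@ftr_comp _ _ _ _ _ _ _ _ _ (fun h => h) (fun h => S (S (regproj h))) fr' fr) //;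
  last by have := regproj_lin; lin.
transitivity (\tsum_(t1 ⊗ t2 <- Delta t) psi (S (S (regproj (S t2))) * t1)).
  by rewrite /tlift /tens_eval big_tnth.
transitivity (\tsum_(t1 ⊗ t2 <- Delta t) \tsum_(u ⊗ v <- Delta t2)
    ((regchar (S v) : k) *: phi (S (S (t1 * S u))))).
  apply: eq_tsum => t1 t2; rewrite /regproj; rwl (Delta_S HH).
  rewrite (tsum_push (L := fun z => psi (S (S z) * t1))); last by lin.
  apply: eq_tsum => u v; rewrite !(linZ lS) -scalerAl (linZ lpsi).
  by rewrite psi_comm -phi_psi !(SM HH).
rewrite -(@Delta_coassoc _ _ _ _ _ HH _ t
   (fun t1 u v => (regchar (S v) : k) *: phi (S (S (t1 * S u))))); last by lin.
under eq_tsum => z v do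
  rwl (Delta_Sr HH z (G := fun y => (regchar (S v) : k) *: phi (S (S y)))).
rwl (Delta_counitl HH t (G := fun v => (regchar (S v) : k) *: phi (S (S 1)))).
by rewrite S_t regchar_t !(S1 HH) phi1; exact: mul1r.
Qed.

(** Let n = dim H and d = tr(S^2). The idempotent regproj / n commutes with
S^2, and by [tr_regproj_SS] the involution S^2 has trace d / n on its image;
so n divides the nonzero integer d. As d is a difference of the dimensions of
the two eigenspaces of S^2, one of them is zero, and it is the one for -1
because S^2(1) = 1. *)
Lemma antipode_involutive_frame h : S (S h) = h.
Proof.
have nat_inj := pchar0_natr_inj char0.
have natr0 := proj1 (pcharf0P _) char0.
pose s h := S (S h); have ls : lin s by rewrite /s; lin.
have ss y : s (s y) = y by exact: antipode4_id.
have two0 : 2%:R != 0 :> k by rewrite natr0.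
(* the projections onto the eigenspaces of S^2 for 1 and -1 *)
pose E y : H := 2%:R^-1 *: (y + s y).
pose F y : H := 2%:R^-1 *: (y - s y).
have lE : lin E.
  by apply: lin_scaler => a u v; rewrite ls scalerDr addrACA.
have lF : lin F.
  by apply: lin_scaler; apply: lin_sub; lin.
have EsE y : E (s y) = E y by rewrite /E ss addrC.
have half (y : H) : 2%:R^-1 *: (y + y) = y.
  by rewrite -mulr2n -scaler_nat scalerA mulVf // scale1r.
have EE y : E (E y) = E y.
  by rewrite {1}/E (_ : s (E y) = E y) ?half // /E (linZ ls) (linD ls) ss addrC.
have FF y : F (F y) = F y.
  by rewrite {1}/F (_ : s (F y) = - F y) ?opprK ?half // /F (linZ ls) (linB ls) ss -scalerN opprB.
have [r0 [E0 E00]] := ftr_idem fr lE EE.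
have [rF [F0 F00]] := ftr_idem fr lF FF.
have [r [r1 r10]] := ftr_idem fr (@lin_id k H) (fun=> erefl).
have rn0 : (0 < r)%N.
  rewrite lt0n; apply/eqP => /r10/(_ 1)/eqP; rewrite oner_eq0; by [].
have regr : regchar 1 = r%:R.
  by rewrite -r1; congr ftr; apply/funext => y; rewrite mul1r.
pose p y := (regchar 1 : k)^-1 *: regproj y.
have lp : lin p.
  by move=> a u v; rewrite /p regproj_lin scalerDr !scalerA mulrC.
have reg0 : (regchar 1 : k) != 0 by rewrite regr natr0 -lt0n.
have pp y : p (p y) = p y.
  by rewrite /p (linZ regproj_lin) regprojK (scalerA _ (regchar 1 : k)) mulVf // scale1r.
have ps y : p (s y) = s (p y) by rewrite /p /s regproj_SS !(linZ lS).
have pE y : p (E y) = E (p y).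
  by rewrite /E (linZ lp) (linD lp) ps.
have [r2 [pE2 _]] := ftr_idem fr (p := fun y => E (p y))
  (fun a u v => etrans (congr1 E (lp a u v)) (lE a _ _))
  (fun y => etrans (congr1 E (pE (p y))) (etrans (EE _) (congr1 E (pp y)))).
have [r3 [p3 _]] := ftr_idem fr lp pp.
have trE (f g : H -> H) (a b : k) : tr (fun y => a *: f y + b *: g y) = a * tr f + b * tr g.
  rewrite /ftr 2!mulr_sumr -big_split; apply: eq_bigr => i _ /=.
  by rewrite (linD (lc i)) !(linZ (lc i)).
pose d := tr s.
have dE : d = 2%:R * r0%:R - r%:R.
  rewrite -E0 -r1.
  have -> : tr E = 2%:R^-1 * tr id + 2%:R^-1 * d.
    by rewrite -trE; congr ftr; apply/funext => y; rewrite /E scalerDr.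
  by rewrite mulrDr !mulVKf // addrAC subrr add0r.
have Fr : (r0 + rF)%N = r.
  apply: nat_inj; rewrite natrD -E0 -F0 -r1 -[tr E]mul1r -[tr F]mul1r -trE.
  congr ftr; apply/funext => y; rewrite !scale1r -scalerDr addrACA subrr addr0.
  exact: half.
have dp : d = r%:R * (2%:R * r2%:R - r3%:R).
  rewrite -pE2 -p3.
  have -> : tr (fun y => E (p y)) = 2%:R^-1 * tr p + 2%:R^-1 * ((r%:R)^-1 * d).
    rewrite /d -[tr s]tr_regproj_SS -regr.
    have -> : (regchar 1 : k)^-1 * tr (fun h => S (S (regproj h))) = tr (fun y => s (p y)).
      rewrite -[LHS]addr0 -[X in _ + X](mul0r (tr id)) -trE; congr ftr; apply/funext => y.
      by rewrite scale0r addr0 /s /p !(linZ lS).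
    by rewrite -trE; congr ftr; apply/funext => y; rewrite /E scalerDr.
  rewrite [2%:R * _]mulrDr !mulVKf // (addrAC (tr p)) subrr add0r mulVKf //.
  by rewrite natr0 -lt0n.
have key : (2 * r0 + r * r3 = r * (2 * r2) + r)%N.
  apply: nat_inj; rewrite !natrD !natrM.
  transitivity (d + (r%:R + r%:R * r3%:R)); first by rewrite dE; ring.
  by rewrite dp; ring.
have d0 : (2 * r0 != r)%N.
  apply/eqP => E1; have := tr_antipode2_neq0; rewrite -/d dE -natrM E1 subrr eqxx.
  by [].
have [z|z] : r0 = 0%N \/ rF = 0%N.
  have r3le : (r3 <= 2 * r2 + 1)%N by rewrite -(leq_pmul2l rn0) mulnDr muln1; lia.
  have : (2 * r0 = r * (2 * r2 + 1 - r3))%N by rewrite mulnBr mulnDr muln1; lia.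
  case: (2 * r2 + 1 - r3)%N => [|[|z]] zE; [left|move: d0|right]; lia.
- have := E00 z 1; rewrite /E /s !(S1 HH) half => /eqP; rewrite oner_eq0; by [].
- have := F00 z h => /(congr1 (fun y => 2%:R *: y)).
  rewrite scaler0 /F scalerA mulfV // scale1r => /eqP; rewrite subr_eq0 => /eqP.
  by move/esym.
Qed.

End CharZero.
End Frame.
End Integral.

(** The theorem of Larson and Radford. *)
Theorem antipode_involutive : has_pchar0 k -> semisimple_ring H -> forall h, S (S h) = h.
Proof.
move=> char0 ss h; have [t [t_left eps_t]] := normalized_integral ss.
have [n [e [c [fr bas]]]] := hopf_frame t_left eps_t.
exact: (antipode_involutive_frame t_left eps_t fr bas char0).
Qed.

End LarsonRadford.

(** * Quasi-triangular Hopf algebras with involutive antipode *)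

Section RMatrix.
Variables (k : fieldType) (H : algType k).
Variables (Delta : H -> H ⊗ H) (eps : H -> k) (S : H -> H) (R : H ⊗ H).
Hypothesis HH : is_hopf_algebra Delta eps S.
Hypothesis SS : forall h, S (S h) = h.
Hypothesis HR : is_quasitriangular Delta R.

Let lD : lin Delta := lin_Delta HH.
Let le : lin (eps : H -> k^o) := lin_eps HH.
Let lS : lin S := lin_S HH.

(** For an involutive antipode the antipode identities also hold with the two
factors exchanged. *)
Lemma Delta_Sl_flip (W : lmodType k) h (G : H -> W) : lin G ->
  \tsum_(u ⊗ v <- Delta h) G (S v * u) = eps h *: G 1.
Proof.
move=> lG; rewrite -(S1 HH); rewrite -(Delta_Sl HH h (G := fun z => G (S z))); last by lin.
by apply: eq_tsum => u v; rewrite (SM HH) SS.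
Qed.

Lemma Delta_Sr_flip (W : lmodType k) h (G : H -> W) : lin G ->
  \tsum_(u ⊗ v <- Delta h) G (v * S u) = eps h *: G 1.
Proof.
move=> lG; rewrite -(S1 HH); rewrite -(Delta_Sr HH h (G := fun z => G (S z))); last by lin.
by apply: eq_tsum => u v; rewrite (SM HH) SS.
Qed.

Section Sums.
Variable W : lmodType k.

Lemma R_comull (G : H -> H -> H -> W) : tril G ->
  \tsum_(r1 ⊗ r2 <- R) \tsum_(u ⊗ v <- Delta r1) G u v r2 =
  \tsum_(r1 ⊗ r2 <- R) \tsum_(s1 ⊗ s2 <- R) G r1 s1 (r2 * s2).
Proof.
move=> [G1 G2 G3]; have := qt_comull HR.
move/(congr1 (fun t => \tsum_(uv ⊗ w <- t) \tsum_(u ⊗ v <- uv) G u v w)).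
rwl tsum_flatten; rwl tsum_flatten.
under eq_tsum => r1 r2.
  rwl tsum_flatten; under eq_tsum => u v do (do 2 rwl tsum_tens).
  over.
move=> ->; apply: eq_tsum => r1 r2; rwl tsum_flatten.
by apply: eq_tsum => u v; do 2 rwl tsum_tens.
Qed.

Lemma R_comulr (G : H -> H -> H -> W) : tril G ->
  \tsum_(r1 ⊗ r2 <- R) \tsum_(u ⊗ v <- Delta r2) G r1 u v =
  \tsum_(r1 ⊗ r2 <- R) \tsum_(s1 ⊗ s2 <- R) G (r1 * s1) s2 r2.
Proof.
move=> [G1 G2 G3]; have := qt_comulr HR.
move/(congr1 (fun t => \tsum_(uv ⊗ w <- t) \tsum_(u ⊗ v <- uv) G u v w)).
rwl tsum_flatten; rwl tsum_flatten.
under eq_tsum => r1 r2.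
  rwl tsum_flatten; under eq_tsum => u v do (do 2 rwl tsum_tens).
  over.
move=> ->; apply: eq_tsum => r1 r2; rwl tsum_flatten.
by apply: eq_tsum => u v; do 2 rwl tsum_tens.
Qed.

Lemma R_comm h (G : H -> H -> W) : bil G ->
  \tsum_(r1 ⊗ r2 <- R) \tsum_(h1 ⊗ h2 <- Delta h) G (r1 * h1) (r2 * h2) =
  \tsum_(r1 ⊗ r2 <- R) \tsum_(h1 ⊗ h2 <- Delta h) G (h2 * r1) (h1 * r2).
Proof.
move=> [G1 G2]; have := qt_comm HR h.
move/(congr1 (fun t => \tsum_(u ⊗ v <- t) G u v)).
rwl tsum_flatten; rwl tsum_flatten.
under eq_tsum => r1 r2.
  rwl tsum_flatten; under eq_tsum => u v do rwl tsum_tens.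
  over.
move=> ->; apply: eq_tsum => r1 r2; rwl tsum_flatten.
by apply: eq_tsum => u v; rwl tsum_tens.
Qed.
End Sums.

Lemma R_inv : exists R' : H ⊗ H,
  (forall (W : lmodType k) (G : H -> H -> W), bil G ->
    \tsum_(r1 ⊗ r2 <- R) \tsum_(s1 ⊗ s2 <- R') G (r1 * s1) (r2 * s2) = G 1 1) /\
  (forall (W : lmodType k) (G : H -> H -> W), bil G ->
    \tsum_(s1 ⊗ s2 <- R') \tsum_(r1 ⊗ r2 <- R) G (s1 * r1) (s2 * r2) = G 1 1).
Proof.
have [R' [RR' R'R]] := qt_invertible HR; exists R'.
split=> W G [G1 G2].
  move: RR' => /(congr1 (fun t => \tsum_(u ⊗ v <- t) G u v)).
  rwl tsum_tens; move=> <-; rewrite /tmul; rwl tsum_flatten.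
  apply: eq_tsum => r1 r2; rwl tsum_flatten.
  by apply: eq_tsum => s1 s2; rwl tsum_tens.
move: R'R => /(congr1 (fun t => \tsum_(u ⊗ v <- t) G u v)).
rwl tsum_tens; move=> <-; rewrite /tmul; rwl tsum_flatten.
apply: eq_tsum => r1 r2; rwl tsum_flatten.
by apply: eq_tsum => s1 s2; rwl tsum_tens.
Qed.

(** By the rule for (Delta ⊗ id) R, the invertible element (eps ⊗ id) R is
idempotent. *)
Lemma R_counitl (W : lmodType k) (G : H -> W) : lin G ->
  \tsum_(r1 ⊗ r2 <- R) eps r1 *: G r2 = G 1.
Proof.
move=> lG; have [R' [RR' _]] := R_inv.
transitivity (\tsum_(r1 ⊗ r2 <- R) \tsum_(s1 ⊗ s2 <- R) \tsum_(t1 ⊗ t2 <- R')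
   ((eps r1 * eps (s1 * t1)) *: G (r2 * (s2 * t2)))).
  apply: eq_tsum => r1 r2.
  rewrite (RR' W (fun u v => (eps r1 * eps u) *: G (r2 * v))); last by lin.
  by rewrite (eps1 HH) !mulr1.
transitivity (\tsum_(t1 ⊗ t2 <- R') \tsum_(r1 ⊗ r2 <- R) \tsum_(s1 ⊗ s2 <- R)
   ((eps r1 * eps (s1 * t1)) *: G (r2 * s2 * t2))).
  rewrite [RHS]tsumC; apply: eq_tsum => r1 r2; rewrite tsumC.
  by under eq_tsum => ? ? do under eq_tsum => ? ? do rewrite mulrA.
under eq_tsum => t1 t2.
  rewrite -(R_comull (G := fun r1 s1 z => (eps r1 * eps (s1 * t1)) *: G (z * t2))); last by lin.
  under eq_tsum => r1 r2.
    under eq_tsum => u v do rewrite -scalerA.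
    rwl (Delta_counitl HH r1 (G := fun s1 => eps (s1 * t1) *: G (r2 * t2))).
    over.
  over.
rewrite tsumC (RR' W (fun u v => eps u *: G v)); last by lin.
by rewrite (eps1 HH) scale1r.
Qed.

Lemma R_counitr (W : lmodType k) (G : H -> W) : lin G ->
  \tsum_(r1 ⊗ r2 <- R) eps r2 *: G r1 = G 1.
Proof.
move=> lG; have [R' [RR' _]] := R_inv.
transitivity (\tsum_(r1 ⊗ r2 <- R) \tsum_(s1 ⊗ s2 <- R) \tsum_(t1 ⊗ t2 <- R')
   ((eps r2 * eps (s2 * t2)) *: G (r1 * (s1 * t1)))).
  apply: eq_tsum => r1 r2.
  rewrite (RR' W (fun u v => (eps r2 * eps v) *: G (r1 * u))); last by lin.
  by rewrite (eps1 HH) !mulr1.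
transitivity (\tsum_(t1 ⊗ t2 <- R') \tsum_(r1 ⊗ r2 <- R) \tsum_(s1 ⊗ s2 <- R)
   ((eps r2 * eps (s2 * t2)) *: G (r1 * s1 * t1))).
  rewrite [RHS]tsumC; apply: eq_tsum => r1 r2; rewrite tsumC.
  by under eq_tsum => ? ? do under eq_tsum => ? ? do rewrite mulrA.
under eq_tsum => t1 t2.
  rewrite -(R_comulr (G := fun z s2 r2 => (eps r2 * eps (s2 * t2)) *: G (z * t1))); last by lin.
  under eq_tsum => r1 r2.
    under eq_tsum => u v do rewrite -scalerA.
    rwl (Delta_counitr HH r2 (G := fun s2 => eps (s2 * t2) *: G (r1 * t1))).
    over.
  over.
rewrite tsumC (RR' W (fun u v => eps v *: G u)); last by lin.
by rewrite (eps1 HH) scale1r.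
Qed.

(** Both S ⊗ id and id ⊗ S turn R into its inverse; the second needs the
identities with exchanged factors, hence the involutivity of S. *)
Lemma R_Sl_inv (W : lmodType k) (G : H -> H -> W) : bil G ->
  \tsum_(r1 ⊗ r2 <- R) \tsum_(s1 ⊗ s2 <- R) G (S r1 * s1) (r2 * s2) = G 1 1.
Proof.
move=> [G1 G2].
rewrite -(R_comull (G := fun u v z => G (S u * v) z)); last by lin.
under eq_tsum => r1 r2 do rwl (Delta_Sl HH r1 (G := fun y => G y r2)).
by rwl R_counitl.
Qed.

Lemma R_Sr_inv (W : lmodType k) (G : H -> H -> W) : bil G ->
  \tsum_(r1 ⊗ r2 <- R) \tsum_(s1 ⊗ s2 <- R) G (r1 * s1) (S r2 * s2) = G 1 1.
Proof.
move=> [G1 G2].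
rewrite -(R_comulr (G := fun z v u => G z (S u * v))); last by lin.
under eq_tsum => r1 r2 do rwl (Delta_Sl_flip r2 (G := fun y => G r1 y)).
by rwl R_counitr.
Qed.

Lemma R_S (W : lmodType k) (G : H -> H -> W) : bil G ->
  \tsum_(r1 ⊗ r2 <- R) G (S r1) r2 = \tsum_(r1 ⊗ r2 <- R) G r1 (S r2).
Proof.
move=> [G1 G2]; have [R' [RR' _]] := R_inv.
transitivity (\tsum_(t1 ⊗ t2 <- R') G t1 t2).
  transitivity (\tsum_(r1 ⊗ r2 <- R) \tsum_(s1 ⊗ s2 <- R) \tsum_(t1 ⊗ t2 <- R')
     G (S r1 * (s1 * t1)) (r2 * (s2 * t2))).
    apply: eq_tsum => r1 r2.
    by rewrite (RR' W (fun u v => G (S r1 * u) (r2 * v))) ?mulr1 //; lin.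
  under eq_tsum => r1 r2 do rewrite tsumC.
  rewrite tsumC; apply: eq_tsum => t1 t2.
  under eq_tsum => r1 r2 do under eq_tsum => s1 s2 do rewrite !mulrA.
  by rewrite (R_Sl_inv (G := fun u v => G (u * t1) (v * t2))) ?mul1r //; lin.
symmetry; transitivity (\tsum_(r1 ⊗ r2 <- R) \tsum_(s1 ⊗ s2 <- R) \tsum_(t1 ⊗ t2 <- R')
     G (r1 * (s1 * t1)) (S r2 * (s2 * t2))).
  apply: eq_tsum => r1 r2.
  by rewrite (RR' W (fun u v => G (r1 * u) (S r2 * v))) ?mulr1 //; lin.
under eq_tsum => r1 r2 do rewrite tsumC.
rewrite tsumC; apply: eq_tsum => t1 t2.
under eq_tsum => r1 r2 do under eq_tsum => s1 s2 do rewrite !mulrA.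
by rewrite (R_Sr_inv (G := fun u v => G (u * t1) (v * t2))) ?mul1r //; lin.
Qed.

End RMatrix.

(** * The trace form of a strongly separable algebra *)

Section SeparabilityForm.
Variables (k : fieldType) (A : algType k) (x : A ⊗ A).
Hypothesis HX : is_symmetric_separability_idempotent x.
Local Notation alpha := (sep_form x).

Lemma sep_sym (W : lmodType k) (G : A -> A -> W) : bil G ->
  \tsum_(x1 ⊗ x2 <- x) G x1 x2 = \tsum_(x1 ⊗ x2 <- x) G x2 x1.
Proof.
move=> [G1 G2]; rewrite -{1}(sepidem_sym HX) /tswap; rwl tsum_flatten.
by apply: eq_tsum => u v; rwl tsum_tens.
Qed.

Lemma sep_central (W : lmodType k) a (G : A -> A -> W) : bil G ->
  \tsum_(x1 ⊗ x2 <- x) G (a * x1) x2 = \tsum_(x1 ⊗ x2 <- x) G x1 (x2 * a).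
Proof. by move=> bG; apply: (tsum_central (sepidem_central HX)). Qed.

Lemma sep_mid (W : lmodType k) a (G : A -> A -> W) : bil G ->
  \tsum_(x1 ⊗ x2 <- x) G (x1 * a) x2 = \tsum_(x1 ⊗ x2 <- x) G x1 (a * x2).
Proof.
move=> [G1 G2]; rewrite (sep_sym); last by lin.
rewrite -(sep_central a (G := fun x1 x2 => G x2 x1)); last by lin.
by rewrite (sep_sym) //; lin.
Qed.

Lemma sep_mul (W : lmodType k) (G : A -> W) : lin G ->
  \tsum_(x1 ⊗ x2 <- x) G (x1 * x2) = G 1.
Proof. by move=> lG; rewrite -(sepidem_mul HX) (tsum_push lG). Qed.

(** The trace of left multiplication satisfies the equation that defines
alpha, and as x is central this equation has at most one solution. In this
form alpha is visibly symmetric, and it is also the form in which its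
invariance can be proved. *)
Lemma sep_form_trace : exists n (e : 'I_n -> A) (c : 'I_n -> A -> k^o),
  frame e c /\ forall a, alpha a = ftr e c (fun b => a * b).
Proof.
have [n [e [c [fr _]]]] := separable_frame (sepidem_central HX) (sepidem_mul HX).
exists n, e, c; split=> //.
have lc i : lin (c i) := frame_lin fr i.
have ltr : linear (fun a => ftr e c (fun b => a * b) : k^o).
  move=> a u v; rewrite /ftr scaler_sumr -big_split; apply: eq_bigr => i _ /=.
  by rewrite mulrDl -scalerAl lc.
pose f : {linear A -> k^o} := HB.pack (fun a => ftr e c (fun b => a * b) : k^o)
  (GRing.isLinear.Build _ _ _ _ _ ltr).
have fP : \tsum_(x1 ⊗ x2 <- x) (f x1 : k) *: x2 = 1.
  transitivity (\sum_i (\tsum_(x1 ⊗ x2 <- x) (c i (x1 * e i) : k) *: x2)).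
    by rewrite tsum_bigC; apply: eq_tsum => x1 x2; rewrite -scaler_suml.
  transitivity (\sum_i (\tsum_(x1 ⊗ x2 <- x) (c i x1 : k) *: (e i * x2))).
    by apply: eq_bigr => i _; rwl (sep_mid (e i) (G := fun x1 x2 => (c i x1 : k) *: x2)).
  rewrite tsum_bigC -(sepidem_mul HX); apply: eq_tsum => x1 x2.
  by rewrite {2}(frameE fr x1) mulr_suml; apply: eq_bigr => i _; rewrite scalerAl.
have gP : \tsum_(x1 ⊗ x2 <- x) (alpha x1 : k) *: x2 = 1.
  exact: (@classical_sets.xgetPex _ 0 (fun f : {linear A -> k^o} =>
    \tsum_(x1 ⊗ x2 <- x) (f x1 : k) *: x2 = 1) (ex_intro _ f fP)).
have lf : lin f := lin_linear f.
have lal : lin alpha := lin_linear alpha.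
have fx a : \tsum_(x1 ⊗ x2 <- x) (f (a * x1) : k) *: x2 = a.
  rwl (sep_central a (G := fun x1 x2 => (f x1 : k) *: x2)).
  rewrite -[RHS]mul1r -fP (tsum_push (L := fun z => z * a)); last by lin.
  by apply: eq_tsum => x1 x2; rewrite scalerAl.
move=> a; rewrite -[RHS]/(f a).
rewrite -{1}(fx a) (tsum_push lal).
transitivity (\tsum_(x1 ⊗ x2 <- x) (alpha x1 : k) *: f (a * x2)).
  rewrite (sep_sym); last by lin.
  by apply: eq_tsum => x1 x2; rewrite (linZ lal); exact: mulrC.
rewrite -[a in RHS]mulr1 -gP.
rewrite (tsum_push (L := fun z => f (a * z))); last by lin.
by apply: eq_tsum => x1 x2; rewrite -scalerAr (linZ lf).
Qed.

Lemma alphaC a b : alpha (a * b) = alpha (b * a).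
Proof.
have [n [e [c [fr aE]]]] := sep_form_trace; rewrite !aE.
transitivity (ftr e c (fun y => a * (b * y))).
  by congr ftr; apply/funext => y; rewrite mulrA.
rewrite (@ftr_comp _ _ _ _ _ _ _ _ _ (fun y => b * y) (fun y => a * y) fr fr); [|lin|lin].
by congr ftr; apply/funext => y; rewrite mulrA.
Qed.

Lemma alpha_sep1 : \tsum_(x1 ⊗ x2 <- x) (alpha x1 : k) *: x2 = 1.
Proof.
have [n [e [c [fr aE]]]] := sep_form_trace.
transitivity (\sum_i (\tsum_(x1 ⊗ x2 <- x) (c i (x1 * e i) : k) *: x2)).
  by rewrite tsum_bigC; apply: eq_tsum => x1 x2; rewrite -scaler_suml aE.
have lc i : lin (c i) := frame_lin fr i.
transitivity (\sum_i (\tsum_(x1 ⊗ x2 <- x) (c i x1 : k) *: (e i * x2))).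
  by apply: eq_bigr => i _; rwl (sep_mid (e i) (G := fun x1 x2 => (c i x1 : k) *: x2)).
rewrite tsum_bigC -(sepidem_mul HX); apply: eq_tsum => x1 x2.
by rewrite {2}(frameE fr x1) mulr_suml; apply: eq_bigr => i _; rewrite scalerAl.
Qed.

(** The two legs of x are dual bases for the bilinear form alpha(a b). *)
Lemma alpha_sepl (W : lmodType k) a (G : A -> W) : lin G ->
  \tsum_(x1 ⊗ x2 <- x) (alpha (a * x1) : k) *: G x2 = G a.
Proof.
move=> lG; have lal : lin alpha := lin_linear alpha.
rwl (sep_central a (G := fun x1 x2 => (alpha x1 : k) *: G x2)).
rewrite -[in RHS](mul1r a) -alpha_sep1 (tsum_push (L := fun z => G (z * a))); last by lin.
by apply: eq_tsum => x1 x2; rewrite -scalerAl (linZ lG).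
Qed.

Lemma alpha_sepr (W : lmodType k) a (G : A -> W) : lin G ->
  \tsum_(x1 ⊗ x2 <- x) (alpha (x1 * a) : k) *: G x2 = G a.
Proof.
by move=> lG; under eq_tsum do rewrite alphaC; rwl alpha_sepl.
Qed.

Lemma alpha_sepr2 (W : lmodType k) a (G : A -> W) : lin G ->
  \tsum_(x1 ⊗ x2 <- x) (alpha (x2 * a) : k) *: G x1 = G a.
Proof.
move=> lG; have lal : lin alpha := lin_linear alpha.
by rewrite -(alpha_sepr a lG) sep_sym //; lin.
Qed.

End SeparabilityForm.

(** * The coaction defined by the R-matrix *)

Section Coaction.
Variables (k : fieldType) (H : algType k).
Variables (Delta : H -> H ⊗ H) (eps : H -> k) (S : H -> H) (R : H ⊗ H).
Variables (A : algType k) (act : {bilinear H -> A -> A}) (x : A ⊗ A).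
Hypothesis HH : is_hopf_algebra Delta eps S.
Hypothesis SS : forall h, S (S h) = h.
Hypothesis HA : is_module_algebra Delta eps act.
Hypothesis HX : is_symmetric_separability_idempotent x.

Local Notation alpha := (sep_form x).
Let lD : lin Delta := lin_Delta HH.
Let le : lin (eps : H -> k^o) := lin_eps HH.
Let lS : lin S := lin_S HH.
Let lal : lin alpha := lin_linear alpha.

Lemma act_mulE (W : lmodType k) h a b (G : A -> W) : lin G ->
  G (act h (a * b)) = \tsum_(h1 ⊗ h2 <- Delta h) G (act h1 a * act h2 b).
Proof. by move=> lG; rewrite (act_mul HA) (tsum_push lG). Qed.

Lemma act_mull h a b :
  act h a * b = \tsum_(h1 ⊗ h2 <- Delta h) act h1 (a * act (S h2) b).
Proof.
under eq_tsum => h1 h2 do rewrite (act_mul HA).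
rwl (@Delta_coassoc _ _ _ _ _ HH _ h (fun u v h2 => act u a * act v (act (S h2) b))).
under eq_tsum => h1 z.
  under eq_tsum => u v do rewrite -(actM HA).
  rwl (Delta_Sr HH z (G := fun y => act h1 a * act y b)).
  over.
rwl (Delta_counitr HH h (G := fun h1 => act h1 a * act 1 b)).
by rewrite (act1 HA).
Qed.

(** Inside the trace, (h a) b is h1 (a (S(h2) b)); moving the action of h1
around the trace leaves S(h2) h1, which is eps(h) because S is involutive. *)
Lemma alpha_inv h a : alpha (act h a) = eps h * alpha a.
Proof.
have [n [e [c [fr aE]]]] := sep_form_trace HX; rewrite !aE.
have lc i : lin (c i) := frame_lin fr i.
transitivity (\tsum_(h1 ⊗ h2 <- Delta h)
    (ftr e c (fun b => act h1 (a * act (S h2) b)) : k^o)).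
  transitivity (\sum_i (\tsum_(h1 ⊗ h2 <- Delta h) c i (act h1 (a * act (S h2) (e i))))).
    by apply: eq_bigr => i _; rewrite act_mull (tsum_push (lc i)).
  by rewrite tsum_bigC.
transitivity (\tsum_(h1 ⊗ h2 <- Delta h)
    (ftr e c (fun b => a * act (S h2 * h1) b) : k^o)).
  apply: eq_tsum => h1 h2.
  rewrite (@ftr_comp _ _ _ _ _ _ _ _ _ (fun b => a * act (S h2) b) (fun b => act h1 b) fr fr);
    [|lin|lin].
  by congr ftr; apply/funext => b; rewrite (actM HA).
have lf : lin (fun g => ftr e c (fun b => a * act g b) : k^o).
  move=> z u v; rewrite /ftr scaler_sumr -big_split; apply: eq_bigr => i _ /=.
  by rewrite linearPl mulrDr -scalerAr lc.
rwl (Delta_Sl_flip HH SS h (G := fun g => ftr e c (fun b => a * act g b) : k^o)).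
suff -> : (fun b => a * act 1 b) = (fun b => a * b) by [].
by apply/funext => b; rewrite (act1 HA).
Qed.

Lemma alpha_actl h a b : alpha (act h a * b) = alpha (a * act (S h) b).
Proof.
rewrite act_mull (tsum_push lal).
under eq_tsum => h1 h2 do rewrite alpha_inv.
by apply: (Delta_counitl HH h); lin.
Qed.

(** Dual bases of an invariant form are invariant. *)
Lemma sep_act (W : lmodType k) h (G : A -> A -> W) : bil G ->
  \tsum_(x1 ⊗ x2 <- x) G (act h x1) x2 = \tsum_(x1 ⊗ x2 <- x) G x1 (act (S h) x2).
Proof.
move=> [G1 G2].
transitivity (\tsum_(x1 ⊗ x2 <- x) \tsum_(y1 ⊗ y2 <- x)
   (alpha (x1 * act (S h) y1) : k) *: G y2 x2).
  apply: eq_tsum => x1 x2; under eq_tsum => y1 y2 do rewrite -alpha_actl.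
  by rwl (alpha_sepl HX (act h x1) (G := fun y => G y x2)).
rewrite tsumC; under eq_tsum => y1 y2 do rwl (alpha_sepr HX (act (S h) y1) (G := fun z => G y2 z)).
by rewrite (sep_sym HX) //; lin.
Qed.

(** The coaction q |-> q0 ⊗ q1 = R^2 q ⊗ R^1. Through the axioms of R it makes
A a comodule algebra over H with the opposite product. *)
Definition rsum (W : zmodType) (q : A) (G : A -> H -> W) : W :=
  \tsum_(r1 ⊗ r2 <- R) G (act r2 q) r1.

(** The sum over J1 ⊗ J2 ⊗ J3 = (x1)_0 ⊗ (x1)_1 ⊗ x2, the tensor out of which
the coproduct and the R-matrix of B are built. *)
Definition jsum (W : zmodType) (G : A -> H -> A -> W) : W :=
  \tsum_(x1 ⊗ x2 <- x) rsum x1 (fun a h => G a h x2).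

Lemma eq_rsum (W : zmodType) q (G G' : A -> H -> W) :
  (forall a h, G a h = G' a h) -> rsum q G = rsum q G'.
Proof. by move=> GG; apply: eq_tsum. Qed.

Lemma eq_jsum (W : zmodType) (G G' : A -> H -> A -> W) :
  (forall a h b, G a h b = G' a h b) -> jsum G = jsum G'.
Proof. by move=> GG; apply: eq_tsum => x1 x2; apply: eq_rsum. Qed.

Section Lin.
Variables (W W' : lmodType k).
Lemma lin_rsum_arg (G : A -> H -> W) : bil G -> lin (fun q => rsum q G).
Proof. by move=> [G1 G2]; rewrite /rsum; lin. Qed.
Lemma lin_rsum_body q (F : W' -> A -> H -> W) :
  (forall a h, lin (fun z => F z a h)) -> lin (fun z => rsum q (F z)).
Proof. by move=> lF; rewrite /rsum; apply: lin_tsum_body => u v; apply: lF. Qed.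
Lemma lin_jsum_body (F : W' -> A -> H -> A -> W) :
  (forall a h b, lin (fun z => F z a h b)) -> lin (fun z => jsum (F z)).
Proof.
move=> lF; rewrite /jsum; apply: lin_tsum_body => x1 x2.
by apply: lin_rsum_body => a h; apply: lF.
Qed.
Lemma rsum_push (L : W -> W') q (G : A -> H -> W) : lin L ->
  L (rsum q G) = rsum q (fun a h => L (G a h)).
Proof. by move=> lL; rewrite /rsum (tsum_push lL). Qed.
Lemma jsum_push (L : W -> W') (G : A -> H -> A -> W) : lin L ->
  L (jsum G) = jsum (fun a h b => L (G a h b)).
Proof.
by move=> lL; rewrite /jsum (tsum_push lL); apply: eq_tsum => x1 x2; rewrite rsum_push.
Qed.
Lemma rsumZ (a : k) q (G : A -> H -> W) :
  a *: rsum q G = rsum q (fun b h => a *: G b h).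
Proof. exact: tsumZ. Qed.
Lemma jsumZ (a : k) (G : A -> H -> A -> W) :
  a *: jsum G = jsum (fun b h d => a *: G b h d).
Proof. by rewrite /jsum tsumZ; apply: eq_tsum => x1 x2; rewrite rsumZ. Qed.
End Lin.

Section Exchange.
Variable (W : zmodType).
Lemma rsumC (U V : lmodType k) (t : U ⊗ V) q (F : A -> H -> U -> V -> W) :
  rsum q (fun a h => tlift t (F a h)) = tlift t (fun u v => rsum q (fun a h => F a h u v)).
Proof. exact: tsumC. Qed.
Lemma rsum2C q q' (F : A -> H -> A -> H -> W) :
  rsum q (fun a h => rsum q' (F a h)) = rsum q' (fun a' h' => rsum q (fun a h => F a h a' h')).
Proof. exact: tsumC. Qed.
Lemma jsumC (U V : lmodType k) (t : U ⊗ V) (F : A -> H -> A -> U -> V -> W) :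
  jsum (fun a h b => tlift t (F a h b)) = tlift t (fun u v => jsum (fun a h b => F a h b u v)).
Proof.
rewrite /jsum [RHS]tsumC; apply: eq_tsum => x1 x2; exact: rsumC.
Qed.
Lemma jrsumC q (F : A -> H -> A -> A -> H -> W) :
  jsum (fun a h b => rsum q (F a h b)) = rsum q (fun a' h' => jsum (fun a h b => F a h b a' h')).
Proof.
transitivity (\tsum_(x1 ⊗ x2 <- x)
    rsum q (fun a' h' => rsum x1 (fun a h => F a h x2 a' h'))).
  by apply: eq_tsum => x1 x2; exact: rsum2C.
symmetry.
exact: (rsumC x q (fun a' h' x1 x2 => rsum x1 (fun a h => F a h x2 a' h'))).
Qed.
End Exchange.

Lemma jsum2C (W : zmodType) (F : A -> H -> A -> A -> H -> A -> W) :
  jsum (fun a h b => jsum (F a h b)) =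
  jsum (fun a' h' b' => jsum (fun a h b => F a h b a' h' b')).
Proof.
transitivity (\tsum_(x1 ⊗ x2 <- x)
    jsum (fun a h b => rsum x1 (fun a' h' => F a h b a' h' x2))).
  exact: (jsumC x (fun a h b x1 x2 => rsum x1 (fun a' h' => F a h b a' h' x2))).
by apply: eq_tsum => x1 x2; exact: jrsumC.
Qed.
End Coaction.

Ltac lin_ext ::=
  match goal with
  | |- lin (fun z => jsum ?R ?act ?x (@?F z)) => apply lin_jsum_body
  | |- @lin ?k ?U ?W (fun z => rsum ?R ?act (@?q z) (@?F z)) =>
      first [ is_const q; apply lin_rsum_body
            | lazymatch F with (fun _ => ?F0) =>
                apply (@lin_comp k U _ W (fun y => rsum R act y F0) q);
                [apply lin_rsum_arg; lin | ] end ]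
  end.

(** * Reordering iterated sums *)

(** Strips the outermost sum from both sides of an equation. *)
Ltac under1 :=
  lazymatch goal with
  | |- jsum _ _ _ _ = _ => apply: eq_jsum; intros ? ? ?
  | |- rsum _ _ _ _ = _ => apply: eq_rsum; intros ? ?
  | |- tlift _ _ = _ => apply: eq_tsum; intros ? ?
  end; cbv beta.

Ltac swp1 :=
  cbv beta;
  lazymatch goal with
  | |- jsum _ _ _ (fun _ _ _ => jsum _ _ _ _) = _ =>
      refine (eq_trans (jsum2C _ _ _ (fun _ _ _ => _)) _)
  | |- jsum _ _ _ (fun _ _ _ => rsum _ _ _ _) = _ =>
      refine (eq_trans (jrsumC _ _ _ _ (fun _ _ _ => _)) _)
  | |- jsum _ _ _ (fun _ _ _ => tlift _ _) = _ =>
      refine (eq_trans (jsumC _ _ _ _ (fun _ _ _ => _)) _)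
  | |- rsum _ _ _ (fun _ _ => jsum _ _ _ _) = _ =>
      refine (eq_trans (esym (jrsumC _ _ _ _ (fun _ _ _ => _))) _)
  | |- rsum _ _ _ (fun _ _ => rsum _ _ _ _) = _ =>
      refine (eq_trans (rsum2C _ _ _ _ (fun _ _ => _)) _)
  | |- rsum _ _ _ (fun _ _ => tlift _ _) = _ =>
      refine (eq_trans (rsumC _ _ _ _ (fun _ _ => _)) _)
  | |- tlift _ (fun _ _ => jsum _ _ _ _) = _ =>
      refine (eq_trans (esym (jsumC _ _ _ _ (fun _ _ _ => _))) _)
  | |- tlift _ (fun _ _ => rsum _ _ _ _) = _ =>
      refine (eq_trans (esym (rsumC _ _ _ _ (fun _ _ => _))) _)
  | |- tlift _ (fun _ _ => tlift _ _) = _ =>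
      refine (eq_trans (tsumC _ _ (fun _ _ => _)) _)
  end; cbv beta.

(** [swp n] exchanges the sums at depths n and n + 1 of the left-hand side,
and [float i j] moves the sum at depth i out to depth j, depth 0 being the
outermost. *)
Ltac swp n :=
  lazymatch n with
  | O => swp1
  | S ?m => etransitivity;
      [ under1; swp m; reflexivity | ]
  end; cbv beta.

Ltac float i j :=
  tryif unify i j then idtac
  else lazymatch i with S ?m => swp m; float m j end.

Section Tmul.
Variables (k : fieldType) (U V : lmodType k) (mU : U -> U -> U) (mV : V -> V -> V).
Hypotheses (bU : bil mU) (bV : bil mV).

Let lU1 := bU.1. Let lU2 := bU.2. Let lV1 := bV.1. Let lV2 := bV.2.

Lemma tmul_tsum (W : lmodType k) s t (G : U -> V -> W) : bil G ->
  \tsum_(u ⊗ v <- tmul mU mV s t) G u v =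
  \tsum_(u ⊗ v <- s) \tsum_(u' ⊗ v' <- t) G (mU u u') (mV v v').
Proof.
move=> [G1 G2]; rewrite /tmul; rwl tsum_flatten.
apply: eq_tsum => u v; rwl tsum_flatten.
by apply: eq_tsum => u' v'; rwl tsum_tens.
Qed.

Lemma bil_tmul : bil (tmul mU mV).
Proof. by split=> [t|s]; rewrite /tmul; lin. Qed.

Lemma tmul_tens u v u' v' : tmul mU mV (u ⊗ v) (u' ⊗ v') = mU u u' ⊗ mV v v'.
Proof. by rewrite /tmul; rwl tsum_tens; rwl tsum_tens. Qed.
End Tmul.

Lemma tensor_ext (k : fieldType) (U V : lmodType k) (s t : U ⊗ V) :
  (forall (W : lmodType k) (G : U -> V -> W), bil G ->
     \tsum_(u ⊗ v <- s) G u v = \tsum_(u ⊗ v <- t) G u v) -> s = t.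
Proof. by move=> E; rewrite -(tsum_id s) -(tsum_id t); apply: E; lin. Qed.

Section WeakHopfB.
Variables (k : fieldType) (H : algType k).
Variables (Delta : H -> H ⊗ H) (eps : H -> k) (S : H -> H) (R : H ⊗ H).
Variables (A : algType k) (act : {bilinear H -> A -> A}) (x : A ⊗ A).
Hypothesis HH : is_hopf_algebra Delta eps S.
Hypothesis SS : forall h, S (S h) = h.
Hypothesis HR : is_quasitriangular Delta R.
Hypothesis HA : is_module_algebra Delta eps act.
Hypothesis HX : is_symmetric_separability_idempotent x.

Local Notation alpha := (sep_form x).
Local Notation rsum := (rsum R act).
Local Notation jsum := (jsum R act x).
Local Notation dual := {linear A -> k^o}.
Local Notation B := (A ⊗ H ⊗ dual)%type.
Local Notation D := (DeltaB Delta R act x).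
Local Notation epsB := (epsB eps x).
Local Notation SB := (SB S R act x).
Local Notation oneB := (oneB H x).
Local Notation RB := (RB R act x).
Let lD : lin Delta := lin_Delta HH.
Let le : lin (eps : H -> k^o) := lin_eps HH.
Let lS : lin S := lin_S HH.
Let lal : lin alpha := lin_linear alpha.

(** * The calculus of the coaction tensor *)

Section RSum.
Variable W : lmodType k.

Lemma rsum_counit q (G : A -> W) : lin G -> rsum q (fun a h => eps h *: G a) = G q.
Proof.
by move=> lG; rewrite /rsum (R_counitl HH HR) ?(act1 HA) //; lin.
Qed.

Lemma rsum_coassoc q (G : A -> H -> H -> W) : tril G ->
  rsum q (fun a h => \tsum_(u ⊗ v <- Delta h) G a u v) =
  rsum q (fun a h => rsum a (fun a' h' => G a' h' h)).
Proof.
move=> [G1 G2 G3]; rewrite /rsum.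
rewrite (R_comull HR); last by lin.
rewrite [RHS]tsumC; apply: eq_tsum => r1 r2; apply: eq_tsum => s1 s2.
by rewrite (actM HA).
Qed.

Lemma rsum_mul p q (G : A -> H -> W) : bil G ->
  rsum (p * q) G = rsum p (fun p0 p1 => rsum q (fun q0 q1 => G (p0 * q0) (q1 * p1))).
Proof.
move=> [G1 G2]; rewrite /rsum.
transitivity (\tsum_(r1 ⊗ r2 <- R) \tsum_(u ⊗ v <- Delta r2) G (act u p * act v q) r1).
  by apply: eq_tsum => r1 r2; rewrite (act_mulE HA r2 p q (G := fun z => G z r1)) //; lin.
rewrite (R_comulr HR); last by lin.
by rewrite tsumC.
Qed.

Lemma rsum_one (G : A -> H -> W) : bil G -> rsum 1 G = G 1 1.
Proof.
move=> [G1 G2]; rewrite /rsum.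
under eq_tsum => r1 r2 do rewrite (act_unit HA) (linZ (G1 _)).
by rwl (R_counitr HH HR).
Qed.

Lemma rsum_alpha q (G : H -> W) : lin G ->
  rsum q (fun a h => (alpha a : k) *: G h) = (alpha q : k) *: G 1.
Proof.
move=> lG; rewrite /rsum.
under eq_tsum => r1 r2 do rewrite (alpha_inv HH SS HA HX) -scalerA.
by rwl (R_counitr HH HR).
Qed.

(** The idempotent x is coinvariant: its invariance brings the two actions
together on one leg, where they cancel by the antipode identity. *)
Lemma rsum_sep (G : A -> A -> H -> W) : tril G ->
  \tsum_(x1 ⊗ x2 <- x) rsum x1 (fun a u => rsum x2 (fun b v => G a b (v * u))) =
  \tsum_(x1 ⊗ x2 <- x) G x1 x2 1.
Proof.
move=> [G1 G2 G3].
transitivity (\tsum_(r1 ⊗ r2 <- R) \tsum_(u ⊗ v <- Delta r2)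
   \tsum_(x1 ⊗ x2 <- x) G (act u x1) (act v x2) r1).
  rewrite (R_comulr HR); last by lin.
  rewrite /rsum tsumC; under eq_tsum => r1 r2 do rewrite tsumC.
  by rewrite tsumC.
under eq_tsum => r1 r2.
  under eq_tsum => u v.
    rwl (sep_act HH SS HA HX u (G := fun a b => G a (act v b) r1)).
    under eq_tsum => x1 x2 do rewrite -(actM HA).
    over.
  rewrite tsumC.
  under eq_tsum => x1 x2 do
    rwl (Delta_Sr_flip HH SS r2 (G := fun y => G x1 (act y x2) r1)).
  rewrite -tsumZ.
  over.
rwl (R_counitr HH HR).
by under eq_tsum => x1 x2 do rewrite (act1 HA).
Qed.
End RSum.

Section JSum.
Variable W : lmodType k.

Lemma jsum_alphar q (G : A -> H -> W) : bil G ->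
  jsum (fun a h b => (alpha (q * b) : k) *: G a h) = rsum q G.
Proof.
move=> [G1 G2]; rewrite /jsum.
rewrite (sep_sym HX); last by lin.
rewrite -(alpha_sepl HX q (G := fun x2 => rsum x2 G)); last by lin.
apply: eq_tsum => x1 x2.
by rewrite rsumZ.
Qed.

Lemma jsum_alphal q (G : A -> H -> W) : bil G ->
  jsum (fun a h b => (alpha (b * q) : k) *: G a h) = rsum q G.
Proof.
by move=> bG; rewrite -jsum_alphar //; apply: eq_jsum => a h b; rewrite (alphaC HX).
Qed.

Lemma jsum_alpha1 (G : A -> H -> W) : bil G ->
  jsum (fun a h b => (alpha b : k) *: G a h) = G 1 1.
Proof.
move=> bG; rewrite -(rsum_one bG) -jsum_alphar //.
by apply: eq_jsum => a h b; rewrite mul1r.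
Qed.

Lemma jsum_counit (G : A -> A -> W) : bil G ->
  jsum (fun a h b => eps h *: G a b) = \tsum_(x1 ⊗ x2 <- x) G x1 x2.
Proof.
by move=> [G1 G2]; apply: eq_tsum => x1 x2; rwl (rsum_counit x1 (G := fun a => G a x2)).
Qed.

(** x is central and the coaction is multiplicative, so p may be inserted in
the first leg of x before the coaction, or in the second leg. *)
Lemma jsum_left p (G : A -> H -> A -> W) : tril G ->
  rsum p (fun p0 p1 => jsum (fun a h b => G (p0 * a) (h * p1) b)) =
  jsum (fun a h b => G a h (b * p)).
Proof.
move=> [G1 G2 G3]; rewrite -jrsumC /jsum.
rewrite -(sep_central HX p (G := fun x1 x2 => rsum x1 (fun a h => G a h x2))); last by lin.
by apply: eq_tsum => x1 x2; rwl rsum_mul; rewrite rsum2C.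
Qed.

Lemma jsum_right p (G : A -> H -> A -> W) : tril G ->
  rsum p (fun p0 p1 => jsum (fun a h b => G (a * p0) (p1 * h) b)) =
  jsum (fun a h b => G a h (p * b)).
Proof.
move=> [G1 G2 G3]; rewrite -jrsumC /jsum.
rewrite -(sep_mid HX p (G := fun x1 x2 => rsum x1 (fun a h => G a h x2))); last by lin.
by apply: eq_tsum => x1 x2; rwl rsum_mul.
Qed.

Lemma jsum_coassoc (G : A -> H -> H -> A -> W) :
  (forall b, tril (fun a u v => G a u v b)) ->
  jsum (fun a h b => \tsum_(u ⊗ v <- Delta h) G a u v b) =
  jsum (fun a h b => rsum a (fun a' h' => G a' h' h b)).
Proof.
move=> tG; apply: eq_tsum => x1 x2.
by rewrite (rsum_coassoc x1).
Qed.

(** The scalar alpha(b' b) joins the two copies of x by the dual basis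
property. What remains is the coaction on x1 x2 = 1. *)
Lemma jsum_contract (G : A -> H -> W) : bil G ->
  jsum (fun a' h' b' => jsum (fun a h b => (alpha (b' * b) : k) *: G (a' * a) (h * h'))) =
  G 1 1.
Proof.
move=> [G1 G2].
transitivity (jsum (fun a' h' b' => rsum b' (fun a h => G (a' * a) (h * h')))).
  by apply: eq_jsum => a' h' b'; rwl (jsum_alphar b').
rewrite /jsum.
transitivity (\tsum_(x1 ⊗ x2 <- x) rsum (x1 * x2) G).
  by apply: eq_tsum => x1 x2; rwl rsum_mul.
rwl (sep_mul HX (G := fun z => rsum z G)).
by rwl rsum_one.
Qed.
End JSum.

(** * The algebra B in coordinates *)

Lemma lin_harpoonl : lin (fun c => dual_harpoonl alpha c).
Proof.
move=> a u v; apply: linear_ext => b; rewrite dual_harpoonlE /=.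
by rewrite mulrDl -scalerAl lal.
Qed.
Let lh := lin_harpoonl.

(** The inverse of c |-> alpha ↼ c. *)
Definition frob (f : {linear A -> k^o}) : A := \tsum_(x1 ⊗ x2 <- x) (f x1 : k) *: x2.

Lemma frobK (f : dual) : dual_harpoonl alpha (frob f) = f.
Proof.
have lf : lin f := lin_linear f.
apply: linear_ext => a; rewrite dual_harpoonlE /frob.
rewrite (tsum_push (L := fun z => alpha (z * a))); last by lin.
rewrite (sep_sym HX); last by lin.
rewrite -(alpha_sepr HX a lf); apply: eq_tsum => x1 x2.
by rewrite -scalerAl (linZ lal); exact: mulrC.
Qed.

Lemma dual_expand (f : dual) : f = \tsum_(x1 ⊗ x2 <- x) (f x1 : k) *: dual_harpoonl alpha x2.
Proof.
rewrite -{1}(frobK f) /frob (tsum_push lh); apply: eq_tsum => x1 x2.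
by rewrite (linZ lh).
Qed.

(** Elements of A^* ⊗ A^* are determined by their values because every
functional is a combination of the finitely many alpha ↼ x2. *)
Lemma dual_tensor_ext (s t : dual ⊗ dual) :
  (forall a b, \tsum_(f ⊗ g <- s) f a * g b = \tsum_(f ⊗ g <- t) f a * g b) -> s = t.
Proof.
have E (r : dual ⊗ dual) : r = \tsum_(x1 ⊗ x2 <- x) \tsum_(y1 ⊗ y2 <- x)
   (((\tsum_(f ⊗ g <- r) f x1 * g y1) : k) *: (dual_harpoonl alpha x2 ⊗ dual_harpoonl alpha y2)).
  rewrite -{1}(tsum_id r).
  transitivity (\tsum_(f ⊗ g <- r) \tsum_(x1 ⊗ x2 <- x) \tsum_(y1 ⊗ y2 <- x)
    (f x1 * g y1 : k) *: (dual_harpoonl alpha x2 ⊗ dual_harpoonl alpha y2)).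
    apply: eq_tsum => f g; rewrite {1}(dual_expand f) (tsum_push (L := fun z => z ⊗ g)); last by lin.
    apply: eq_tsum => x1 x2; rewrite {1}(dual_expand g).
    rewrite (tsum_push (L := fun z => _ ⊗ z)); last by lin.
    by apply: eq_tsum => y1 y2; rewrite linearZl_LR linearZr_LR /= scalerA.
  rewrite tsumC; apply: eq_tsum => x1 x2; rewrite tsumC; apply: eq_tsum => y1 y2.
  by rewrite /tlift /tens_eval -scaler_suml.
move=> st; rewrite (E s) (E t); apply: eq_tsum => x1 x2; apply: eq_tsum => y1 y2.
by rewrite st.
Qed.

(** The right-hand side has the property that defines the coproduct of alpha ↼
c, and only one tensor has it. *)
Lemma dual_comul_harpoon c :
  dual_comul (dual_harpoonl alpha c) =
  \tsum_(x1 ⊗ x2 <- x) dual_harpoonl alpha (x1 * c) ⊗ dual_harpoonl alpha x2.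
Proof.
set t := RHS.
have lev a : lin (fun f : dual => f a) by move=> b f g.
have tP a b : \tsum_(f1 ⊗ f2 <- t) (f1 a * f2 b : k^o) = dual_harpoonl alpha c (a * b).
  rewrite /t; rwl tsum_flatten.
  under eq_tsum => x1 x2 do rwl tsum_tens.
  rewrite dual_harpoonlE mulrA -(alpha_sepr HX (c * a) (G := fun z => alpha (z * b))); last by lin.
  by apply: eq_tsum => x1 x2; rewrite !dual_harpoonlE mulrA.
apply: dual_tensor_ext => a b; rewrite [RHS]tP.
exact: (@classical_sets.xgetPex _ 0 (fun t : dual ⊗ dual =>
  forall a b, \tsum_(f1 ⊗ f2 <- t) f1 a * f2 b = dual_harpoonl alpha c (a * b)) (ex_intro _ t tP)).
Qed.

Lemma lin_dual_comul : lin (fun f : dual => dual_comul f).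
Proof.
have lev a : lin (fun f : dual => f a) by move=> b f g.
have E f : dual_comul f = \tsum_(x1 ⊗ x2 <- x) dual_harpoonl alpha (x1 * frob f) ⊗ dual_harpoonl alpha x2.
  by rewrite -dual_comul_harpoon frobK.
have lfr : lin frob by rewrite /frob; lin.
by move=> a f g; rewrite !E; apply: (_ : lin (fun f => \tsum_(x1 ⊗ x2 <- x)
  dual_harpoonl alpha (x1 * frob f) ⊗ dual_harpoonl alpha x2)); lin.
Qed.

Lemma dual_comul_tsum (W : lmodType k) c (G : dual -> dual -> W) : bil G ->
  \tsum_(f1 ⊗ f2 <- dual_comul (dual_harpoonl alpha c)) G f1 f2 =
  \tsum_(x1 ⊗ x2 <- x) G (dual_harpoonl alpha (x1 * c)) (dual_harpoonl alpha x2).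
Proof.
move=> [G1 G2]; rewrite dual_comul_harpoon; rwl tsum_flatten.
by apply: eq_tsum => x1 x2; rwl tsum_tens.
Qed.

Lemma dual_act_harpoon c h :
  dual_act act (dual_harpoonl alpha c) h = dual_harpoonl alpha (act (S h) c).
Proof.
apply: linear_ext => a; rewrite dual_actE !dual_harpoonlE.
by rewrite [RHS](alpha_actl HH SS HA HX) SS.
Qed.

Lemma harpoonr_harpoon c a :
  dual_harpoonr a (dual_harpoonl alpha c) = dual_harpoonl alpha (a * c).
Proof.
by apply: linear_ext => b; rewrite dual_harpoonrE !dual_harpoonlE mulrA (alphaC HX) mulrA.
Qed.

Lemma harpoonl1 : dual_harpoonl alpha 1 = alpha.
Proof. by apply: linear_ext => b; rewrite dual_harpoonlE mul1r. Qed.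

(** Coordinates of B as A ⊗ H ⊗ A; by [frobK] these elements span B, and
[beta_ext] reduces linear identities to them. *)
Definition beta a h c : B := a ⊗ h ⊗ dual_harpoonl alpha c.

Lemma lin_beta1 h c : lin (fun a => beta a h c). Proof. by rewrite /beta; lin. Qed.
Lemma lin_beta2 a c : lin (fun h => beta a h c). Proof. by rewrite /beta; lin. Qed.
Lemma lin_beta3 a h : lin (fun c => beta a h c). Proof. by rewrite /beta; lin. Qed.

Lemma beta_ext (W : lmodType k) (L L' : B -> W) : lin L -> lin L' ->
  (forall a h c, L (beta a h c) = L' (beta a h c)) -> forall b, L b = L' b.
Proof.
move=> lL lL' E b; rewrite -(tsum_id b) (tsum_push lL) (tsum_push lL').
apply: eq_tsum => t f; rewrite -(tsum_id t) -(frobK f).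
rewrite (tsum_push (L := fun z => L (z ⊗ _))); last by lin.
rewrite (tsum_push (L := fun z => L' (z ⊗ _))); last by lin.
by apply: eq_tsum => a h; exact: E.
Qed.

Lemma beta_tsum (W : lmodType k) a h c (G : A -> H -> dual -> W) : tril G ->
  \tsum_(a' ⊗ h' ⊗ f <- beta a h c) G a' h' f = G a h (dual_harpoonl alpha c).
Proof. by move=> [G1 G2 G3]; rewrite /beta; rwl tsum_tens; rwl tsum_tens. Qed.

Lemma lin_dual_eval a : lin (fun f : dual => f a). Proof. by move=> b f g. Qed.
Let lev := lin_dual_eval.

Lemma lin_dual_act1 (h : H) : lin (fun f : dual => dual_act act f h : dual).
Proof. by move=> a f g; apply: linear_ext => b. Qed.
Lemma lin_dual_act2 (f : dual) : lin (fun h : H => dual_act act f h : dual).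
Proof. by move=> a g h; apply: linear_ext => b; rewrite /dual_act /= linearPl linearP. Qed.
Lemma lin_dual_harpoonr1 a : lin (fun f : dual => dual_harpoonr a f).
Proof. by move=> b f g; apply: linear_ext. Qed.
Lemma lin_dual_harpoonr2 (f : dual) : lin (fun a => dual_harpoonr a f).
Proof.
by move=> b a a'; apply: linear_ext => y; rewrite dual_harpoonrE /= mulrDr -scalerAr linearP.
Qed.
Lemma lin_dual_harpoonl1 a : lin (fun f : dual => dual_harpoonl f a).
Proof. by move=> b f g; apply: linear_ext. Qed.
Let ld1 := lin_dual_act1. Let ld2 := lin_dual_act2.
Let lr1 := lin_dual_harpoonr1. Let lr2 := lin_dual_harpoonr2.
Let ll1 := lin_dual_harpoonl1.
Let lb1 := lin_beta1. Let lb2 := lin_beta2. Let lb3 := lin_beta3.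
Let ldc := lin_dual_comul.

Lemma lin_mulBl t : lin (fun s : B => mulB s t).
Proof. by rewrite /mulB; lin. Qed.
Lemma lin_mulBr s : lin (fun t : B => mulB s t).
Proof. by rewrite /mulB; lin. Qed.

Lemma mulB_beta a h c b g d :
  mulB (beta a h c) (beta b g d) = (alpha (d * a) : k) *: beta b (h * g) c.
Proof.
rewrite /mulB; rwl beta_tsum; rwl beta_tsum.
by [].
Qed.

Lemma oneB_beta : oneB = \tsum_(x1 ⊗ x2 <- x) beta x1 1 x2.
Proof.
rewrite /Defs.oneB; apply: eq_tsum => x1 x2.
by rewrite -harpoonl1 harpoonr_harpoon mulr1.
Qed.

Lemma lin_epsB : lin (epsB : B -> k^o).
Proof. by rewrite /Defs.epsB; lin. Qed.

Lemma epsB_beta a h c : epsB (beta a h c) = alpha a * eps h * alpha c.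
Proof. by rewrite /Defs.epsB; rwl beta_tsum; rewrite dual_harpoonlE mulr1. Qed.

Lemma lin_SB : lin SB.
Proof. by rewrite /Defs.SB; lin. Qed.

Lemma SB_beta a h c :
  SB (beta a h c) =
  rsum a (fun a0 a1 => rsum c (fun c0 c1 => beta c0 (a1 * S h * c1) a0)).
Proof.
rewrite /Defs.SB; rwl beta_tsum; apply: eq_tsum => r1 r2.
under eq_tsum => s1 s2.
  under eq_tsum => x1 x2 do rewrite dual_act_harpoon dual_harpoonlE.
  rwl (alpha_sepl HX (act (S s2) c) (G := fun x2 => x2 ⊗ r1 * S (s1 * h) ⊗ dual_harpoonl alpha (act r2 a))).
  over.
rewrite -(R_S HH SS HR (G := fun s1 s2 => act s2 c ⊗ r1 * S (s1 * h) ⊗ dual_harpoonl alpha (act r2 a))); last by lin.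
by apply: eq_tsum => s1 s2; rewrite (SM HH) SS mulrA.
Qed.

Lemma lin_DeltaB : lin D.
Proof. by rewrite /DeltaB; lin. Qed.

(** By invariance of x, the action on one factor of the coproduct of alpha ↼ c
becomes the coaction on the other leg of x. *)
Lemma dual_comul_coaction (W : lmodType k) c (G : H -> dual -> dual -> W) : tril G ->
  \tsum_(r1 ⊗ r2 <- R) \tsum_(f1 ⊗ f2 <- dual_comul (dual_harpoonl alpha c)) G r1 (dual_act act f1 r2) f2 =
  jsum (fun J1 J2 J3 => G J2 (dual_harpoonl alpha J3) (dual_harpoonl alpha (c * J1))).
Proof.
move=> [G1 G2 G3].
transitivity (\tsum_(r1 ⊗ r2 <- R) \tsum_(x1 ⊗ x2 <- x)
   G r1 (dual_harpoonl alpha x2) (dual_harpoonl alpha (c * act r2 x1))).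
  apply: eq_tsum => r1 r2.
  rwl (dual_comul_tsum c (G := fun f1 f2 => G r1 (dual_act act f1 r2) f2)).
  under eq_tsum => x1 x2 do rewrite dual_act_harpoon.
  rewrite (sep_mid HX c (G := fun x1 x2 => G r1 (dual_harpoonl alpha (act (S r2) x1)) (dual_harpoonl alpha x2))); last by lin.
  rewrite (sep_act HH SS HA HX (S r2) (G := fun x1 x2 => G r1 (dual_harpoonl alpha x1) (dual_harpoonl alpha (c * x2)))); last by lin.
  rewrite SS.
  by rewrite (sep_sym HX) //; lin.
by rewrite tsumC.
Qed.

Lemma DeltaB_beta (W : lmodType k) a h c (G : B -> B -> W) : bil G ->
  \tsum_(u ⊗ v <- D (beta a h c)) G u v =
  jsum (fun J1 J2 J3 => jsum (fun K1 K2 K3 => \tsum_(h1 ⊗ h2 <- Delta h)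
    G (beta (J1 * a) (K2 * h1 * J2) (c * K1)) (beta J3 h2 K3))).
Proof.
move=> [G1 G2]; rewrite /DeltaB; rwl beta_tsum.
rwl tsum_flatten; under eq_tsum => r1 r2.
  rwl tsum_flatten; under eq_tsum => s1 s2.
    rwl tsum_flatten; under eq_tsum => x1 x2.
      rwl tsum_flatten; under eq_tsum => h1 h2.
        rwl tsum_flatten; under eq_tsum => f1 f2 do rwl tsum_tens.
        over.
      over.
    over.
  over.
rewrite /=.
transitivity (\tsum_(x1 ⊗ x2 <- x) \tsum_(r1 ⊗ r2 <- R) \tsum_(h1 ⊗ h2 <- Delta h)
  \tsum_(s1 ⊗ s2 <- R) \tsum_(f1 ⊗ f2 <- dual_comul (dual_harpoonl alpha c))
    G (act r2 x1 * a ⊗ s1 * h1 * r1 ⊗ f2) (x2 ⊗ h2 ⊗ dual_act act f1 s2)).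
  swp 1%N; swp 0%N; apply: eq_tsum => x1 x2; apply: eq_tsum => r1 r2; exact: tsumC.
apply: eq_tsum => x1 x2; apply: eq_tsum => r1 r2.
symmetry; swp 0%N; symmetry; apply: eq_tsum => h1 h2.
by rwl (dual_comul_coaction c (G := fun s1 f1 f2 =>
  G (act r2 x1 * a ⊗ s1 * h1 * r1 ⊗ f2) (x2 ⊗ h2 ⊗ f1))).
Qed.

Lemma RB_beta (W : lmodType k) (G : B -> B -> W) : bil G ->
  \tsum_(u ⊗ v <- RB) G u v =
  \tsum_(y1 ⊗ y2 <- x) \tsum_(r1 ⊗ r2 <- R)
  jsum (fun J1 J2 J3 => jsum (fun K1 K2 K3 =>
    G (beta (J1 * y1) (r1 * J2) K3) (beta J3 (K2 * r2) (y2 * K1)))).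
Proof.
move=> [G1 G2]; rewrite /Defs.RB.
rwl tsum_flatten; under eq_tsum => r1 r2.
  rwl tsum_flatten; under eq_tsum => s1 s2.
    rwl tsum_flatten; under eq_tsum => t1 t2.
      rwl tsum_flatten; under eq_tsum => y1 y2.
        rwl tsum_flatten; under eq_tsum => z1 z2.
          rwl tsum_flatten; under eq_tsum => f1 f2 do rwl tsum_tens.
          over.
        over.
      over.
    over.
  over.
rewrite /=.
swp 2%N; swp 1%N; swp 0%N; apply: eq_tsum => y1 y2.
swp 0%N; apply: eq_tsum => s1 s2.
swp 1%N; swp 0%N; swp 1%N.
symmetry; apply: eq_tsum => z1 z2; apply: eq_tsum => t1 t2; symmetry.
rewrite -harpoonl1.
rewrite (dual_comul_coaction 1 (G := fun r1 f1 f2 =>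
  G (act t2 z1 * y1 ⊗ s1 * t1 ⊗ f1) (z2 ⊗ r1 * s2 ⊗ dual_harpoonr y2 f2))); last by lin.
by apply: eq_jsum => K1 K2 K3; rewrite harpoonr_harpoon mul1r.
Qed.

(** * Sliding and merging two copies of the coaction tensor *)

Section JJ.
Variable W : lmodType k.

(** The coproduct of J2 is a second coaction on J1 by [jsum_coassoc], and
[jsum_right] lets the copy K absorb it: nested copies become chained. *)
Lemma jsum_in (G : A -> H -> A -> H -> A -> W) :
  quinl G ->
  jsum (fun J1 J2 J3 => jsum (fun K1 K2 K3 => \tsum_(u ⊗ v <- Delta J2)
    G (K1 * J1) (u * K2) K3 v J3)) =
  jsum (fun J1 J2 J3 => jsum (fun K1 K2 K3 => G J1 J2 (K1 * J3) K2 K3)).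
Proof.
move=> [G1 G2 G3 G4 G5].
swp 1%N; rwl jsum_coassoc.
symmetry; swp 0%N; symmetry; apply: eq_jsum => J1 J2 J3.
by rwl (jsum_right J1 (G := fun K1 K2 K3 => G K1 K2 K3 J2 J3)).
Qed.

(** The same as [jsum_in] for the other order of factors, with [jsum_left]. *)
Lemma jsum_out (G : A -> H -> A -> H -> A -> W) :
  quinl G ->
  jsum (fun J1 J2 J3 => jsum (fun K1 K2 K3 => \tsum_(u ⊗ v <- Delta J2)
    G (J1 * K1) (K2 * u) K3 v J3)) =
  jsum (fun J1 J2 J3 => jsum (fun K1 K2 K3 => G J1 J2 (J3 * K1) K2 K3)).
Proof.
move=> [G1 G2 G3 G4 G5].
swp 1%N; rwl jsum_coassoc.
symmetry; swp 0%N; symmetry; apply: eq_jsum => J1 J2 J3.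
by rwl (jsum_left J1 (G := fun K1 K2 K3 => G K1 K2 K3 J2 J3)).
Qed.

(** In the coproduct of 1, a factor p travels from the leg of J to the leg of
K: [jsum_right] replaces it by its coaction, centrality of the idempotent y
carries it across, and [jsum_left] absorbs it. *)
Lemma unit_slide p (G : A -> H -> A -> A -> A -> W) :
  quinl G ->
  \tsum_(y1 ⊗ y2 <- x) jsum (fun J1 J2 J3 => jsum (fun K1 K2 K3 =>
    G (J1 * y1) (K2 * J2) (y2 * K1) (p * J3) K3)) =
  \tsum_(y1 ⊗ y2 <- x) jsum (fun J1 J2 J3 => jsum (fun K1 K2 K3 =>
    G (J1 * y1) (K2 * J2) (y2 * K1) J3 (K3 * p))).
Proof.
move=> [G1 G2 G3 G4 G5].
transitivity (rsum p (fun p0 p1 => jsum (fun J1 J2 J3 => jsum (fun K1 K2 K3 =>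
  \tsum_(y1 ⊗ y2 <- x) G (J1 * p0 * y1) (K2 * (p1 * J2)) (y2 * K1) J3 K3)))).
  symmetry; swp 2%N; swp 1%N; swp 0%N; apply: eq_tsum => y1 y2.
  by rwl (jsum_right p (G := fun J1 J2 J3 => jsum (fun K1 K2 K3 =>
     G (J1 * y1) (K2 * J2) (y2 * K1) J3 K3))).
transitivity (rsum p (fun p0 p1 => jsum (fun J1 J2 J3 => jsum (fun K1 K2 K3 =>
  \tsum_(y1 ⊗ y2 <- x) G (J1 * y1) (K2 * p1 * J2) (y2 * (p0 * K1)) J3 K3)))).
  apply: eq_rsum => p0 p1; apply: eq_jsum => J1 J2 J3; apply: eq_jsum => K1 K2 K3.
  under eq_tsum => y1 y2 do rewrite -mulrA.
  rewrite (sep_central HX p0 (G := fun y1 y2 => G (J1 * y1) (K2 * (p1 * J2)) (y2 * K1) J3 K3)); last by lin.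
  by apply: eq_tsum => y1 y2; rewrite !mulrA.
swp 2%N; swp 1%N; swp 0%N; apply: eq_tsum => y1 y2.
swp 0%N; apply: eq_jsum => J1 J2 J3.
by rwl (jsum_left p (G := fun K1 K2 K3 => G (J1 * y1) (K2 * J2) (y2 * K1) J3 K3)).
Qed.
End JJ.
(** * The weak bialgebra B *)

Let lm1 := lin_mulBl.
Let lm2 := lin_mulBr.
Let lDB := lin_DeltaB.
Let leB : lin (epsB : B -> k^o) := lin_epsB.
Let lSB := lin_SB.

(** On one side the copies of J that act on h from the right are nested, on
the other they are chained, and likewise for the copies that act from the
left. [jsum_in] and [jsum_out] identify the two shapes, and coassociativity of
H does the rest. *)
Lemma comul_coassocB (W : lmodType k) l (G : B -> B -> B -> W) : tril G ->
  \tsum_(l1 ⊗ l2 <- D l) \tsum_(u ⊗ v <- D l1) G u v l2 =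
  \tsum_(l1 ⊗ l2 <- D l) \tsum_(u ⊗ v <- D l2) G l1 u v.
Proof.
move=> [G1 G2 G3]; move: l.
apply: beta_ext; [lin|lin|move=> a h c].
pose X (p1 : A) (u1 : H) p2 (u2 : H) p3 c1 (w1 : H) c2 (w2 : H) c3 :=
  \tsum_(h1 ⊗ h2 <- Delta h) \tsum_(h11 ⊗ h12 <- Delta h1)
   G (beta (p1 * a) (w1 * h11 * u1) (c * c1)) (beta p2 (w2 * h12 * u2) c2) (beta p3 h2 c3).
transitivity (jsum (fun J1 J2 J3 => jsum (fun L1 L2 L3 => \tsum_(u1 ⊗ u2 <- Delta J2)
   jsum (fun K1 K2 K3 => jsum (fun M1 M2 M3 => \tsum_(w1 ⊗ w2 <- Delta K2)
     X (L1 * J1) (u1 * L2) L3 u2 J3 (K1 * M1) (M2 * w1) M3 w2 K3))))).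
  rwl (DeltaB_beta a h c (G := fun l1 l2 => \tsum_(u ⊗ v <- D l1) G u v l2)).
  under eq_jsum => J1 J2 J3.
    under eq_jsum => K1 K2 K3.
      under eq_tsum => h1 h2.
        rwl (DeltaB_beta (J1 * a) (K2 * h1 * J2) (c * K1) (G := fun u v => G u v (beta J3 h2 K3))).
        under eq_jsum => L1 L2 L3.
          under eq_jsum => M1 M2 M3.
            rwl (DeltaM HH (K2 * h1) J2 (G := fun h11 h12 =>
              G (beta (L1 * (J1 * a)) (M2 * h11 * L2) (c * K1 * M1)) (beta L3 h12 M3) (beta J3 h2 K3))).
            rwl (DeltaM HH K2 h1 (G := fun u v => \tsum_(u' ⊗ v' <- Delta J2)
              G (beta (L1 * (J1 * a)) (M2 * (u * u') * L2) (c * K1 * M1)) (beta L3 (v * v') M3) (beta J3 h2 K3))).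
            over.
          over.
        over.
      over.
    over.
  float 7%N 1%N; float 4%N 1%N; float 5%N 4%N; float 6%N 5%N.
  do 8 under1.
  by rewrite !mulrA.
under eq_jsum => J1 J2 J3 do under eq_jsum => L1 L2 L3 do under eq_tsum => u1 u2 do
  (rewrite (jsum_out); last by rewrite /X; lin).
rewrite (jsum_in (G := fun p1 u1 p2 u2 p3 => jsum (fun K1 K2 K3 => jsum (fun M1 M2 M3 =>
  X p1 u1 p2 u2 p3 K1 K2 (K3 * M1) M2 M3)))); last by rewrite /X; lin.
symmetry; rwl (DeltaB_beta a h c (G := fun l1 l2 => \tsum_(u ⊗ v <- D l2) G l1 u v)).
under eq_jsum => J1 J2 J3.
  under eq_jsum => K1 K2 K3.
    under eq_tsum => h1 h2 do rwl (DeltaB_beta J3 h2 K3 (G := G (beta (J1 * a) (K2 * h1 * J2) (c * K1)))).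
    over.
  over.
float 3%N 1%N; float 4%N 3%N.
apply: eq_jsum => J1 J2 J3; apply: eq_jsum => L1 L2 L3; apply: eq_jsum => K1 K2 K3.
apply: eq_jsum => M1 M2 M3; rewrite /X.
by rwl (Delta_coassoc HH h (G := fun h1 h2 h3 => G (beta (J1 * a) (K2 * h1 * J2) (c * K1))
  (beta (L1 * J3) (M2 * h2 * L2) (K3 * M1)) (beta L3 h3 M3))).
Qed.

Lemma counitlB (W : lmodType k) l (G : B -> W) : lin G ->
  \tsum_(l1 ⊗ l2 <- D l) (epsB l1 : k) *: G l2 = G l.
Proof.
move=> G1; move: l; apply: beta_ext; [lin|lin|move=> a h c].
rwl (DeltaB_beta a h c (G := fun l1 l2 => (epsB l1 : k) *: G l2)).
transitivity (jsum (fun J1 J2 J3 => jsum (fun K1 K2 K3 => \tsum_(h1 ⊗ h2 <- Delta h)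
  eps h1 *: (eps K2 *: ((alpha (c * K1) : k) *: (eps J2 *: ((alpha (J1 * a) : k) *: G (beta J3 h2 K3)))))))).
  do 3 under1; rewrite epsB_beta !(epsM HH) !scalerA; congr (_ *: _); ring.
under eq_jsum => J1 J2 J3.
  under eq_jsum => K1 K2 K3 do rwl (Delta_counitl HH h (G := fun h2 => eps K2 *:
    ((alpha (c * K1) : k) *: (eps J2 *: ((alpha (J1 * a) : k) *: G (beta J3 h2 K3)))))).
  rwl jsum_counit.
  rwl (alpha_sepl HX c (G := fun K3 => eps J2 *: ((alpha (J1 * a) : k) *: G (beta J3 h K3)))).
  over.
rwl jsum_counit.
by rwl (alpha_sepr HX a (G := fun J3 => G (beta J3 h c))).
Qed.

Lemma counitrB (W : lmodType k) l (G : B -> W) : lin G ->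
  \tsum_(l1 ⊗ l2 <- D l) (epsB l2 : k) *: G l1 = G l.
Proof.
move=> G1; move: l; apply: beta_ext; [lin|lin|move=> a h c].
rwl (DeltaB_beta a h c (G := fun l1 l2 => (epsB l2 : k) *: G l1)).
transitivity (jsum (fun J1 J2 J3 => jsum (fun K1 K2 K3 => \tsum_(h1 ⊗ h2 <- Delta h)
  eps h2 *: ((alpha K3 : k) *: ((alpha J3 : k) *: G (beta (J1 * a) (K2 * h1 * J2) (c * K1))))))).
  do 3 under1; rewrite epsB_beta !scalerA; congr (_ *: _); ring.
under eq_jsum => J1 J2 J3.
  under eq_jsum => K1 K2 K3 do rwl (Delta_counitr HH h (G := fun h1 => (alpha K3 : k) *:
    ((alpha J3 : k) *: G (beta (J1 * a) (K2 * h1 * J2) (c * K1))))).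
  rwl jsum_alpha1.
  over.
rwl jsum_alpha1.
by rewrite !mul1r !mulr1.
Qed.

(** The product of the two second factors produces the scalar by which
[jsum_contract] removes the right copy of the first coproduct and the left
copy of the second. *)
Lemma DeltaB_mul (W : lmodType k) s t (G : B -> B -> W) : bil G ->
  \tsum_(u ⊗ v <- D (mulB s t)) G u v =
  \tsum_(u ⊗ v <- D s) \tsum_(u' ⊗ v' <- D t) G (mulB u u') (mulB v v').
Proof.
move=> [G1 G2]; move: s; apply: beta_ext; [lin|lin|move=> a h c].
move: t; apply: beta_ext; [lin|lin|move=> b g d].
rewrite mulB_beta (linZ (f := fun l => tlift (D l) G)); last by lin.
rwl (DeltaB_beta b (h * g) c (G := G)).
symmetry; rwl (DeltaB_beta a h c (G := fun u v =>
  \tsum_(u' ⊗ v' <- D (beta b g d)) G (mulB u u') (mulB v v'))).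
under eq_jsum => J1 J2 J3 do under eq_jsum => K1 K2 K3 do under eq_tsum => h1 h2 do
  rwl (DeltaB_beta b g d (G := fun u' v' => G (mulB (beta (J1 * a) (K2 * h1 * J2) (c * K1)) u')
     (mulB (beta J3 h2 K3) v'))).
pose X L1 (L2 : H) L3 K1 (K2 : H) K3 h1 h2 g1 g2 p (u : H) :=
  (alpha (d * p * a) : k) *: G (beta (L1 * b) (K2 * h1 * u * g1 * L2) (c * K1)) (beta L3 (h2 * g2) K3).
transitivity (jsum (fun L1 L2 L3 => jsum (fun K1 K2 K3 => \tsum_(h1 ⊗ h2 <- Delta h)
  \tsum_(g1 ⊗ g2 <- Delta g) jsum (fun M1 M2 M3 => jsum (fun J1 J2 J3 =>
    (alpha (M3 * J3) : k) *: X L1 L2 L3 K1 K2 K3 h1 h2 g1 g2 (M1 * J1) (J2 * M2)))))).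
  float 3%N 0%N; float 2%N 1%N; float 3%N 2%N; float 5%N 3%N; float 5%N 4%N.
  do 6 under1; rewrite !mulB_beta /X.
  rewrite (linZ (G2 _)) (linZ (G1 _)).
  by rewrite !mulrA.
under eq_jsum => L1 L2 L3.
  under eq_jsum => K1 K2 K3.
    under eq_tsum => h1 h2.
      under eq_tsum => g1 g2.
        rewrite (jsum_contract); last by rewrite /X; lin.
        rewrite /X.
        over.
      over.
    over.
  over.
rewrite jsumZ.
apply: eq_jsum => J1 J2 J3; rewrite jsumZ.
apply: eq_jsum => K1 K2 K3; rwl (DeltaM HH h g (G := fun u1 u2 =>
  G (beta (J1 * b) (K2 * u1 * J2) (c * K1)) (beta J3 u2 K3))).
rewrite tsumZ.
apply: eq_tsum => h1 h2; rewrite tsumZ.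
by apply: eq_tsum => g1 g2; rewrite !mulr1 !mulrA.
Qed.

Lemma DeltaB_one (W : lmodType k) (G : B -> B -> W) : bil G ->
  \tsum_(u ⊗ v <- D oneB) G u v =
  \tsum_(y1 ⊗ y2 <- x) jsum (fun J1 J2 J3 => jsum (fun K1 K2 K3 =>
    G (beta (J1 * y1) (K2 * J2) (y2 * K1)) (beta J3 1 K3))).
Proof.
move=> [G1 G2]; rewrite oneB_beta (tsum_push (L := fun l => tlift (D l) G)); last by lin.
apply: eq_tsum => y1 y2; rwl (DeltaB_beta y1 1 y2 (G := G)).
apply: eq_jsum => J1 J2 J3; apply: eq_jsum => K1 K2 K3.
by rwl (Delta1 HH); rewrite mulr1.
Qed.

Lemma mulBA : associative (@mulB k H A).
Proof.
move=> s t u; move: s; apply: beta_ext; [lin|lin|move=> a h c].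
move: t; apply: beta_ext; [lin|lin|move=> b g d].
move: u; apply: beta_ext; [lin|lin|move=> p l q].
rewrite !mulB_beta (linZ (lm2 _)) (linZ (lm1 _)) !mulB_beta !scalerA.
by rewrite mulrA mulrC.
Qed.

Lemma mulB1l : left_id oneB (@mulB k H A).
Proof.
apply: beta_ext; [lin|lin|move=> a h c].
rewrite oneB_beta (tsum_push (L := fun u => mulB u (beta a h c))); last by lin.
under eq_tsum => x1 x2 do rewrite mulB_beta mul1r.
by rwl (alpha_sepl HX c (G := beta a h)).
Qed.

Lemma mulB1r : right_id oneB (@mulB k H A).
Proof.
apply: beta_ext; [lin|lin|move=> a h c].
rewrite oneB_beta (tsum_push (L := mulB (beta a h c))); last by lin.
under eq_tsum => x1 x2 do rewrite mulB_beta mulr1.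
by rwl (alpha_sepr2 HX a (G := fun x2 => beta x2 h c)).
Qed.

Lemma DeltaB_one3 (W : lmodType k) (G : B -> B -> B -> W) : tril G ->
  \tsum_(u ⊗ v <- D oneB) \tsum_(u1 ⊗ u2 <- D u) G u1 u2 v =
  \tsum_(y1 ⊗ y2 <- x) jsum (fun J1 J2 J3 => jsum (fun K1 K2 K3 =>
   jsum (fun L1 L2 L3 => jsum (fun M1 M2 M3 =>
    G (beta (J1 * y1) (K2 * J2) (y2 * K1)) (beta (L1 * J3) (M2 * L2) (K3 * M1)) (beta L3 1 M3))))).
Proof.
move=> [G1 G2 G3]; rwl (comul_coassocB oneB (G := G)); rwl DeltaB_one.
apply: eq_tsum => y1 y2; apply: eq_jsum => J1 J2 J3; apply: eq_jsum => K1 K2 K3.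
rwl (DeltaB_beta J3 1 K3 (G := G (beta (J1 * y1) (K2 * J2) (y2 * K1)))).
apply: eq_jsum => L1 L2 L3; apply: eq_jsum => M1 M2 M3.
by rwl (Delta1 HH); rewrite mulr1.
Qed.

(** The product contracts one copy of x and leaves the first leg of a copy of
J in the wrong component of the middle factor; [unit_slide] moves it to the
component where [DeltaB_one3] has it. *)
Lemma DeltaB_one_mull (W : lmodType k) (G : B -> B -> B -> W) : tril G ->
  \tsum_(u ⊗ v <- D oneB) \tsum_(u' ⊗ v' <- D oneB) G u (mulB v u') v' =
  \tsum_(u ⊗ v <- D oneB) \tsum_(u1 ⊗ u2 <- D u) G u1 u2 v.
Proof.
move=> [G1 G2 G3]; rwl DeltaB_one3.
transitivity (jsum (fun L1 L2 L3 => jsum (fun M1 M2 M3 =>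
  \tsum_(y1 ⊗ y2 <- x) jsum (fun J1 J2 J3 => jsum (fun K1 K2 K3 =>
    G (beta (J1 * y1) (K2 * J2) (y2 * K1)) (beta (L1 * (M1 * J3)) (M2 * L2) K3) (beta L3 1 M3)))))).
  rwl DeltaB_one.
  under eq_tsum => y1 y2 do under eq_jsum => J1 J2 J3 do under eq_jsum => K1 K2 K3 do
    rwl DeltaB_one.
  float 4%N 0%N; apply: eq_jsum => L1 L2 L3.
  float 4%N 0%N; apply: eq_jsum => M1 M2 M3.
  apply: eq_tsum => y1 y2; apply: eq_jsum => J1 J2 J3; apply: eq_jsum => K1 K2 K3.
  under eq_tsum => z1 z2.
    rewrite mulB_beta mul1r -mulrA.
    rewrite (linZ (G2 _ _)).
    over.
  by rwl (alpha_sepr2 HX (M1 * J3) (G := fun z => G (beta (J1 * y1) (K2 * J2) (y2 * K1))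
    (beta (L1 * z) (M2 * L2) K3) (beta L3 1 M3))).
symmetry; float 3%N 0%N; apply: eq_jsum => L1 L2 L3.
float 3%N 0%N; apply: eq_jsum => M1 M2 M3; symmetry.
by rwl (unit_slide M1 (G := fun p u q r s =>
  G (beta p u q) (beta (L1 * r) (M2 * L2) s) (beta L3 1 M3))).
Qed.

Lemma DeltaB_one_mulr (W : lmodType k) (G : B -> B -> B -> W) : tril G ->
  \tsum_(u ⊗ v <- D oneB) \tsum_(u' ⊗ v' <- D oneB) G u (mulB u' v) v' =
  \tsum_(u ⊗ v <- D oneB) \tsum_(u1 ⊗ u2 <- D u) G u1 u2 v.
Proof.
move=> [G1 G2 G3]; rwl DeltaB_one3.
transitivity (jsum (fun L1 L2 L3 => jsum (fun M1 M2 M3 =>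
  \tsum_(y1 ⊗ y2 <- x) jsum (fun J1 J2 J3 => jsum (fun K1 K2 K3 =>
    G (beta (J1 * y1) (K2 * J2) (y2 * K1)) (beta J3 (M2 * L2) (K3 * L1 * M1)) (beta L3 1 M3)))))).
  rwl DeltaB_one.
  under eq_tsum => y1 y2 do under eq_jsum => J1 J2 J3 do under eq_jsum => K1 K2 K3 do
    rwl DeltaB_one.
  float 4%N 0%N; apply: eq_jsum => L1 L2 L3.
  float 4%N 0%N; apply: eq_jsum => M1 M2 M3.
  apply: eq_tsum => y1 y2; apply: eq_jsum => J1 J2 J3; apply: eq_jsum => K1 K2 K3.
  under eq_tsum => z1 z2.
    rewrite mulB_beta mulr1 mulrA.
    rewrite (linZ (G2 _ _)).
    over.
  by rwl (alpha_sepl HX (K3 * L1) (G := fun z => G (beta (J1 * y1) (K2 * J2) (y2 * K1))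
    (beta J3 (M2 * L2) (z * M1)) (beta L3 1 M3))).
symmetry; float 3%N 0%N; apply: eq_jsum => L1 L2 L3.
float 3%N 0%N; apply: eq_jsum => M1 M2 M3; symmetry.
by rewrite -(unit_slide L1 (G := fun p u q r s =>
  G (beta p u q) (beta r (M2 * L2) (s * M1)) (beta L3 1 M3))); last by lin.
Qed.

Lemma epsB_mul a h c b g d :
  epsB (mulB (beta a h c) (beta b g d)) =
  alpha (d * a) * (alpha b * (eps h * eps g) * alpha c).
Proof. by rewrite mulB_beta (linZ leB) epsB_beta (epsM HH). Qed.

Lemma counitl_mulB a b c :
  epsB (mulB (mulB a b) c) = \tsum_(b1 ⊗ b2 <- D b) epsB (mulB a b1) * epsB (mulB b2 c).
Proof.
move: a; apply: (beta_ext (W := k^o)); [lin|lin|move=> a h e].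
move: b; apply: (beta_ext (W := k^o)); [lin|lin|move=> b g d].
move: c; apply: (beta_ext (W := k^o)); [lin|lin|move=> p l q].
rwl (DeltaB_beta b g d (G := fun u v => epsB (mulB (beta a h e) u) * epsB (mulB v (beta p l q)) : k^o)).
pose r := alpha p * alpha e * eps h * eps l.
transitivity (jsum (fun J1 J2 J3 => jsum (fun K1 K2 K3 => \tsum_(g1 ⊗ g2 <- Delta g)
  eps g2 *: ((alpha K3 : k) *: (eps J2 *: ((alpha (J1 * b) : k) *:
    (alpha (q * J3) * (eps (K2 * g1) * (alpha (d * K1 * a) * r)) : k^o))))))); last first.
  do 3 under1; rewrite !epsB_mul !(epsM HH) /GRing.scale /= /r; ring.
under eq_jsum => J1 J2 J3.
  under eq_jsum => K1 K2 K3 do rwl (Delta_counitr HH g (G := fun g1 => (alpha K3 : k) *: (eps J2 *: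
    ((alpha (J1 * b) : k) *: (alpha (q * J3) * (eps (K2 * g1) * (alpha (d * K1 * a) * r)) : k^o))))).
  rwl jsum_alpha1.
  over.
rwl jsum_counit.
rwl (alpha_sepr HX b (G := fun J3 => alpha (q * J3) * (eps (1 * g) * (alpha (d * 1 * a) * r)) : k^o)).
rewrite mul1r mulr1 mulB_beta (linZ (lm1 _)) (linZ leB) epsB_mul (epsM HH) /r /GRing.scale /=.
ring.
Qed.

Lemma counitr_mulB a b c :
  epsB (mulB (mulB a b) c) = \tsum_(b1 ⊗ b2 <- D b) epsB (mulB a b2) * epsB (mulB b1 c).
Proof.
move: a; apply: (beta_ext (W := k^o)); [lin|lin|move=> a h e].
move: b; apply: (beta_ext (W := k^o)); [lin|lin|move=> b g d].
move: c; apply: (beta_ext (W := k^o)); [lin|lin|move=> p l q].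
rwl (DeltaB_beta b g d (G := fun u v => epsB (mulB (beta a h e) v) * epsB (mulB u (beta p l q)) : k^o)).
pose r := alpha p * alpha e * eps h * eps l.
transitivity (jsum (fun J1 J2 J3 => jsum (fun K1 K2 K3 => \tsum_(g1 ⊗ g2 <- Delta g)
  eps g2 *: (eps K2 *: ((alpha (K3 * a) : k) *: ((alpha J3 : k) *:
    (alpha (d * K1) * (alpha (q * (J1 * b)) * (eps (g1 * J2) * r)) : k^o))))))); last first.
  do 3 under1; rewrite !epsB_mul !(epsM HH) /GRing.scale /= /r; ring.
under eq_jsum => J1 J2 J3.
  under eq_jsum => K1 K2 K3 do rwl (Delta_counitr HH g (G := fun g1 => eps K2 *: ((alpha (K3 * a) : k) *:
    ((alpha J3 : k) *: (alpha (d * K1) * (alpha (q * (J1 * b)) * (eps (g1 * J2) * r)) : k^o))))).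
  rwl jsum_counit.
  rwl (alpha_sepr2 HX a (G := fun K1 =>
    ((alpha J3 : k) *: (alpha (d * K1) * (alpha (q * (J1 * b)) * (eps (g * J2) * r)) : k^o)))).
  over.
rwl jsum_alpha1.
rewrite mul1r mulr1 mulB_beta (linZ (lm1 _)) (linZ leB) epsB_mul (epsM HH) /r /GRing.scale /=.
ring.
Qed.

(** * The antipode of B *)

(** The coaction on the third leg of J undoes the one on the first, by
[rsum_sep]. *)
Lemma jsum_sep (W : lmodType k) (G : A -> A -> H -> W) : tril G ->
  jsum (fun J1 J2 J3 => rsum J3 (fun p0 p1 => G p0 J1 (J2 * p1))) =
  \tsum_(x1 ⊗ x2 <- x) G x1 x2 1.
Proof.
move=> [G1 G2 G3]; rewrite -(rsum_sep) //.
transitivity (\tsum_(x1 ⊗ x2 <- x) rsum x2 (fun p0 p1 => rsum x1 (fun J1 J2 => G p0 J1 (J2 * p1)))).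
  by apply: eq_tsum => x1 x2; exact: rsum2C.
by rewrite (sep_sym HX) //; lin.
Qed.

(** Both sides are alpha(a) eps(h) beta(y1, 1, c y2): on the left [jsum_sep]
cancels the coactions on each side of h, on the right the coproduct of 1 is
contracted with beta(a, h, c). *)
Lemma antipoderB l :
  \tsum_(l1 ⊗ l2 <- D l) mulB l1 (SB l2) =
  \tsum_(u1 ⊗ u2 <- D oneB) (epsB (mulB u1 l) : k) *: u2.
Proof.
move: l; apply: beta_ext; [lin|lin|move=> a h c].
transitivity (\tsum_(y1 ⊗ y2 <- x) (eps h *: ((alpha a : k) *: beta y1 1 (c * y2)))).
  rwl (DeltaB_beta a h c (G := fun u v => mulB u (SB v))).
  transitivity (jsum (fun K1 K2 K3 => rsum K3 (fun q0 q1 => \tsum_(h1 ⊗ h2 <- Delta h)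
    jsum (fun J1 J2 J3 => rsum J3 (fun p0 p1 =>
      (alpha (p0 * J1 * a) : k) *: beta q0 (K2 * (h1 * (J2 * p1) * S h2) * q1) (c * K1)))))).
    under eq_jsum => J1 J2 J3 do under eq_jsum => K1 K2 K3 do under eq_tsum => h1 h2 do
      (rewrite SB_beta (rsum_push _ _ (L := mulB _)); last by lin).
    under eq_jsum => J1 J2 J3 do under eq_jsum => K1 K2 K3 do under eq_tsum => h1 h2 do
      under eq_rsum => p0 p1 do (rewrite (rsum_push _ _ (L := mulB _)); last by lin).
    float 1%N 0%N; float 4%N 1%N; float 3%N 2%N.
    do 5 under1; by rewrite mulB_beta !mulrA.
  under eq_jsum => K1 K2 K3.
    under eq_rsum => q0 q1.
      under eq_tsum => h1 h2.
        rwl (jsum_sep (G := fun p0 J1 u => (alpha (p0 * J1 * a) : k) *: beta q0 (K2 * (h1 * u * S h2) * q1) (c * K1))).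
        rwl (sep_mul HX (G := fun z => (alpha (z * a) : k) *: beta q0 (K2 * (h1 * 1 * S h2) * q1) (c * K1))).
        rewrite mul1r mulr1.
        over.
      rwl (Delta_Sr HH h (G := fun z => (alpha a : k) *: beta q0 (K2 * z * q1) (c * K1))).
      rewrite mulr1.
      over.
    over.
  by rwl (jsum_sep (G := fun q0 K1 u => eps h *: ((alpha a : k) *: beta q0 u (c * K1)))).
symmetry; rwl DeltaB_one.
transitivity (\tsum_(y1 ⊗ y2 <- x) jsum (fun J1 J2 J3 => jsum (fun K1 K2 K3 =>
  eps K2 *: ((alpha (y2 * K1) : k) *: (eps J2 *: ((alpha (J1 * (y1 * c)) : k) *:
   (eps h *: ((alpha a : k) *: beta J3 1 K3)))))))).
  do 3 under1.
  rewrite mulB_beta (linZ leB) epsB_beta !(epsM HH) (alphaC HX c) -!mulrA !scalerA.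
  by congr (_ *: _); rewrite /GRing.scale /=; ring.
under eq_tsum => y1 y2.
  under eq_jsum => J1 J2 J3.
    rwl jsum_counit.
    rwl (alpha_sepl HX y2 (G := fun K3 =>
      (eps J2 *: ((alpha (J1 * (y1 * c)) : k) *: (eps h *: ((alpha a : k) *: beta J3 1 K3)))))).
    over.
  rwl jsum_counit.
  rwl (alpha_sepr HX (y1 * c) (G := fun J3 => eps h *: ((alpha a : k) *: beta J3 1 y2))).
  over.
by rwl (sep_mid HX c (G := fun y1 y2 => eps h *: ((alpha a : k) *: beta y1 1 y2))).
Qed.

(** The coactions created by S on J1 and K1 are coproducts of J2 and K2 by
[jsum_coassoc], so that they cancel against S(J2) and S(K2); the coaction on c
then disappears by invariance of alpha. *)
Lemma antipodelB_beta a h c :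
  \tsum_(l1 ⊗ l2 <- D (beta a h c)) mulB (SB l1) l2 =
  \tsum_(y1 ⊗ y2 <- x) rsum a (fun a0 a1 =>
     (alpha c : k) *: (eps h *: beta y1 a1 (y2 * a0))).
Proof.
rwl (DeltaB_beta a h c (G := fun u v => mulB (SB u) v)).
transitivity (rsum a (fun a0 a1 => \tsum_(h1 ⊗ h2 <- Delta h) rsum c (fun c0 c1 =>
  jsum (fun J1 J2 J3 => rsum J1 (fun j0 j1 => jsum (fun K1 K2 K3 => rsum K1 (fun k0 k1 =>
   (alpha (K3 * (c0 * k0)) : k) *:
    beta J3 (a1 * (j1 * S J2) * S h1 * (S K2 * k1) * c1 * h2) (j0 * a0)))))))).
  under eq_jsum => J1 J2 J3 do under eq_jsum => K1 K2 K3 do under eq_tsum => h1 h2 do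
    (rewrite SB_beta (rsum_push _ _ (L := fun z => mulB z (beta J3 h2 K3))); last by lin).
  under eq_jsum => J1 J2 J3 do under eq_jsum => K1 K2 K3 do under eq_tsum => h1 h2 do
    under eq_rsum => p0 p1 do
     ((rewrite (rsum_push _ _ (L := fun z => mulB z (beta J3 h2 K3))); last by lin);
     (rwl (rsum_mul c K1 (G := fun q0 q1 => mulB (beta q0 (p1 * S (K2 * h1 * J2) * q1) p0) (beta J3 h2 K3))))).
  under eq_jsum => J1 J2 J3 do under eq_jsum => K1 K2 K3 do under eq_tsum => h1 h2 do
    rwl (rsum_mul J1 a (G := fun p0 p1 => rsum c (fun c0 c1 => rsum K1 (fun k0 k1 =>
      mulB (beta (c0 * k0) (p1 * S (K2 * h1 * J2) * (k1 * c1)) p0) (beta J3 h2 K3))))).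
  float 4%N 0%N; float 3%N 1%N; float 5%N 2%N; float 5%N 4%N.
  do 7 under1; by rewrite mulB_beta !(SM HH) !mulrA.
transitivity (rsum a (fun a0 a1 => \tsum_(x1 ⊗ x2 <- x)
     (alpha c : k) *: (eps h *: beta x2 a1 (x1 * a0)))).
  apply: eq_rsum => a0 a1.
  under eq_tsum => h1 h2.
    under eq_rsum => c0 c1.
      under eq_jsum => J1 J2 J3.
        under eq_rsum => j0 j1.
          rewrite -(jsum_coassoc); last by lin.
          under eq_jsum => K1 K2 K3 do
            rwl (Delta_Sl_flip HH SS K2 (G := fun z => (alpha (K3 * (c0 * K1)) : k) *:
            beta J3 (a1 * (j1 * S J2) * S h1 * z * c1 * h2) (j0 * a0))).
          rwl jsum_counit.
          under eq_tsum => K1 K3 do rewrite (alphaC HX) -(mulrA c0) mulr1.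
          rwl (sep_mul HX (G := fun z => (alpha (c0 * z) : k) *:
            beta J3 (a1 * (j1 * S J2) * S h1 * c1 * h2) (j0 * a0))).
          rewrite mulr1.
          over.
        over.
      rewrite -(jsum_coassoc); last by lin.
      under eq_jsum => J1 J2 J3 do
         rwl (Delta_Sr HH J2 (G := fun z => (alpha c0 : k) *:
            beta J3 (a1 * z * S h1 * c1 * h2) (J1 * a0))).
      rwl jsum_counit.
      rewrite mulr1.
      rewrite -tsumZ.
      over.
    rwl (rsum_alpha c (G := fun c1 => \tsum_(x1 ⊗ x2 <- x) beta x2 (a1 * S h1 * c1 * h2) (x1 * a0))).
    rewrite mulr1 -mulrA.
    over.
  rwl (Delta_Sl HH h (G := fun z => (alpha c : k) *: \tsum_(x1 ⊗ x2 <- x) beta x2 (a1 * z) (x1 * a0))).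
  rewrite mulr1 scalerA mulrC -scalerA.
  rewrite (tsum_push (L := fun z => (alpha c : k) *: (eps h *: z))) //; last by lin.
swp 0%N; symmetry.
rewrite (sep_sym HX) //; lin.
Qed.

Lemma antipodelB l :
  \tsum_(l1 ⊗ l2 <- D l) mulB (SB l1) l2 =
  \tsum_(u1 ⊗ u2 <- D oneB) (epsB (mulB l u2) : k) *: u1.
Proof.
move: l; apply: beta_ext; [lin|lin|move=> a h c].
rewrite antipodelB_beta.
rwl DeltaB_one.
apply: eq_tsum => y1 y2; symmetry; swp 0%N.
transitivity (jsum (fun K1 K2 K3 => jsum (fun J1 J2 J3 => (alpha J3 : k) *:
  ((alpha (K3 * a) : k) *: ((alpha c : k) *: (eps h *: beta (J1 * y1) (K2 * J2) (y2 * K1))))))).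
  do 2 under1; rewrite mulB_beta (linZ leB) epsB_beta mulr1 !scalerA.
  by congr (_ *: _); rewrite /GRing.scale /=; ring.
under eq_jsum => K1 K2 K3 do rwl jsum_alpha1.
rwl (jsum_alphal a (G := fun K1 K2 =>
  ((alpha c : k) *: (eps h *: beta (1 * y1) (K2 * 1) (y2 * K1))))).
by apply: eq_rsum => a0 a1; rewrite mul1r mulr1.
Qed.

(** Multiplication by the antipode of an element turns the projection computed
in [antipodelB_beta] into a factor of its first component. So the third
antipode identity is reduced to counits. *)
Lemma source_mul_SB q b h d :
  mulB (\tsum_(y1 ⊗ y2 <- x) rsum q (fun q0 q1 => beta y1 q1 (y2 * q0))) (SB (beta b h d)) =
  SB (beta (b * q) h d).
Proof.
rewrite !SB_beta; rwl (rsum_mul b q (G := fun p0 p1 =>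
  rsum d (fun d0 d1 => beta d0 (p1 * S h * d1) p0))).
rewrite (rsum_push _ _ (L := mulB _)); last by lin.
apply: eq_rsum => b0 b1.
rewrite (tsum_push (L := fun z => mulB z _)); last by lin.
transitivity (rsum q (fun q0 q1 => rsum d (fun d0 d1 => \tsum_(y1 ⊗ y2 <- x)
  ((alpha (b0 * y1) : k) *: beta d0 (q1 * b1 * S h * d1) (y2 * q0))))).
  under eq_tsum => y1 y2 do (rewrite (rsum_push _ _ (L := fun z => mulB z _)); last by lin).
  under eq_tsum => y1 y2 do under eq_rsum => q0 q1 do (rewrite (rsum_push _ _ (L := mulB _)); last by lin).
  float 1%N 0%N; float 2%N 1%N; do 3 under1; by rewrite mulB_beta !mulrA.
apply: eq_rsum => q0 q1; apply: eq_rsum => d0 d1.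
by rwl (alpha_sepl HX b0 (G := fun y2 => beta d0 (q1 * b1 * S h * d1) (y2 * q0))).
Qed.

Lemma antipode3B l :
  \tsum_(l1 ⊗ l2 <- D l) \tsum_(l11 ⊗ l12 <- D l1) mulB (mulB (SB l11) l12) (SB l2) = SB l.
Proof.
move: l; apply: beta_ext; [lin|lin|move=> a h c].
rwl (DeltaB_beta a h c (G := fun l1 l2 => \tsum_(l11 ⊗ l12 <- D l1) mulB (mulB (SB l11) l12) (SB l2))).
transitivity (jsum (fun J1 J2 J3 => jsum (fun K1 K2 K3 => \tsum_(h1 ⊗ h2 <- Delta h)
  eps h1 *: (eps K2 *: ((alpha (c * K1) : k) *: (eps J2 *: SB (beta (J3 * (J1 * a)) h2 K3))))))).
  apply: eq_jsum => J1 J2 J3; apply: eq_jsum => K1 K2 K3; apply: eq_tsum => h1 h2.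
  rewrite -(tsum_push (L := fun z => mulB z (SB (beta J3 h2 K3)))); last by lin.
  rewrite antipodelB_beta.
  rewrite -source_mul_SB -!(linZ (lm1 _)); congr mulB.
  rewrite (tsum_push (L := fun z => eps h1 *: (eps K2 *: ((alpha (c * K1) : k) *: (eps J2 *: z))))); last by lin.
  apply: eq_tsum => y1 y2.
  rewrite (rsum_push _ _ (L := fun z => eps h1 *: (eps K2 *: ((alpha (c * K1) : k) *: (eps J2 *: z))))); last by lin.
  by apply: eq_rsum => q0 q1; rewrite !scalerA !(epsM HH); congr (_ *: _); ring.
under eq_jsum => J1 J2 J3.
  under eq_jsum => K1 K2 K3 do rwl (Delta_counitl HH h (G := fun h2 =>
   (eps K2 *: ((alpha (c * K1) : k) *: (eps J2 *: SB (beta (J3 * (J1 * a)) h2 K3)))))).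
  rwl jsum_counit.
  rwl (alpha_sepl HX c (G := fun K3 => eps J2 *: SB (beta (J3 * (J1 * a)) h K3))).
  over.
rwl jsum_counit.
rewrite (sep_sym HX); last by lin.
under eq_tsum => x1 x2 do rewrite mulrA.
by rwl (sep_mul HX (G := fun z => SB (beta (z * a) h c))); rewrite mul1r.
Qed.

(** * The R-matrix of B *)

(** The product of the second factors yields the scalar that lets
[jsum_contract] remove one copy of J from R_B and one from Delta(1). *)
Lemma RB_unitr (W : lmodType k) (G : B -> B -> W) : bil G ->
  \tsum_(r ⊗ s <- RB) \tsum_(u ⊗ v <- D oneB) G (mulB r u) (mulB s v) =
  \tsum_(r ⊗ s <- RB) G r s.
Proof.
move=> [G1 G2].
rwl RB_beta.
rwl RB_beta.
under eq_tsum => y1 y2 do under eq_tsum => r1 r2 do under eq_jsum => J1 J2 J3 do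
  under eq_jsum => K1 K2 K3 do rwl DeltaB_one.
transitivity (\tsum_(y1 ⊗ y2 <- x) \tsum_(r1 ⊗ r2 <- R) jsum (fun L1 L2 L3 =>
  jsum (fun K1 K2 K3 => \tsum_(z1 ⊗ z2 <- x) jsum (fun M1 M2 M3 => jsum (fun J1 J2 J3 =>
    (alpha (M3 * J3) : k) *: ((alpha (z2 * ((M1 * J1) * y1)) : k) *:
      G (beta (L1 * z1) (r1 * (J2 * M2) * L2) K3) (beta L3 (K2 * r2) (y2 * K1)))))))).
  float 5%N 2%N; float 4%N 3%N; float 5%N 4%N; float 6%N 5%N.
  do 7 under1; rewrite !mulB_beta (linZ (G2 _)) (linZ (G1 _)).
  by rewrite mulr1 !mulrA.
apply: eq_tsum => y1 y2; apply: eq_tsum => r1 r2.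
apply: eq_jsum => L1 L2 L3; apply: eq_jsum => K1 K2 K3.
under eq_tsum => z1 z2 do rwl (jsum_contract (G := fun p u =>
  ((alpha (z2 * (p * y1)) : k) *:
      G (beta (L1 * z1) (r1 * u * L2) K3) (beta L3 (K2 * r2) (y2 * K1))))).
rwl (alpha_sepr2 HX (1 * y1) (G := fun z1 =>
      G (beta (L1 * z1) (r1 * 1 * L2) K3) (beta L3 (K2 * r2) (y2 * K1)))).
by rewrite mul1r mulr1.
Qed.

(** Two copies of J are contracted as in [RB_unitr]. The result differs from
[RB_Delta] only by the axiom [R_comm] of H. *)
Lemma cop_RB a h c (W : lmodType k) (G : B -> B -> W) : bil G ->
  \tsum_(u ⊗ v <- D (beta a h c)) \tsum_(r ⊗ s <- RB) G (mulB v r) (mulB u s) =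
  \tsum_(h1 ⊗ h2 <- Delta h) \tsum_(r1 ⊗ r2 <- R)
   jsum (fun J1 J2 J3 => jsum (fun M1 M2 M3 =>
    G (beta (J1 * a) (h2 * r1 * J2) M3) (beta J3 (M2 * (h1 * r2)) (c * M1)))).
Proof.
move=> [G1 G2].
rwl (DeltaB_beta a h c (G := fun u v => \tsum_(r ⊗ s <- RB) G (mulB v r) (mulB u s))).
under eq_jsum => L1 L2 L3 do under eq_jsum => M1 M2 M3 do under eq_tsum => h1 h2 do
  rwl RB_beta.
transitivity (\tsum_(h1 ⊗ h2 <- Delta h) \tsum_(r1 ⊗ r2 <- R)
   jsum (fun J1 J2 J3 => jsum (fun M1 M2 M3 => \tsum_(y1 ⊗ y2 <- x)
     jsum (fun K1 K2 K3 => jsum (fun L1 L2 L3 =>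
    (alpha (K3 * L3) : k) *: ((alpha (y2 * (K1 * L1) * a) : k) *:
      G (beta (J1 * y1) (h2 * r1 * J2) M3) (beta J3 (M2 * h1 * (L2 * K2) * r2) (c * M1)))))))).
  float 2%N 0%N; float 4%N 1%N; float 5%N 2%N; float 4%N 3%N; float 5%N 4%N; float 6%N 5%N.
  do 7 under1; rewrite !mulB_beta (linZ (G2 _)) (linZ (G1 _)).
  by rewrite !scalerA mulrC !mulrA.
apply: eq_tsum => h1 h2; apply: eq_tsum => r1 r2.
apply: eq_jsum => J1 J2 J3; apply: eq_jsum => M1 M2 M3.
under eq_tsum => y1 y2 do rwl (jsum_contract (G := fun p u =>
  ((alpha (y2 * p * a) : k) *:
      G (beta (J1 * y1) (h2 * r1 * J2) M3) (beta J3 (M2 * h1 * u * r2) (c * M1))))).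
under eq_tsum => y1 y2 do rewrite !mulr1.
rwl (alpha_sepr2 HX a (G := fun y1 =>
      G (beta (J1 * y1) (h2 * r1 * J2) M3) (beta J3 (M2 * h1 * r2) (c * M1)))).
by rewrite !mulrA.
Qed.

Lemma RB_Delta a h c (W : lmodType k) (G : B -> B -> W) : bil G ->
  \tsum_(r ⊗ s <- RB) \tsum_(u ⊗ v <- D (beta a h c)) G (mulB r u) (mulB s v) =
  \tsum_(r1 ⊗ r2 <- R) \tsum_(h1 ⊗ h2 <- Delta h)
   jsum (fun J1 J2 J3 => jsum (fun M1 M2 M3 =>
    G (beta (J1 * a) (r1 * h1 * J2) M3) (beta J3 (M2 * (r2 * h2)) (c * M1)))).
Proof.
move=> [G1 G2].
rwl RB_beta.
under eq_tsum => y1 y2 do under eq_tsum => r1 r2 do under eq_jsum => J1 J2 J3 do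
  under eq_jsum => K1 K2 K3 do rwl (DeltaB_beta a h c (G := fun u v =>
    G (mulB (beta (J1 * y1) (r1 * J2) K3) u) (mulB (beta J3 (K2 * r2) (y2 * K1)) v))).
transitivity (\tsum_(r1 ⊗ r2 <- R) \tsum_(h1 ⊗ h2 <- Delta h) jsum (fun L1 L2 L3 =>
  jsum (fun K1 K2 K3 => \tsum_(y1 ⊗ y2 <- x) jsum (fun M1 M2 M3 => jsum (fun J1 J2 J3 =>
    (alpha (M3 * J3) : k) *: ((alpha (c * (M1 * J1) * y1) : k) *:
      G (beta (L1 * a) (r1 * (J2 * M2) * h1 * L2) K3) (beta L3 (K2 * r2 * h2) (y2 * K1)))))))).
  float 1%N 0%N; float 6%N 1%N; float 5%N 2%N; float 5%N 3%N; float 6%N 5%N.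
  do 7 under1; rewrite !mulB_beta (linZ (G2 _)) (linZ (G1 _)).
  by rewrite !mulrA.
apply: eq_tsum => r1 r2; apply: eq_tsum => h1 h2.
apply: eq_jsum => L1 L2 L3; apply: eq_jsum => K1 K2 K3.
under eq_tsum => y1 y2 do rwl (jsum_contract (G := fun p u =>
  ((alpha (c * p * y1) : k) *:
      G (beta (L1 * a) (r1 * u * h1 * L2) K3) (beta L3 (K2 * r2 * h2) (y2 * K1))))).
under eq_tsum => y1 y2 do rewrite !mulr1.
rwl (alpha_sepl HX c (G := fun y2 =>
      G (beta (L1 * a) (r1 * h1 * L2) K3) (beta L3 (K2 * r2 * h2) (y2 * K1)))).
by rewrite !mulrA.
Qed.

Lemma RB_comm l (W : lmodType k) (G : B -> B -> W) : bil G ->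
  \tsum_(u ⊗ v <- D l) \tsum_(r ⊗ s <- RB) G (mulB v r) (mulB u s) =
  \tsum_(r ⊗ s <- RB) \tsum_(u ⊗ v <- D l) G (mulB r u) (mulB s v).
Proof.
move=> [G1 G2]; move: l; apply: beta_ext; [lin|lin|move=> a h c].
rwl (cop_RB a h c); rwl (RB_Delta a h c).
rewrite [LHS]tsumC; symmetry.
by rwl (R_comm HR h (G := fun u v => jsum (fun J1 J2 J3 => jsum (fun M1 M2 M3 =>
    G (beta (J1 * a) (u * J2) M3) (beta J3 (M2 * v) (c * M1)))))).
Qed.

(** After expansion the two sides differ by the position of one copy of J: its
first two legs act on the second tensor factor on one side, and on the third
and the first on the other. The copy is carried over by [jsum_right],
[jsum_coassoc], [R_comm], centrality of x and [jsum_left]. *)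
Lemma RB_comulr (W : lmodType k) (G : B -> B -> B -> W) : tril G ->
  \tsum_(r ⊗ s <- RB) \tsum_(u ⊗ v <- D s) G r u v =
  \tsum_(r ⊗ s <- RB) \tsum_(r' ⊗ s' <- RB) G (mulB r r') s' s.
Proof.
move=> [G1 G2 G3].
transitivity (\tsum_(y1 ⊗ y2 <- x) \tsum_(r1 ⊗ r2 <- R) \tsum_(s1 ⊗ s2 <- R)
  jsum (fun J1 J2 J3 => jsum (fun L1 L2 L3 => jsum (fun K1 K2 K3 => jsum (fun M1 M2 M3 =>
    G (beta (J1 * y1) (r1 * s1 * J2) M3) (beta (L1 * J3) (K2 * s2 * L2) (y2 * K1))
      (beta L3 (M2 * r2) (K3 * M1))))))).
  rwl RB_beta.
  apply: eq_tsum => y1 y2.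
  under eq_tsum => r1 r2 do under eq_jsum => J1 J2 J3 do under eq_jsum => K1 K2 K3 do
    rwl (DeltaB_beta J3 (K2 * r2) (y2 * K1) (G := G (beta (J1 * y1) (r1 * J2) K3))).
  under eq_tsum => r1 r2 do under eq_jsum => J1 J2 J3 do under eq_jsum => K1 K2 K3 do
    under eq_jsum => L1 L2 L3 do under eq_jsum => M1 M2 M3 do
     rwl (DeltaM HH K2 r2 (G := fun u v => G (beta (J1 * y1) (r1 * J2) K3)
       (beta (L1 * J3) (M2 * u * L2) (y2 * K1 * M1)) (beta L3 v M3))).
  float 6%N 1%N.
  rwl (R_comulr HR).
  apply: eq_tsum => r1 r2; apply: eq_tsum => s1 s2; apply: eq_jsum => J1 J2 J3.
  float 1%N 0%N; apply: eq_jsum => L1 L2 L3.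
  rewrite -(jsum_out (G := fun p u q v t => G (beta (J1 * y1) (r1 * s1 * J2) t)
    (beta (L1 * J3) (u * s2 * L2) (y2 * p)) (beta L3 (v * r2) q))); last by lin.
  by do 3 under1; rewrite !mulrA.
symmetry.
transitivity (\tsum_(r1 ⊗ r2 <- R) \tsum_(s1 ⊗ s2 <- R) jsum (fun J1 J2 J3 =>
  \tsum_(z1 ⊗ z2 <- x) jsum (fun L1 L2 L3 => jsum (fun K1 K2 K3 => jsum (fun M1 M2 M3 =>
    G (beta (L1 * z1) (r1 * J2 * s1 * L2) K3) (beta L3 (M2 * s2) (z2 * M1))
      (beta J3 (K2 * r2) (M3 * J1 * K1))))))).
  rwl RB_beta.
  under eq_tsum => y1 y2 do under eq_tsum => r1 r2 do under eq_jsum => J1 J2 J3 do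
    under eq_jsum => K1 K2 K3 do rwl RB_beta.
  float 1%N 0%N; float 5%N 1%N; float 3%N 2%N; float 5%N 3%N; float 6%N 4%N; float 6%N 5%N; float 7%N 6%N.
  apply: eq_tsum => r1 r2; apply: eq_tsum => s1 s2; apply: eq_jsum => J1 J2 J3; apply: eq_tsum => z1 z2.
  apply: eq_jsum => L1 L2 L3; apply: eq_jsum => K1 K2 K3; apply: eq_jsum => M1 M2 M3.
  under eq_tsum => y1 y2 do rewrite mulB_beta mulrA (linZ (G1 _ _)).
  rwl (alpha_sepl HX (M3 * J1) (G := fun y2 => G (beta (L1 * z1) (r1 * J2 * (s1 * L2)) K3)
    (beta L3 (M2 * s2) (z2 * M1)) (beta J3 (K2 * r2) (y2 * K1)))).
  by rewrite !mulrA.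
symmetry.
(* The arguments p, q, u, v are the places where the moving copy of J acts. *)
pose Y (r1 r2 : H) J3 p q (u v : H) := \tsum_(z1 ⊗ z2 <- x) jsum (fun K1 K2 K3 =>
  jsum (fun M1 M2 M3 => jsum (fun L1 L2 L3 =>
    G (beta (L1 * (p * z1)) (r1 * u * L2) K3) (beta L3 (M2 * v) (z2 * q * M1))
      (beta J3 (K2 * r2) (M3 * K1))))).
have YE := erefl Y; rewrite {2}/Y in YE.
have YC r1 r2 J3 p u v : Y r1 r2 J3 p 1 u v = Y r1 r2 J3 1 p u v.
  rewrite /Y; rwl (sep_central HX p (G := fun z1 z2 => jsum (fun K1 K2 K3 =>
    jsum (fun M1 M2 M3 => jsum (fun L1 L2 L3 =>
    G (beta (L1 * z1) (r1 * u * L2) K3) (beta L3 (M2 * v) (z2 * 1 * M1))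
      (beta J3 (K2 * r2) (M3 * K1))))))).
  by do 4 under1; rewrite mulr1 mul1r.
have Y1 r1 r2 J3 q u v : lin (fun p => Y r1 r2 J3 p q u v) by rewrite /Y; lin.
have Y2 r1 r2 J3 p u v : lin (fun q => Y r1 r2 J3 p q u v) by rewrite /Y; lin.
have Y3 r1 r2 J3 p q v : lin (fun u => Y r1 r2 J3 p q u v) by rewrite /Y; lin.
have Y4 r1 r2 J3 p q u : lin (fun v => Y r1 r2 J3 p q u v) by rewrite /Y; lin.
have Y5 r1 r2 p q u v : lin (fun J3 => Y r1 r2 J3 p q u v) by rewrite /Y; lin.
clearbody Y.
transitivity (\tsum_(r1 ⊗ r2 <- R) \tsum_(s1 ⊗ s2 <- R) jsum (fun J1 J2 J3 =>
  rsum J1 (fun p0 p1 => Y r1 r2 J3 p0 1 (s1 * p1) (s2 * J2)))).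
  float 1%N 0%N; float 2%N 1%N; apply: eq_tsum => r1 r2; apply: eq_tsum => s1 s2.
  float 2%N 0%N; apply: eq_jsum => J1 J2 J3.
  rewrite YE; symmetry; swp 0%N; apply: eq_tsum => z1 z2.
  float 1%N 0%N; symmetry; float 2%N 0%N; apply: eq_jsum => K1 K2 K3.
  symmetry; float 1%N 0%N; symmetry; float 1%N 0%N; apply: eq_jsum => M1 M2 M3.
  rewrite -(jsum_right J1 (G := fun p u q => G (beta (p * z1) (r1 * s1 * u) K3)
    (beta q (M2 * s2 * J2) (z2 * M1)) (beta J3 (K2 * r2) (M3 * K1)))); last by lin.
  by do 2 under1; rewrite mulr1 !mulrA.
transitivity (\tsum_(r1 ⊗ r2 <- R) jsum (fun J1 J2 J3 => \tsum_(s1 ⊗ s2 <- R)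
   \tsum_(u ⊗ v <- Delta J2) Y r1 r2 J3 1 J1 (s1 * u) (s2 * v))).
  apply: eq_tsum => r1 r2; symmetry; float 1%N 0%N; apply: eq_tsum => s1 s2.
  rewrite (jsum_coassoc); last by lin.
  by do 2 under1; rewrite YC.
symmetry.
transitivity (\tsum_(r1 ⊗ r2 <- R) jsum (fun J1 J2 J3 => \tsum_(s1 ⊗ s2 <- R)
   \tsum_(u ⊗ v <- Delta J2) Y r1 r2 J3 1 J1 (v * s1) (u * s2))); last first.
  apply: eq_tsum => r1 r2; apply: eq_jsum => J1 J2 J3; symmetry.
  by rwl (R_comm HR J2 (G := Y r1 r2 J3 1 J1)).
apply: eq_tsum => r1 r2; symmetry; float 1%N 0%N; apply: eq_tsum => s1 s2.
rewrite (jsum_coassoc); last by lin.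
apply: eq_jsum => J1 J2 J3; rewrite YE; swp 0%N; apply: eq_tsum => z1 z2.
symmetry; float 1%N 0%N; symmetry; float 1%N 0%N; apply: eq_jsum => K1 K2 K3.
float 2%N 0%N; apply: eq_jsum => L1 L2 L3.
rewrite -mulrA -(jsum_left J1 (G := fun p u q => G (beta (L1 * z1) (r1 * J2 * s1 * L2) K3)
   (beta L3 (u * s2) (z2 * p)) (beta J3 (K2 * r2) (q * K1)))); last by lin.
by do 2 under1; rewrite mul1r !mulrA.
Qed.

(** The mirror image of [RB_comulr]: the copy M of the coaction tensor is
moved by [jsum_right], [jsum_coassoc], centrality, [R_comm] and [jsum_out]. *)
Lemma RB_comull (W : lmodType k) (G : B -> B -> B -> W) : tril G ->
  \tsum_(r ⊗ s <- RB) \tsum_(u ⊗ v <- D r) G u v s =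
  \tsum_(r ⊗ s <- RB) \tsum_(r' ⊗ s' <- RB) G r r' (mulB s s').
Proof.
move=> [G1 G2 G3].
transitivity (\tsum_(y1 ⊗ y2 <- x) \tsum_(r1 ⊗ r2 <- R) \tsum_(s1 ⊗ s2 <- R)
  jsum (fun M1 M2 M3 => jsum (fun K1 K2 K3 => jsum (fun J1 J2 J3 => jsum (fun L1 L2 L3 =>
    G (beta (J1 * y1) (K2 * r1 * J2) (M3 * K1)) (beta (L1 * J3) (s1 * L2) K3)
      (beta L3 (M2 * (r2 * s2)) (y2 * M1))))))).
  rwl RB_beta.
  apply: eq_tsum => y1 y2.
  under eq_tsum => r1 r2 do under eq_jsum => J1 J2 J3 do under eq_jsum => K1 K2 K3 do
    rwl (DeltaB_beta (J1 * y1) (r1 * J2) K3 (G := fun u v => G u v (beta J3 (K2 * r2) (y2 * K1)))).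
  under eq_tsum => r1 r2 do under eq_jsum => J1 J2 J3 do under eq_jsum => K1 K2 K3 do
    under eq_jsum => L1 L2 L3 do under eq_jsum => M1 M2 M3 do
     rwl (DeltaM HH r1 J2 (G := fun u v => G (beta (L1 * (J1 * y1)) (M2 * u * L2) (K3 * M1))
       (beta L3 v M3) (beta J3 (K2 * r2) (y2 * K1)))).
  float 5%N 1%N.
  rwl (R_comull HR).
  apply: eq_tsum => r1 r2; apply: eq_tsum => s1 s2.
  float 1%N 0%N; apply: eq_jsum => M1 M2 M3.
  float 2%N 0%N; apply: eq_jsum => K1 K2 K3.
  rewrite -(jsum_in (G := fun p u q v t => G (beta (p * y1) (K2 * r1 * u) (M3 * K1))
    (beta q (s1 * v) K3) (beta t (M2 * (r2 * s2)) (y2 * M1)))); last by lin.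
  by do 3 under1; rewrite !mulrA.
symmetry.
(* As before, the arguments are the places where the moving copies act. *)
pose Y (s1 s2 : H) p a (u : H) (h : H) b c := \tsum_(y1 ⊗ y2 <- x) jsum (fun J1 J2 J3 =>
  jsum (fun L1 L2 L3 => G (beta (J1 * (p * y1)) (u * J2) b) (beta (L1 * J3) (s1 * L2) c)
    (beta L3 (h * s2) (y2 * a)))).
have YE := erefl Y; rewrite {2}/Y in YE.
have YC s1 s2 p a u h b c : Y s1 s2 p a u h b c = Y s1 s2 1 (p * a) u h b c.
  rewrite /Y; rwl (sep_central HX p (G := fun y1 y2 => jsum (fun J1 J2 J3 =>
  jsum (fun L1 L2 L3 => G (beta (J1 * y1) (u * J2) b) (beta (L1 * J3) (s1 * L2) c)
    (beta L3 (h * s2) (y2 * a)))))).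
  by do 3 under1; rewrite mul1r !mulrA.
have Y1 s1 s2 a u h b c : lin (fun p => Y s1 s2 p a u h b c) by rewrite /Y; lin.
have Y2 s1 s2 p u h b c : lin (fun a => Y s1 s2 p a u h b c) by rewrite /Y; lin.
have Y3 s1 s2 p a h b c : lin (fun u => Y s1 s2 p a u h b c) by rewrite /Y; lin.
have Y4 s1 s2 p a u b c : lin (fun h => Y s1 s2 p a u h b c) by rewrite /Y; lin.
have Y5 s1 s2 p a u h c : lin (fun b => Y s1 s2 p a u h b c) by rewrite /Y; lin.
have Y6 s1 s2 p a u h b : lin (fun c => Y s1 s2 p a u h b c) by rewrite /Y; lin.
clearbody Y.
transitivity (\tsum_(s1 ⊗ s2 <- R) \tsum_(r1 ⊗ r2 <- R) jsum (fun M1 M2 M3 =>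
  rsum M1 (fun p0 p1 => jsum (fun K1 K2 K3 => Y s1 s2 p0 K1 (r1 * p1) (K2 * (r2 * M2)) K3 M3)))).
  rwl RB_beta.
  under eq_tsum => y1 y2 do under eq_tsum => r1 r2 do under eq_jsum => J1 J2 J3 do
    under eq_jsum => K1 K2 K3 do rwl RB_beta.
  float 5%N 0%N; apply: eq_tsum => s1 s2; float 1%N 0%N; apply: eq_tsum => r1 r2.
  float 5%N 0%N; apply: eq_jsum => M1 M2 M3; float 2%N 0%N.
  symmetry; float 1%N 0%N; symmetry; apply: eq_jsum => K1 K2 K3; rewrite YE.
  symmetry; float 1%N 0%N; symmetry; apply: eq_tsum => y1 y2.
  transitivity (jsum (fun J1 J2 J3 => jsum (fun L1 L2 L3 =>
    G (beta (J1 * y1) (r1 * J2) K3) (beta (L1 * (M1 * J3)) (s1 * L2) M3)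
      (beta L3 (K2 * (r2 * M2) * s2) (y2 * K1))))).
    apply: eq_jsum => J1 J2 J3; float 1%N 0%N; apply: eq_jsum => L1 L2 L3.
    under eq_tsum => z1 z2 do rewrite mulB_beta -mulrA (linZ (G3 _ _)).
    rwl (alpha_sepr2 HX (M1 * J3) (G := fun z1 => G (beta (J1 * y1) (r1 * J2) K3)
      (beta (L1 * z1) (s1 * L2) M3) (beta L3 (K2 * r2 * (M2 * s2)) (y2 * K1)))).
    by rewrite !mulrA.
  rewrite -(jsum_right M1 (G := fun p u q => jsum (fun L1 L2 L3 =>
    G (beta (p * y1) (r1 * u) K3) (beta (L1 * q) (s1 * L2) M3)
      (beta L3 (K2 * (r2 * M2) * s2) (y2 * K1))))); last by lin.
  by do 3 under1; rewrite !mulrA.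
transitivity (\tsum_(s1 ⊗ s2 <- R) jsum (fun M1 M2 M3 => jsum (fun K1 K2 K3 =>
  \tsum_(u ⊗ v <- Delta M2) \tsum_(r1 ⊗ r2 <- R)
     Y s1 s2 1 (M1 * K1) (v * r1) (K2 * u * r2) K3 M3))).
  apply: eq_tsum => s1 s2; float 1%N 0%N.
  symmetry; under eq_jsum => M1 M2 M3 do under eq_jsum => K1 K2 K3 do
   (rewrite tsumC; under eq_tsum => r1 r2 do under eq_tsum => u v do rewrite -mulrA;
    rewrite -(R_comm HR M2 (G := fun u v => Y s1 s2 1 (M1 * K1) u (K2 * v) K3 M3)); last by lin).
  symmetry.
  transitivity (\tsum_(r1 ⊗ r2 <- R) jsum (fun M1 M2 M3 => \tsum_(u ⊗ v <- Delta M2)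
     jsum (fun K1 K2 K3 => Y s1 s2 M1 K1 (r1 * u) (K2 * (r2 * v)) K3 M3))).
    swp 0%N; apply: eq_tsum => r1 r2.
    by rwl jsum_coassoc.
  float 1%N 0%N; apply: eq_jsum => M1 M2 M3.
  float 2%N 0%N; apply: eq_jsum => K1 K2 K3.
  by do 2 under1; rewrite YC.
symmetry; float 2%N 0%N; apply: eq_tsum => s1 s2.
rwl (jsum_out (G := fun a h b w c => \tsum_(r1 ⊗ r2 <- R)
  Y s1 s2 1 a (w * r1) (h * r2) b c)).
float 2%N 0%N; float 3%N 1%N; swp 2%N; do 3 under1; rewrite YE.
by do 3 under1; rewrite mul1r !mulrA.
Qed.

(** R_B with R replaced by its inverse and with the copies of J attached so
that [jsum_contract] applies to both products with R_B. *)
Definition RbarB (R' : H ⊗ H) : B ⊗ B :=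
  \tsum_(y1 ⊗ y2 <- x) \tsum_(s1 ⊗ s2 <- R') jsum (fun J1 J2 J3 => jsum (fun K1 K2 K3 =>
    beta K3 (J2 * s1) (y2 * J1) ⊗ beta (K1 * y1) (s2 * K2) J3)).

Lemma RbarB_beta (W : lmodType k) R' (G : B -> B -> W) : bil G ->
  \tsum_(p ⊗ q <- RbarB R') G p q =
  \tsum_(y1 ⊗ y2 <- x) \tsum_(s1 ⊗ s2 <- R') jsum (fun J1 J2 J3 => jsum (fun K1 K2 K3 =>
    G (beta K3 (J2 * s1) (y2 * J1)) (beta (K1 * y1) (s2 * K2) J3))).
Proof.
move=> [G1 G2]; have lG : lin (fun t => tlift t G) by apply: lin_tsum_arg; split.
rewrite /RbarB (tsum_push lG); apply: eq_tsum => y1 y2.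
rewrite (tsum_push lG); apply: eq_tsum => s1 s2.
rewrite (jsum_push _ _ _ _ lG); apply: eq_jsum => J1 J2 J3.
rewrite (jsum_push _ _ _ _ lG); apply: eq_jsum => K1 K2 K3.
by rwl tsum_tens.
Qed.

Section Inverse.
Variable R' : H ⊗ H.
Hypothesis RR' : forall (W : lmodType k) (G : H -> H -> W), bil G ->
    \tsum_(r1 ⊗ r2 <- R) \tsum_(s1 ⊗ s2 <- R') G (r1 * s1) (r2 * s2) = G 1 1.
Hypothesis R'R : forall (W : lmodType k) (G : H -> H -> W), bil G ->
    \tsum_(s1 ⊗ s2 <- R') \tsum_(r1 ⊗ r2 <- R) G (s1 * r1) (s2 * r2) = G 1 1.

Lemma RbarB_mull (W : lmodType k) (G : B -> B -> W) : bil G ->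
  \tsum_(p ⊗ q <- RbarB R') \tsum_(r ⊗ s <- RB) G (mulB p r) (mulB q s) =
  \tsum_(u ⊗ v <- D oneB) G u v.
Proof.
move=> [G1 G2].
rwl (RbarB_beta R' (G := fun p q => \tsum_(r ⊗ s <- RB) G (mulB p r) (mulB q s))).
under eq_tsum => y1 y2 do under eq_tsum => s1 s2 do under eq_jsum => J1 J2 J3 do
  under eq_jsum => K1 K2 K3 do rwl RB_beta.
rwl DeltaB_one; apply: eq_tsum => y1 y2.
transitivity (\tsum_(s1 ⊗ s2 <- R') \tsum_(r1 ⊗ r2 <- R) jsum (fun L1 L2 L3 =>
  jsum (fun J1 J2 J3 => \tsum_(z1 ⊗ z2 <- x) jsum (fun M1 M2 M3 => jsum (fun K1 K2 K3 =>
    (alpha (M3 * K3) : k) *: ((alpha (z2 * ((M1 * K1) * y1)) : k) *: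
      G (beta (L1 * z1) (J2 * (s1 * r1) * L2) (y2 * J1)) (beta L3 (s2 * (K2 * M2) * r2) J3))))))).
  float 4%N 1%N; float 5%N 2%N; float 5%N 4%N; float 6%N 5%N.
  do 7 under1; rewrite !mulB_beta (linZ (G2 _)) (linZ (G1 _)).
  by rewrite !scalerA mulrC !mulrA.
transitivity (\tsum_(s1 ⊗ s2 <- R') \tsum_(r1 ⊗ r2 <- R) jsum (fun L1 L2 L3 =>
  jsum (fun J1 J2 J3 =>
      G (beta (L1 * y1) (J2 * (s1 * r1) * L2) (y2 * J1)) (beta L3 (s2 * r2) J3)))).
  apply: eq_tsum => s1 s2; apply: eq_tsum => r1 r2.
  apply: eq_jsum => L1 L2 L3; apply: eq_jsum => J1 J2 J3.
  under eq_tsum => z1 z2 do rwl (jsum_contract (G := fun p u =>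
    ((alpha (z2 * (p * y1)) : k) *:
      G (beta (L1 * z1) (J2 * (s1 * r1) * L2) (y2 * J1)) (beta L3 (s2 * u * r2) J3)))).
  under eq_tsum => z1 z2 do rewrite mul1r mulr1.
  by rwl (alpha_sepr2 HX y1 (G := fun z1 =>
      G (beta (L1 * z1) (J2 * (s1 * r1) * L2) (y2 * J1)) (beta L3 (s2 * r2) J3))).
rwl (R'R (G := fun u v => jsum (fun L1 L2 L3 => jsum (fun J1 J2 J3 =>
      G (beta (L1 * y1) (J2 * u * L2) (y2 * J1)) (beta L3 v J3))))).
by do 2 under1; rewrite mulr1.
Qed.

Lemma RbarB_mulr (W : lmodType k) (G : B -> B -> W) : bil G ->
  \tsum_(r ⊗ s <- RB) \tsum_(p ⊗ q <- RbarB R') G (mulB r p) (mulB s q) =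
  \tsum_(u ⊗ v <- D oneB) G v u.
Proof.
move=> [G1 G2].
rwl RB_beta.
under eq_tsum => z1 z2 do under eq_tsum => r1 r2 do under eq_jsum => L1 L2 L3 do
  under eq_jsum => M1 M2 M3 do rwl (RbarB_beta R' (G := fun p q =>
    G (mulB (beta (L1 * z1) (r1 * L2) M3) p) (mulB (beta L3 (M2 * r2) (z2 * M1)) q))).
rwl DeltaB_one.
float 4%N 0%N; apply: eq_tsum => y1 y2.
transitivity (\tsum_(r1 ⊗ r2 <- R) \tsum_(s1 ⊗ s2 <- R') jsum (fun K1 K2 K3 =>
  jsum (fun M1 M2 M3 => \tsum_(z1 ⊗ z2 <- x) jsum (fun J1 J2 J3 => jsum (fun L1 L2 L3 =>
    (alpha (J3 * L3) : k) *: ((alpha (y2 * (J1 * L1) * z1) : k) *: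
      G (beta K3 (r1 * (L2 * J2) * s1) M3) (beta (K1 * y1) (M2 * (r2 * s2) * K2) (z2 * M1)))))))).
  float 1%N 0%N; float 4%N 1%N; float 6%N 2%N; float 5%N 3%N; float 6%N 5%N.
  do 7 under1; rewrite !mulB_beta (linZ (G2 _)) (linZ (G1 _)).
  by rewrite !mulrA.
transitivity (\tsum_(r1 ⊗ r2 <- R) \tsum_(s1 ⊗ s2 <- R') jsum (fun K1 K2 K3 =>
  jsum (fun M1 M2 M3 =>
      G (beta K3 (r1 * s1) M3) (beta (K1 * y1) (M2 * (r2 * s2) * K2) (y2 * M1))))).
  apply: eq_tsum => r1 r2; apply: eq_tsum => s1 s2.
  apply: eq_jsum => K1 K2 K3; apply: eq_jsum => M1 M2 M3.
  under eq_tsum => z1 z2 do rwl (jsum_contract (G := fun p u =>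
    ((alpha (y2 * p * z1) : k) *:
      G (beta K3 (r1 * u * s1) M3) (beta (K1 * y1) (M2 * (r2 * s2) * K2) (z2 * M1))))).
  rewrite !mulr1.
  by rwl (alpha_sepl HX y2 (G := fun z2 =>
      G (beta K3 (r1 * s1) M3) (beta (K1 * y1) (M2 * (r2 * s2) * K2) (z2 * M1)))).
rwl (RR' (G := fun u v => jsum (fun K1 K2 K3 => jsum (fun M1 M2 M3 =>
      G (beta K3 u M3) (beta (K1 * y1) (M2 * v * K2) (y2 * M1)))))).
by do 2 under1; rewrite mulr1.
Qed.
End Inverse.

Local Notation m := (@mulB k H A).
Local Notation m2 := (tmul m m).
Local Notation m3 := (tmul m2 m).

Let bm : bil m. Proof. by split; [exact: lm1|exact: lm2]. Qed.
Let bm2 : bil m2. Proof. exact: bil_tmul. Qed.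

Lemma m2A s t r : m2 (m2 s t) r = m2 s (m2 t r).
Proof.
apply: tensor_ext => W G bG; have [G1 G2] := bG.
rewrite tmul_tsum //.
rewrite (tmul_tsum _ _ _ _); last by lin.
rewrite tmul_tsum //; apply: eq_tsum => u v.
rewrite (tmul_tsum _ _ _ _); last by lin.
apply: eq_tsum => u' v'; apply: eq_tsum => u'' v''.
by rewrite !mulBA.
Qed.

Lemma tswap_m2 s t : tswap (m2 s t) = m2 (tswap s) (tswap t).
Proof.
apply: tensor_ext => W G bG; have [G1 G2] := bG.
rewrite tswap_tsum // (tmul_tsum _ _ _ _) //.
rewrite tmul_tsum //.
rewrite (tswap_tsum _); last by lin.
by apply: eq_tsum => u v; rwl (tswap_tsum t (G := fun u' v' => G (m v u') (m u v'))).
Qed.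

Lemma DeltaB_m2 s t : D (m s t) = m2 (D s) (D t).
Proof.
apply: tensor_ext => W G bG; have [G1 G2] := bG.
by rewrite tmul_tsum // (DeltaB_mul s t).
Qed.

Let bm3 : bil m3. Proof. exact: bil_tmul. Qed.

Lemma m3_tens s b t c : m3 (s ⊗ b) (t ⊗ c) = m2 s t ⊗ m b c.
Proof. exact: tmul_tens. Qed.

Lemma m2_tensr s u v : m2 s (u ⊗ v) = \tsum_(s1 ⊗ s2 <- s) m s1 u ⊗ m s2 v.
Proof. by rewrite /tmul; apply: eq_tsum => s1 s2; rwl tsum_tens. Qed.

Lemma m2_tensl s u v : m2 (u ⊗ v) s = \tsum_(s1 ⊗ s2 <- s) m u s1 ⊗ m v s2.
Proof. by rewrite /tmul; rwl tsum_tens. Qed.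

Lemma qtwha_of_involutive :
  is_quasitriangular_weak_hopf_algebra m oneB D epsB SB RB.
Proof.
have lt3 : tril (fun u v w : B => u ⊗ v ⊗ w) by lin.
have D11 : m2 (D oneB) (D oneB) = D oneB by rewrite -DeltaB_m2 mulB1l.
have RD : m2 RB (D oneB) = RB.
  apply: tensor_ext => W G bG; have [G1 G2] := bG.
  by rewrite tmul_tsum // (RB_unitr).
have comm l : m2 (tswap (D l)) RB = m2 RB (D l).
  apply: tensor_ext => W G bG; have [G1 G2] := bG.
  rewrite !tmul_tsum //.
  rewrite (tswap_tsum _); last by lin.
  exact: (RB_comm l).
have DcR : m2 (tswap (D oneB)) RB = RB by rewrite comm.
split.
- split.
  + split.
    * split; [exact: lm1|exact: lm2|exact: mulBA|exact: mulB1l|exact: mulB1r].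
    * split; [exact: lDB|exact: leB| | |].
      - by move=> c; exact: (comul_coassocB c).
      - by move=> c; exact: (counitlB c (@lin_id _ _)).
      - by move=> c; exact: (counitrB c (@lin_id _ _)).
    * exact: DeltaB_m2.
    * rewrite -(DeltaB_one_mull) //.
      rewrite (tsum_push (bm3.2 _)) tsumC; apply: eq_tsum => u1 u2.
      rewrite m3_tens m2_tensr mulB1l (tsum_push (L := fun z => z ⊗ u2)); last by lin.
      by apply: eq_tsum => v1 v2; rewrite mulB1r.
    * rewrite -(DeltaB_one_mulr) //.
      rewrite (tsum_push (bm3.1 _)) tsumC; apply: eq_tsum => u1 u2.
      rewrite m3_tens.
      rewrite m2_tensl mulB1r (tsum_push (L := fun z => z ⊗ u2)); last by lin.
      by apply: eq_tsum => v1 v2; rewrite mulB1l.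
    * exact: counitl_mulB.
    * exact: counitr_mulB.
  + exact: lSB.
  + exact: antipoderB.
  + exact: antipodelB.
  + exact: antipode3B.
- by exists RB; rewrite DcR RD.
- exact: comm.
- rewrite (RB_comulr) // (tsum_push (bm3.1 _)).
  apply: eq_tsum => r1 r2; rewrite m3_tens.
  rewrite m2_tensl mulB1r (tsum_push (L := fun z => z ⊗ r2)); last by lin.
  by apply: eq_tsum => s1 s2; rewrite mulB1l.
- rewrite (RB_comull) // (tsum_push (bm3.1 _)).
  apply: eq_tsum => r1 r2; rewrite (tsum_push (bm3.2 _)).
  by apply: eq_tsum => s1 s2; rewrite m3_tens m2_tensr; rwl tsum_tens; rewrite mulB1l mulB1r.
have [R' [RR' R'R]] := R_inv HR.
have RbR : m2 (RbarB R') RB = D oneB.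
  apply: tensor_ext => W G bG; have [G1 G2] := bG.
  by rewrite tmul_tsum // (RbarB_mull R'R).
have RRb : m2 RB (RbarB R') = tswap (D oneB).
  apply: tensor_ext => W G bG; have [G1 G2] := bG.
  by rewrite tmul_tsum // (RbarB_mulr RR') // tswap_tsum.
(* Cutting RbarB down by Delta(1) and its opposite gives membership at once,
   and changes neither product with R_B since R_B absorbs both. *)
exists (m2 (m2 (D oneB) (RbarB R')) (tswap (D oneB))); split.
- by exists (RbarB R').
- by rewrite m2A DcR m2A RbR D11.
- by rewrite -m2A -m2A RD RRb -tswap_m2 D11.
Qed.
End WeakHopfB.

Theorem proposition3p6 (k : fieldType)
    (H : algType k) (Delta : H -> H ⊗ H) (eps : H -> k) (S : H -> H)
    (R : H ⊗ H)
    (A : algType k) (act : {bilinear H -> A -> A}) (x : A ⊗ A) :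
  has_pchar0 k ->
  is_hopf_algebra Delta eps S ->
  is_quasitriangular Delta R ->
  semisimple_ring H ->
  is_module_algebra Delta eps act ->
  quantum_commutative R act ->
  is_symmetric_separability_idempotent x ->
  is_quasitriangular_weak_hopf_algebra
    (@mulB k H A) (oneB H x)
    (DeltaB Delta R act x) (epsB eps x) (SB S R act x) (RB R act x).

Proof.
move=> char0 HH HR ss HA _ HX.
exact: (qtwha_of_involutive HH (antipode_involutive HH char0 ss) HR HA HX).
Qed.
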